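(* Let $K=R[x,y]/(x(x-p),y(y-p))$ be the Kleinian 4-ring over $R$, let $A=K+Rz\subset Q^4$ be its unique minimal over-ring, and let $R_{\alpha\beta}$ ($\alpha,\beta\in\{0,p\}$) be the rank one $K$-lattices on which $x$ acts as $\alpha$ and $y$ acts as $\beta$. For $k\in\mathbb Z$ write $M^k=\tau_K^kM$, where $\tau_K$ is the Auslander–Reiten translate of the category of $K$-lattices. Then for all integers $n,k$ the Tate cohomologies are: $$\widehat H^n(K,A^k)\simeq\begin{cases}\Bbbk^{\,n-k+1}&\text{if } n\ge k,\\ \Bbbk^{\,k-n}&\text{if } n<k;\end{cases}$$ $$\widehat H^n(K,R_{pp}^k)\simeq\begin{cases}\Bbbk^{\,|n-k|/2+1}&\text{if } n-k\neq 0 \text{ is even},\\ \Bbbk^{\,[\,|n-k|/2\,]}&\text{if } n-k\text{ is odd},\\ R/xyR=R/p^2R&\text{if } n=k;\end{cases}$$ and, if $(\alpha,\beta)\ne(p,p)$, $$\widehat H^n(K,R_{\alpha\beta}^k)\simeq\Bbbk^{\,[(|n-k|+1)/2]}.$$ Here $[\cdot]$ denotes the integer part.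
   Context: $R$ is a complete discrete valuation ring with prime element $p$, field of fractions $Q$ and residue field $\Bbbk=R/pR$. The Kleinian 4-ring is $K=R[x,y]/(x(x-p),y(y-p))$; it is embedded in $Q^4$ by $x\mapsto(p,p,0,0)$, $y\mapsto(p,0,p,0)$. Put $z=(p,0,0,0)\in Q^4$ (so $z\notin K$, $z^2=xy$) and $A=K+Rz$, a subring of $Q^4$ which is the unique minimal over-ring of $K$. A $K$-lattice (or $A$-lattice) is a module that is finitely generated and free over $R$. $R_{\alpha\beta}$, $\alpha,\beta\in\{0,p\}$, is $R$ as an $R$-module, with $xv=\alpha v$, $yv=\beta v$. The ring $K$ is a local Gorenstein ring. For a non-projective indecomposable $K$-lattice $M$, $\tau_KM$ is the indecomposable $K$-lattice $N$ for which there is an almost split sequence $0\to N\to E\to M\to0$ of $K$-lattices; for an indecomposable $A$-lattice $M$ one has $\tau_KM\simeq\Omega M$, the (first) syzygy of $M$ as a $K$-module. For $k<0$, $\tau_K^{k}$ denotes the $(-k)$-th power of the inverse translate $\tau_K^{-1}$, and $\tau_K^0M=M$. $R$ is regarded as a $K$-module via $x\mapsto p$, $y\mapsto p$ (i.e. $R=R_{pp}$); $H_n(K,M)=\mathrm{Tor}_n^K(R,M)$ and $H^n(K,M)=\mathrm{Ext}^n_K(R,M)$. The Tate cohomologies $\widehat H^n(K,M)$, $n\in\mathbb Z$, are the cohomologies of $\mathrm{Hom}_K(\widehat{\mathbf P},M)$, where $\widehat{\mathbf P}$ is the full resolution obtained from a resolution $\mathbf P$ of $R$ by finitely generated free $K$-modules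 with $P_0=K$ by setting $\widehat P_n=P_n$ for $n\ge0$, $\widehat P_n=\mathrm{Hom}_K(P_{-n-1},K)$ for $n<0$, with $d_0:\widehat P_0=K\to\widehat P_{-1}\simeq K$ multiplication by $xy$. Explicitly, $\widehat H^n(K,M)=H^n(K,M)$ for $n>0$; $\widehat H^n(K,M)=H_{-n-1}(K,M)$ for $n<-1$; $\widehat H^0(K,M)=M_{pp}/xyM$, where $M_{pp}=\{m\in M\mid xm=ym=pm\}$; $\widehat H^{-1}(K,M)=\{m\in M\mid xym=0\}/((x-p)M+(y-p)M)$. *)

(* Defs.v *)
From HB Require Import structures.
From mathcomp Require Import all_boot all_order all_algebra.
From mathcomp Require Import generic_quotient ring_quotient fraction.
From mathcomp Require Import boolp.

Set Implicit Arguments.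
Unset Strict Implicit.
Unset Printing Implicit Defensive.

Import GRing.Theory.
Local Open Scope ring_scope.
Local Open Scope quotient_scope.

(* [R] is a discrete valuation ring with prime element [p], and is complete:
   every p-adic Cauchy sequence converges (limits are unique, since the
   intersection of the ideals p^n R is zero in a discrete valuation ring).
   By passing to subsequences it is enough to consider the sequences with
   s (n+1) = s n modulo p^n. *)
Definition complete_dvr (R : idomainType) (p : R) : Prop :=
  [/\ p != 0,
      p \isn't a GRing.unit,
      forall a : R, a != 0 ->
        exists n : nat, exists2 u : R, u \is a GRing.unit & a = u * p ^+ n
    & forall s : nat -> R,
        (forall n, exists c, s n.+1 - s n = p ^+ n * c) ->
        exists l : R, forall n, exists c, l - s n = p ^+ n * c].

Section ModuleQuotient.
Variables (R : comNzRingType) (V : lmodType R).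
Variables (T : {pred V}) (submodT : submod_closed T).

Definition submod_pred (_ : submod_closed T) : {pred V} := T.
Local Notation S := (submod_pred submodT).
HB.instance Definition _ := GRing.isSubmodClosed.Build R V S submodT.

Definition lmod_quot : Type := Quotient.quot S.
HB.instance Definition _ := GRing.Zmodule.on lmod_quot.

Definition lmod_pi (v : V) : lmod_quot := \pi_(Quotient.quot S) v.
Definition quot_scale (c : R) (q : lmod_quot) : lmod_quot :=
  lmod_pi (c *: repr (q : Quotient.quot S)).

Lemma lmod_pi_eq (u v : V) : (lmod_pi u = lmod_pi v) <-> (u - v \in T).
Proof.
rewrite (@Quotient.idealrBE V S u v); split=> [h|/eqP //]; exact/eqP.
Qed.

Lemma lmod_piK (q : lmod_quot) : lmod_pi (repr (q : Quotient.quot S)) = q.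
Proof. exact: reprK. Qed.

Lemma lmod_piD : {morph lmod_pi : u v / u + v}.
Proof. by move=> u v; rewrite /lmod_pi raddfD. Qed.

Lemma quot_scale_pi c v : quot_scale c (lmod_pi v) = lmod_pi (c *: v).
Proof.
apply/lmod_pi_eq; rewrite -scalerBr.
have [T0 Tlin] := submodT; rewrite -[_ *: _]addr0; apply: Tlin => //.
by apply/lmod_pi_eq; rewrite lmod_piK.
Qed.

Fact quot_scaleA a b q : quot_scale a (quot_scale b q) = quot_scale (a * b) q.
Proof. by rewrite -[q]lmod_piK !quot_scale_pi scalerA. Qed.
Fact quot_scale1 : left_id 1 quot_scale.
Proof. by move=> q; rewrite -[q]lmod_piK quot_scale_pi scale1r. Qed.
Fact quot_scaleDr : right_distributive quot_scale +%R.
Proof.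
move=> c q r; rewrite -[q]lmod_piK -[r]lmod_piK.
by rewrite -lmod_piD !quot_scale_pi scalerDr lmod_piD.
Qed.
Fact quot_scaleDl q : {morph quot_scale^~ q : a b / a + b}.
Proof. by move=> a b; rewrite -[q]lmod_piK !quot_scale_pi scalerDl lmod_piD. Qed.

HB.instance Definition _ := GRing.Zmodule_isLmodule.Build R lmod_quot
  quot_scaleA quot_scale1 quot_scaleDr quot_scaleDl.

Fact lmod_pi_linear : linear lmod_pi.
Proof. by move=> c u v; rewrite lmod_piD -quot_scale_pi. Qed.
HB.instance Definition _ := GRing.isLinear.Build R V lmod_quot _ lmod_pi
  lmod_pi_linear.

End ModuleQuotient.

Definition lmod_iso (R : nzRingType) (U V : lmodType R) : Prop :=
  exists f : {linear U -> V}, bijective f.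

Section Homology.
Variables (R : comNzRingType) (U V W : lmodType R).
Variables (f : {linear U -> V}) (g : {linear V -> W}).

Definition in_ker : {pred V} := fun v => g v == 0.
Fact in_ker_submod : submod_closed in_ker.
Proof.
split=> [|c u v]; first by rewrite unfold_in /in_ker linear0.
rewrite !unfold_in /in_ker => /eqP gu /eqP gv.
by rewrite linearP gu gv scaler0 addr0.
Qed.
HB.instance Definition _ := GRing.isSubmodClosed.Build R V in_ker in_ker_submod.

Definition ker_mod : Type := {v : V | in_ker v}.
HB.instance Definition _ := SubChoice.on ker_mod.
HB.instance Definition _ := [SubChoice_isSubLmodule of ker_mod by <:].

Definition in_im : {pred ker_mod} := fun v => `[< exists u, f u = val v >].
Fact in_im_submod : submod_closed in_im.
Proof.
split=> [|c v w].
  by apply/asboolP; exists 0; rewrite linear0 raddf0.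
move=> /asboolP[u1 h1] /asboolP[u2 h2]; apply/asboolP; exists (c *: u1 + u2).
by rewrite linearP h1 h2 linearP.
Qed.

(* ker g / im f; used below only when g \o f = 0 *)
Definition homology : lmodType R := lmod_quot in_im_submod.

End Homology.

Section Cyclic.
Variables (R : comNzRingType) (q : R).

Definition multiples : {pred R^o} := fun a => `[< exists b : R, a = q * b >].
Fact multiples_submod : submod_closed multiples.
Proof.
split=> [|c u v]; first by apply/asboolP; exists 0; rewrite mulr0.
move=> /asboolP[a ->] /asboolP[b ->]; apply/asboolP; exists (c * a + b).
by rewrite mulrDr mulrCA.
Qed.

(* the R-module R / qR *)
Definition cyclic_mod : lmodType R := lmod_quot multiples_submod.

(* the R-module (R / qR)^m *)
Definition cyclic_pow (m : nat) : lmodType R := {ffun 'I_m -> cyclic_mod}.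
End Cyclic.

Section KleinianRing.
Variables (R : idomainType) (p : R).

(* R[x,y] is {poly {poly R}}, with x the inner and y the outer variable. *)
Definition polX : {poly {poly R}} := 'X%:P.
Definition polY : {poly {poly R}} := 'X.
Definition polC (c : R) : {poly {poly R}} := c%:P%:P.

Definition kleinian_ideal : {pred {poly {poly R}}} := fun q =>
  `[< exists a b : {poly {poly R}},
        q = a * (polX * (polX - polC p)) + b * (polY * (polY - polC p)) >].

(* the value p or 0 of a character at x or y *)
Definition pz (b : bool) : R := if b then p else 0.

Definition eval_at (a b : bool) (q : {poly {poly R}}) : R :=
  q.[(pz b)%:P].[pz a].

Fact eval_at_zmod_morphism a b : zmod_morphism (eval_at a b).
Proof. by move=> q r; rewrite /eval_at !hornerE. Qed.
Fact eval_at_monoid_morphism a b : monoid_morphism (eval_at a b).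
Proof. by split=> [|q r]; rewrite /eval_at !hornerE. Qed.
HB.instance Definition _ a b := GRing.isZmodMorphism.Build
  {poly {poly R}} R (eval_at a b) (eval_at_zmod_morphism a b).
HB.instance Definition _ a b := GRing.isMonoidMorphism.Build
  {poly {poly R}} R (eval_at a b) (eval_at_monoid_morphism a b).

Lemma eval_atX a b : eval_at a b polX = pz a.
Proof. by rewrite /eval_at /polX !hornerE. Qed.
Lemma eval_atY a b : eval_at a b polY = pz b.
Proof. by rewrite /eval_at /polY !hornerE. Qed.
Lemma eval_atC a b c : eval_at a b (polC c) = c.
Proof. by rewrite /eval_at /polC !hornerE. Qed.

Lemma eval_at_ideal a b q : q \in kleinian_ideal -> eval_at a b q = 0.
Proof.
move=> /asboolP[u [v ->]]; rewrite rmorphD !rmorphM !rmorphB /=.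
rewrite eval_atX eval_atY !eval_atC /pz.
by case: a; case: b; rewrite ?subrr ?mul0r ?mulr0 ?addr0.
Qed.

Fact kleinian_idealP : idealr_closed kleinian_ideal.
Proof.
split=> [||c u v].
- by apply/asboolP; exists 0, 0; rewrite !mul0r addr0.
- apply/negP=> /(@eval_at_ideal false false) /eqP.
  by rewrite rmorph1 oner_eq0.
- move=> /asboolP[a1 [b1 ->]] /asboolP[a2 [b2 ->]]; apply/asboolP.
  exists (c * a1 + a2), (c * b1 + b2).
  by rewrite mulrDr !mulrA !mulrDl addrACA.
Qed.
HB.instance Definition _ :=
  isIdealr.Build {poly {poly R}} kleinian_ideal kleinian_idealP.

Definition K : comNzRingType := {ideal_quot kleinian_ideal}.

Definition Kpi (q : {poly {poly R}}) : K :=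
  \pi_{ideal_quot kleinian_ideal} q.
Definition Krepr (a : K) : {poly {poly R}} :=
  repr (a : {ideal_quot kleinian_ideal}).

Lemma KreprK a : Kpi (Krepr a) = a.
Proof. exact: reprK. Qed.
Fact Kpi_zmod_morphism : zmod_morphism Kpi.
Proof. by move=> q r; rewrite /Kpi raddfB. Qed.
Fact Kpi_monoid_morphism : monoid_morphism Kpi.
Proof. by split=> [|q r]; rewrite /Kpi ?rmorph1 ?rmorphM. Qed.
HB.instance Definition _ :=
  GRing.isZmodMorphism.Build {poly {poly R}} K Kpi Kpi_zmod_morphism.
HB.instance Definition _ :=
  GRing.isMonoidMorphism.Build {poly {poly R}} K Kpi Kpi_monoid_morphism.

Definition xK : K := Kpi polX.
Definition yK : K := Kpi polY.

Definition RtoK (c : R) : K := Kpi (polC c).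
Fact RtoK_zmod_morphism : zmod_morphism RtoK.
Proof. by move=> c d; rewrite /RtoK /polC !rmorphB. Qed.
Fact RtoK_monoid_morphism : monoid_morphism RtoK.
Proof. by split=> [|c d]; rewrite /RtoK /polC ?rmorph1 ?rmorphM. Qed.
HB.instance Definition _ :=
  GRing.isZmodMorphism.Build R K RtoK RtoK_zmod_morphism.
HB.instance Definition _ :=
  GRing.isMonoidMorphism.Build R K RtoK RtoK_monoid_morphism.

(* The R-algebra morphism K -> R with x |-> pz a and y |-> pz b. *)
Definition chi (a b : bool) (u : K) : R := eval_at a b (Krepr u).

Lemma chi_pi a b q : chi a b (Kpi q) = eval_at a b q.
Proof.
apply/eqP; rewrite -subr_eq0 -rmorphB; apply/eqP/eval_at_ideal.
rewrite (Quotient.idealrBE kleinian_ideal); apply/eqP.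
exact: (KreprK (Kpi q)).
Qed.

Lemma chi_x a b : chi a b xK = pz a.
Proof. by rewrite chi_pi eval_atX. Qed.
Lemma chi_y a b : chi a b yK = pz b.
Proof. by rewrite chi_pi eval_atY. Qed.
Lemma chi_C a b c : chi a b (RtoK c) = c.
Proof. by rewrite chi_pi eval_atC. Qed.

Fact chi_zmod_morphism a b : zmod_morphism (chi a b).
Proof.
by move=> u v; rewrite -[u]KreprK -[v]KreprK -rmorphB !chi_pi rmorphB.
Qed.
Fact chi_monoid_morphism a b : monoid_morphism (chi a b).
Proof.
split=> [|u v]; first by rewrite -(rmorph1 Kpi) chi_pi rmorph1.
by rewrite -[u]KreprK -[v]KreprK -rmorphM !chi_pi rmorphM.
Qed.
HB.instance Definition _ a b :=
  GRing.isZmodMorphism.Build K R (chi a b) (chi_zmod_morphism a b).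
HB.instance Definition _ a b :=
  GRing.isMonoidMorphism.Build K R (chi a b) (chi_monoid_morphism a b).

(* R_{alpha beta}, with alpha = pz a and beta = pz b *)
Definition Rchar_sort (a b : bool) : Type := R.
HB.instance Definition _ a b := GRing.Zmodule.copy (Rchar_sort a b) R.

Definition Rchar_scale a b (u : K) (v : Rchar_sort a b) : Rchar_sort a b :=
  chi a b u * (v : R).
Fact Rchar_scaleA a b u v w :
  @Rchar_scale a b u (@Rchar_scale a b v w) = Rchar_scale (u * v) w.
Proof. by rewrite /Rchar_scale rmorphM mulrA. Qed.
Fact Rchar_scale1 a b : left_id 1 (@Rchar_scale a b).
Proof. by move=> v; rewrite /Rchar_scale rmorph1 mul1r. Qed.
Fact Rchar_scaleDr a b : right_distributive (@Rchar_scale a b) +%R.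
Proof. by move=> u v w; rewrite /Rchar_scale mulrDr. Qed.
Fact Rchar_scaleDl a b v : {morph (@Rchar_scale a b)^~ v : u w / u + w}.
Proof. by move=> u w; rewrite /Rchar_scale rmorphD mulrDl. Qed.
HB.instance Definition _ a b := GRing.Zmodule_isLmodule.Build K (Rchar_sort a b)
  (@Rchar_scaleA a b) (@Rchar_scale1 a b) (@Rchar_scaleDr a b)
  (@Rchar_scaleDl a b).

Definition Rchar (a b : bool) : lmodType K := Rchar_sort a b.

(* Q^4, with K acting through its embedding x |-> (p,p,0,0), y |-> (p,0,p,0) *)
Definition Q4_sort : Type :=
  ({fraction R} * {fraction R} * {fraction R} * {fraction R})%type.
HB.instance Definition _ := GRing.NzRing.on Q4_sort.

Definition mkQ4 (a b c d : R) : Q4_sort :=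
  (tofrac a, tofrac b, tofrac c, tofrac d).
Definition Kembed (u : K) : Q4_sort :=
  mkQ4 (chi true true u) (chi true false u)
       (chi false true u) (chi false false u).

Lemma Kembed_x : Kembed xK = mkQ4 p p 0 0.
Proof. by rewrite /Kembed !chi_x. Qed.
Lemma Kembed_y : Kembed yK = mkQ4 p 0 p 0.
Proof. by rewrite /Kembed !chi_y. Qed.

Fact Kembed_zmod_morphism : zmod_morphism Kembed.
Proof. by move=> u v; rewrite /Kembed /mkQ4 !rmorphB. Qed.
Fact Kembed_monoid_morphism : monoid_morphism Kembed.
Proof. by split=> [|u v]; rewrite /Kembed /mkQ4 ?rmorph1 ?rmorphM. Qed.
HB.instance Definition _ :=
  GRing.isZmodMorphism.Build K Q4_sort Kembed Kembed_zmod_morphism.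
HB.instance Definition _ :=
  GRing.isMonoidMorphism.Build K Q4_sort Kembed Kembed_monoid_morphism.

Definition Q4_scale (u : K) (v : Q4_sort) : Q4_sort := Kembed u * v.
Fact Q4_scaleA u v w : Q4_scale u (Q4_scale v w) = Q4_scale (u * v) w.
Proof. by rewrite /Q4_scale rmorphM mulrA. Qed.
Fact Q4_scale1 : left_id 1 Q4_scale.
Proof. by move=> v; rewrite /Q4_scale rmorph1 mul1r. Qed.
Fact Q4_scaleDr : right_distributive Q4_scale +%R.
Proof. by move=> u v w; rewrite /Q4_scale mulrDr. Qed.
Fact Q4_scaleDl v : {morph Q4_scale^~ v : u w / u + w}.
Proof. by move=> u w; rewrite /Q4_scale rmorphD mulrDl. Qed.
HB.instance Definition _ := GRing.Zmodule_isLmodule.Build K Q4_sort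
  Q4_scaleA Q4_scale1 Q4_scaleDr Q4_scaleDl.

Definition Q4 : lmodType K := Q4_sort.

Definition zQ4 : Q4_sort := mkQ4 p 0 0 0.

Lemma zQ4_sqr : zQ4 * zQ4 = Kembed (xK * yK).
Proof.
have -> : Kembed (xK * yK) = Kembed xK * Kembed yK by exact: rmorphM.
rewrite Kembed_x Kembed_y /zQ4 /mkQ4 rmorph0.
by congr (_, _, _, _); rewrite /= ?mulr0 ?mul0r.
Qed.

(* A = K + Rz; the scalar r acts on Q^4 as the element RtoK r of K *)
Definition in_A : {pred Q4} := fun v =>
  `[< exists (u : K) (r : R), v = Kembed u + Kembed (RtoK r) * zQ4 >].

Lemma Kembed_z u : Kembed u * zQ4 = Kembed (RtoK (chi true true u)) * zQ4.
Proof.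
rewrite /Kembed !chi_C /zQ4 /mkQ4 rmorph0.
by congr (_, _, _, _); rewrite /= !mulr0.
Qed.

Fact in_A_submod : submod_closed in_A.
Proof.
split=> [|c v w].
  by apply/asboolP; exists 0, 0; rewrite !rmorph0 mul0r addr0.
move=> /asboolP[u1 [r1 ->]] /asboolP[u2 [r2 ->]]; apply/asboolP.
exists (c * u1 + u2), (chi true true (c * RtoK r1) + r2).
have scaleE (t : Q4_sort) : c *: (t : Q4) = Kembed c * t by [].
rewrite scaleE mulrDr mulrA -!rmorphM (Kembed_z (c * RtoK r1)) [LHS]addrACA.
have KD (s t : K) : Kembed (s + t) = Kembed s + Kembed t by exact: rmorphD.
by rewrite KD (rmorphD RtoK) KD [in RHS]mulrDl.
Qed.
HB.instance Definition _ := GRing.isSubmodClosed.Build K Q4 in_A in_A_submod.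

Definition A_sort : Type := {v : Q4 | in_A v}.
HB.instance Definition _ := SubChoice.on A_sort.
HB.instance Definition _ := [SubChoice_isSubLmodule of A_sort by <:].

(* A as a K-module *)
Definition A : lmodType K := A_sort.

End KleinianRing.

Section Lattices.
Variables (R : idomainType) (p : R).
Local Notation K := (K p).
Implicit Types L M N E : lmodType K.

(* restriction of scalars along R -> K *)
Definition restr_sort (M : lmodType K) : Type := M.
HB.instance Definition _ M := GRing.Zmodule.on (restr_sort M).

Section Restr.
Variable M : lmodType K.
Definition restr_scale (c : R) (m : restr_sort M) : restr_sort M :=
  RtoK p c *: (m : M).
Fact restr_scaleA a b m :
  restr_scale a (restr_scale b m) = restr_scale (a * b) m.
Proof. by rewrite /restr_scale rmorphM scalerA. Qed.
Fact restr_scale1 : left_id 1 restr_scale.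
Proof. by move=> m; rewrite /restr_scale rmorph1 scale1r. Qed.
Fact restr_scaleDr : right_distributive restr_scale +%R.
Proof. by move=> a m m'; rewrite /restr_scale scalerDr. Qed.
Fact restr_scaleDl m : {morph restr_scale^~ m : a b / a + b}.
Proof. by move=> a b; rewrite /restr_scale rmorphD scalerDl. Qed.
HB.instance Definition _ := GRing.Zmodule_isLmodule.Build R (restr_sort M)
  restr_scaleA restr_scale1 restr_scaleDr restr_scaleDl.
End Restr.

Definition restr M : lmodType R := restr_sort M.

(* finitely generated and free over R *)
Definition lattice M : Prop :=
  exists (n : nat) (e : 'I_n -> restr M),
    forall m : restr M,
      exists! c : {ffun 'I_n -> R}, m = \sum_i c i *: e i.

Definition indecomposable M : Prop :=
  (exists m : M, m != 0) /\
  forall U V : lmodType K, lmod_iso M (U * V)%type ->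
    (forall u : U, u = 0) \/ (forall v : V, v = 0).

Definition split_epi L M (h : {linear L -> M}) : Prop :=
  exists s : {linear M -> L}, forall m, h (s m) = m.

Definition split_mono N L (h : {linear N -> L}) : Prop :=
  exists r : {linear L -> N}, forall n, r (h n) = n.

Definition right_almost_split E M (g : {linear E -> M}) : Prop :=
  ~ split_epi g /\
  forall L (h : {linear L -> M}), lattice L -> ~ split_epi h ->
    exists t : {linear L -> E}, forall l, g (t l) = h l.

Definition left_almost_split N E (f : {linear N -> E}) : Prop :=
  ~ split_mono f /\
  forall L (h : {linear N -> L}), lattice L -> ~ split_mono h ->
    exists t : {linear E -> L}, forall n, t (f n) = h n.

Definition almost_split_seq N E M
    (f : {linear N -> E}) (g : {linear E -> M}) : Prop :=
  [/\ lattice N, lattice E & lattice M] /\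
  [/\ injective f,
      forall e, g e = 0 <-> exists n, f n = e
    & forall m, exists e, g e = m] /\
  left_almost_split f /\ right_almost_split g.

(* N is (isomorphic to) tau_K M.  M is not projective, since an almost split
   sequence does not split. *)
Definition is_tau M N : Prop :=
  [/\ indecomposable M, indecomposable N
    & exists (E : lmodType K) (f : {linear N -> E}) (g : {linear E -> M}),
        almost_split_seq f g].

Fixpoint is_tau_iter (n : nat) M N : Prop :=
  if n is n'.+1 then exists2 L, is_tau_iter n' M L & is_tau L N
  else lmod_iso M N.

(* N is (isomorphic to) tau_K^k M; for k < 0 this means that M is
   tau_K^(-k) N. *)
Definition is_tau_pow (k : int) M N : Prop :=
  match k with
  | Posz n => is_tau_iter n M N
  | Negz n => is_tau_iter n.+1 N M
  end.

End Lattices.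

Section TateCohomology.
Variables (R : idomainType) (p : R).
Local Notation K := (K p).

(* A resolution P of R = R_pp by finitely generated free K-modules with
   P_0 = K.  P_n is the module of row vectors 'rV[K]_(res_rank P n), and the
   differential P_(n+1) -> P_n is right multiplication by res_d P n. *)
Definition rank_of (r : nat -> nat) (n : nat) : nat :=
  if n is n'.+1 then r n' else 1%N.

Record resolution := Resolution {
  res_rankS : nat -> nat;
  res_rank := rank_of res_rankS;
  res_d : forall n, 'M[K]_(res_rank n.+1, res_rank n);
  res_exact0 : forall v : 'rV[K]_(res_rank 0),
    chi true true (v ord0 ord0) = 0 <-> exists w, v = w *m res_d 0;
  res_exact : forall n (v : 'rV[K]_(res_rank n.+1)),
    v *m res_d n = 0 <-> exists w, v = w *m res_d n.+1
}.

Variable P : resolution.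

Definition int_succ (i : int) : int :=
  match i with
  | Posz n => Posz n.+1
  | Negz 0 => Posz 0%N
  | Negz n.+1 => Negz n
  end.

Lemma int_succE i : int_succ i = i + 1.
Proof.
case: i => [n|[|n]] //=; first by rewrite intS addrC.
by rewrite !NegzE [in RHS]intS opprD addrAC addNr add0r.
Qed.

(* The full resolution.  Negz n is the integer -(n+1), so that the module in
   degree Negz n is Hom_K(P_n, K), identified with row vectors by means of the
   dual basis; the dual of a differential is then the transposed matrix. *)
Definition full_rank (i : int) : nat :=
  match i with
  | Posz n => res_rank P n
  | Negz n => res_rank P n
  end.

Definition full_d (i : int) : 'M[K]_(full_rank (int_succ i), full_rank i) :=
  match i return 'M[K]_(full_rank (int_succ i), full_rank i) with
  | Posz n => res_d P n
  | Negz 0 => (xK p * yK p)%:M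
  | Negz n.+1 => (res_d P n)^T
  end.

Variable M : lmodType K.

(* Hom_K(K^r, M), a homomorphism being given by the images of the basis
   vectors, and its R-module structure *)
Definition cochain (i : int) : lmodType R :=
  {ffun 'I_(full_rank i) -> restr M}.

(* composition with the differential from degree i + 1 to degree i *)
Definition delta (i : int) (f : cochain i) : cochain (int_succ i) :=
  [ffun j => \sum_(l < full_rank i) full_d i j l *: (f l : M)].

Fact delta_linear i : linear (@delta i).
Proof.
have scaleE (c : R) (m : restr M) : c *: m = RtoK p c *: (m : M) by [].
move=> c f g; apply/ffunP=> j; rewrite !ffunE scaleE scaler_sumr -big_split /=.
apply: eq_bigr => l _; rewrite !ffunE scaleE scalerDr.
by rewrite !scalerA mulrC.
Qed.
HB.instance Definition _ i :=
  GRing.isLinear.Build R (cochain i) (cochain (int_succ i)) _ (@delta i)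
    (@delta_linear i).

(* int_succ (n - 1) is n, by int_succE *)
Definition tate_cohomology (n : int) : lmodType R :=
  homology (@delta (n - 1)) (@delta (int_succ (n - 1))).

End TateCohomology.

(* Main.v *)
(* For lattices over the symmetric R-algebra K, an almost split sequence
   0 -> N -> E -> M -> 0 forces N to be a direct summand of the syzygy of M, and M
   to be a direct summand of the cosyzygy of N: this follows from the nondegeneracy
   of the Tate pairing between stable Hom groups.  Dimension shifting therefore
   embeds H^n(N) and H^(n-1)(M) into each other, and iterating, H^n(M^k) and
   H^(n-k)(M) embed into each other.  The latter has finite length, so the two are
   isomorphic (no Krull-Schmidt argument is needed), and it remains to treat k = 0.
   There one computes with the tensor product of the periodic resolutions of R over
   R[x]/(x(x-p)) and R[y]/(y(y-p)).  With coefficients in R_ab it splits into small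
   pieces.  For A one uses 0 -> K -> A -> R/p -> 0: K is acyclic, and on R/p the
   differentials of this minimal resolution vanish. *)
Require Import Defs.
From HB Require Import structures.
From mathcomp Require Import all_boot all_order all_algebra ring.
From mathcomp Require Import ssrAC fraction boolp.

Set Implicit Arguments.
Unset Strict Implicit.
Unset Printing Implicit Defensive.

Import Order.TTheory GRing.Theory Num.Theory.
Local Open Scope ring_scope.

Local Notation "c %:K" := (RtoK _ c) (at level 2, left associativity, format "c %:K").

(** * The ring K and its symmetrizing form *)

Section KleinianElements.
Variables (R : idomainType) (p : R).
Hypothesis p0 : p != 0.
Local Notation K := (K p).
Local Notation x := (xK p).
Local Notation y := (yK p).

(** The translate is given only through almost split sequences, so no description of it as a syzygy
    is available in advance; relating such a sequence to free covers and hulls requires control of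
    the maps that factor through free modules. One operator does this. The element (x ⊗ 1 + 1 ⊗ x -
    p)(y ⊗ 1 + 1 ⊗ y - p) makes R-linear maps K-linear, and its image consists of the maps factoring
    through free modules. On K-linear maps it is multiplication by D = (2x - p)(2y - p), and (2x -
    p)^2 = p^2 because x^2 = px; hence D^2 = p^4. So tr(D h u) / p^4, with values in Q/R, is the
    trace of D^-1 h u, written without passing to the fraction field.

    The resolution is arbitrary. Exactness of its dual half is therefore derived from the
    self-injectivity of K before an explicit resolution can replace it. Finite length enters in the
    form that injective endomorphisms of (R/p)^m and R/p^2 are onto. The module R/p^2 arises because
    the splicing map xy acts on R_pp as p^2. *)

Lemma Kpi_ideal q : q \in kleinian_ideal p -> Kpi p q = 0.
Proof.
move=> Hq; rewrite -(rmorph0 (Kpi p)).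
apply/eqP; rewrite /Kpi -Quotient.idealrBE subr0; exact: Hq.
Qed.

Lemma xK_root : x * (x - p%:K) = 0.
Proof.
have := @Kpi_ideal (polX R * (polX R - polC p)).
rewrite rmorphM rmorphB /=; apply; apply/asboolP.
by exists 1, 0; rewrite mul0r addr0 mul1r.
Qed.

Lemma yK_root : y * (y - p%:K) = 0.
Proof.
have := @Kpi_ideal (polY R * (polY R - polC p)).
rewrite rmorphM rmorphB /=; apply; apply/asboolP.
by exists 0, 1; rewrite mul0r add0r mul1r.
Qed.

Lemma xK_sqr : x * x = p%:K * x.
Proof. by apply/eqP; rewrite -subr_eq0 -mulrBl mulrC xK_root. Qed.

Lemma yK_sqr : y * y = p%:K * y.
Proof. by apply/eqP; rewrite -subr_eq0 -mulrBl mulrC yK_root. Qed.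

Lemma K_basis (u : K) : exists a b c d : R,
  u = a%:K + b%:K * x + c%:K * y + d%:K * (x * y).
Proof.
rewrite -[u]KreprK; elim/poly_ind: (Krepr u) => [|q r [a [b [c [d IH]]]]].
  by exists 0, 0, 0, 0; rewrite !rmorph0 !mul0r !addr0.
have [a' [b' IHr]] : exists a b : R, Kpi p r%:P = a%:K + b%:K * x.
  elim/poly_ind: r => [|s t [a1 [b1 E]]].
    by exists 0, 0; rewrite !rmorph0 mul0r addr0.
  exists t, (a1 + p * b1).
  rewrite polyCD polyCM (rmorphD (Kpi p)) (rmorphM (Kpi p)). rewrite /= E.
  rewrite -[Kpi p 'X%:P]/x -[Kpi p t%:P%:P]/(t%:K) (rmorphD (RtoK p)).
  rewrite (rmorphM (RtoK p)) /=.
  have -> : (a1%:K + b1%:K * x) * x = a1%:K * x + b1%:K * (x * x) by ring.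
  rewrite xK_sqr; ring.
exists a', b', (a + p * c), (b + p * d).
rewrite (rmorphD (Kpi p)) (rmorphM (Kpi p)) /= IH IHr -[Kpi p 'X]/y.
rewrite !(rmorphD (RtoK p)) !(rmorphM (RtoK p)) /=.
have -> : (a%:K + b%:K * x + c%:K * y + d%:K * (x * y)) * y
   = a%:K * y + b%:K * (x * y) + c%:K * (y * y) + d%:K * (x * (y * y)) by ring.
rewrite yK_sqr; ring.
Qed.

Lemma chi_basis a b (t1 t2 t3 t4 : R) :
  chi a b (t1%:K + t2%:K * x + t3%:K * y + t4%:K * (x * y)) =
  t1 + t2 * pz p a + t3 * pz p b + t4 * (pz p a * pz p b).
Proof. by rewrite !(rmorphD, rmorphM) /= !chi_C chi_x chi_y. Qed.

(** The four values determine the coefficients on 1, x, y, xy by a triangular system with diagonal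
    1, p, p, p^2. Identities in K can thus be checked in R, one character at a time. *)
Lemma chi_inj (u v : K) : (forall a b, chi a b u = chi a b v) -> u = v.
Proof.
move=> E; apply/eqP; rewrite -subr_eq0; apply/eqP.
have {E} : forall a b, chi a b (u - v) = 0.
  by move=> a b; rewrite rmorphB /= E subrr.
have [t1 [t2 [t3 [t4 ->]]]] := K_basis (u - v) => E.
have := (E false false, E true false, E false true, E true true).
rewrite !chi_basis /pz !mulr0 !mul0r !mulr0 !addr0.
move=> [[[-> /eqP]]]; rewrite !add0r mulf_eq0 (negPf p0) orbF => /eqP -> /eqP.
rewrite !mul0r !add0r mulf_eq0 (negPf p0) orbF => /eqP -> /eqP.
rewrite !mul0r !add0r !mulf_eq0 (negPf p0) !orbF => /eqP ->.
by rewrite !rmorph0 !mul0r !addr0.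
Qed.

(** Inclusion-exclusion over the four characters cancels every term but that of xy, on which it
    gives p^2. *)
Fact topcoef_exists (u : K) : exists d : R,
  p ^+ 2 * d = chi true true u - chi true false u
                  - chi false true u + chi false false u.
Proof.
have [t1 [t2 [t3 [t4 ->]]]] := K_basis u; exists t4.
rewrite !chi_basis /pz; ring.
Qed.

(* The coefficient of xy; the form (u, v) |-> topcoef (u * v) is perfect. *)
Definition topcoef (u : K) : R := sval (cid (topcoef_exists u)).

Lemma topcoefE (u : K) : p ^+ 2 * topcoef u = chi true true u - chi true false u
                  - chi false true u + chi false false u.
Proof. exact: (svalP (cid (topcoef_exists u))). Qed.

Lemma topcoef_linear c (u v : K) :
  topcoef (c%:K * u + v) = c * topcoef u + topcoef v.
Proof.
apply: (mulfI (expf_neq0 2 p0)).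
rewrite mulrDr mulrCA !topcoefE !(rmorphD, rmorphM) /= !chi_C; ring.
Qed.

(** For the form [topcoef], the basis dual to 1, x, y, xy is (x-p)(y-p), y-p, x-p, 1. *)
Lemma topcoef_basis (u : K) : u = (topcoef (u * ((x - p%:K) * (y - p%:K))))%:K
  + (topcoef (u * (y - p%:K)))%:K * x + (topcoef (u * (x - p%:K)))%:K * y
  + (topcoef u)%:K * (x * y).
Proof.
apply: chi_inj => a b; rewrite chi_basis.
apply: (mulfI (expf_neq0 2 p0)).
have := topcoefE (u * ((x - p%:K) * (y - p%:K))).
have := topcoefE (u * (y - p%:K)).
have := topcoefE (u * (x - p%:K)).
have := topcoefE u.
rewrite !(rmorphM, rmorphB) /= !chi_C !chi_x !chi_y.
set t4 := topcoef (_ * (_ * _)); set t3 := topcoef (u * (y - _)).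
set t2 := topcoef (u * (x - _)); set t1 := topcoef u => E1 E2 E3 E4.
have -> : p ^+ 2 * (t4 + t3 * pz p a + t2 * pz p b + t1 * (pz p a * pz p b)) =
  p ^+ 2 * t4 + p ^+ 2 * t3 * pz p a + p ^+ 2 * t2 * pz p b
  + p ^+ 2 * t1 * (pz p a * pz p b) by ring.
rewrite E1 E2 E3 E4.
by case: a; case: b; rewrite /pz; ring.
Qed.

Lemma topcoef_nondeg (u : K) : (forall v : K, topcoef (v * u) = 0) -> u = 0.
Proof.
move=> E; rewrite (topcoef_basis u) ![u * _]mulrC !E -[topcoef u]/(topcoef u).
by rewrite -[u in topcoef u]mul1r E !rmorph0 !mul0r !addr0.
Qed.

Lemma chi_true_ker (u : K) : chi true true u = 0 ->
  exists v w : K, u = v * (x - p%:K) + w * (y - p%:K).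
Proof.
have [a [b [c [d ->]]]] := K_basis u; rewrite chi_basis /pz => E.
(* Here a = -(bp + cp + dp^2) by [E]; the terms dpx of the two products cancel. *)
exists ((b + d * p)%:K), (c%:K + d%:K * x).
apply: chi_inj => a' b'; rewrite chi_basis !(rmorphD, rmorphM, rmorphN) /=.
rewrite !chi_C chi_x chi_y.
apply/eqP; rewrite -subr_eq0; apply/eqP; rewrite -[RHS]E /pz; ring.
Qed.

End KleinianElements.

(** * R-linear maps and the Casimir operator *)

Section RestrictedLinear.
Variables (R : idomainType) (p : R).
Local Notation K := (K p).
Local Notation x := (xK p).
Local Notation y := (yK p).
Implicit Types L M N X Y Z : lmodType K.

(** A predicate on plain functions, so that R-linear and K-linear maps compose without passing to
    the restricted modules. *)
Definition Rlinear M X (f : M -> X) : Prop :=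
  forall (c : R) (u v : M), f (c%:K *: u + v) = c%:K *: f u + f v.

Section Theory.
Variables (M X : lmodType K) (f : M -> X).
Hypothesis flin : Rlinear f.

Lemma RlinearD u v : f (u + v) = f u + f v.
Proof. by have := flin 1 u v; rewrite rmorph1 !scale1r. Qed.

Lemma Rlinear0 : f 0 = 0.
Proof. by apply: (addrI (f 0)); rewrite -RlinearD !addr0. Qed.

Lemma RlinearZ c u : f (c%:K *: u) = c%:K *: f u.
Proof. by have := flin c u 0; rewrite Rlinear0 !addr0. Qed.

Lemma RlinearN u : f (- u) = - f u.
Proof. by apply/eqP; rewrite -addr_eq0 -RlinearD addNr Rlinear0. Qed.

Lemma RlinearB u v : f (u - v) = f u - f v.
Proof. by rewrite RlinearD RlinearN. Qed.

Lemma Rlinear_sum (I : finType) (F : I -> M) : f (\sum_i F i) = \sum_i f (F i).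
Proof. exact: (big_morph f RlinearD Rlinear0). Qed.

End Theory.

Lemma linear_Rlinear M X (f : {linear M -> X}) : Rlinear f.
Proof. by move=> c u v; rewrite linearP. Qed.

Lemma Rlinear_comp M X Z (g : X -> Z) (f : M -> X) :
  Rlinear g -> Rlinear f -> Rlinear (fun m => g (f m)).
Proof. by move=> gl fl c u v; rewrite fl gl. Qed.

Lemma Rlinear_id M : Rlinear (fun m : M => m).
Proof. by []. Qed.

Lemma Rlinear_add M X (f g : M -> X) :
  Rlinear f -> Rlinear g -> Rlinear (fun m => f m + g m).
Proof. by move=> fl gl c u v; rewrite fl gl scalerDr addrACA. Qed.

Lemma Rlinear_opp M X (f : M -> X) : Rlinear f -> Rlinear (fun m => - f m).
Proof. by move=> fl c u v; rewrite fl opprD scalerN. Qed.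

Lemma Rlinear_scale M X (f : M -> X) (a : K) :
  Rlinear f -> Rlinear (fun m => a *: f m).
Proof.
by move=> fl c u v; rewrite fl scalerDr !scalerA mulrC.
Qed.

Lemma Rlinear_prescale M X (f : M -> X) (a : K) :
  Rlinear f -> Rlinear (fun m => f (a *: m)).
Proof.
by move=> fl c u v; rewrite scalerDr scalerA mulrC -scalerA fl.
Qed.

Lemma linear_bundle M X (f : M -> X) : linear f ->
  exists g : {linear M -> X}, g =1 f.
Proof.
move=> fl.
pose Fm := GRing.isLinear.Build K M X _ f fl.
pose g : {linear M -> X} := HB.pack f Fm.
by exists g.
Qed.

Lemma Rlinear_linear M X (f : M -> X) : Rlinear f ->
  (forall m, f (x *: m) = x *: f m) -> (forall m, f (y *: m) = y *: f m) ->
  linear f.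
Proof.
move=> fl fx fy u m m'; rewrite (RlinearD fl); congr (_ + _).
have [a [b [c [d ->]]]] := K_basis u.
by rewrite !scalerDl !(RlinearD fl) -!scalerA !(RlinearZ fl) !(fx, fy).
Qed.

(** The action of a ⊗ 1 + 1 ⊗ a - p on R-linear maps. If a^2 = pa, its product with a ⊗ 1 - 1 ⊗ a is
    zero, so a twisted map commutes with a. *)
Definition twist M X (a : K) (f : M -> X) (m : M) : X :=
  a *: f m + f (a *: m) - p%:K *: f m.

Lemma twist_Rlinear M X a (f : M -> X) : Rlinear f -> Rlinear (twist a f).
Proof.
move=> fl; apply: Rlinear_add; last by apply: Rlinear_opp; apply: Rlinear_scale.
by apply: Rlinear_add; [apply: Rlinear_scale | apply: Rlinear_prescale].
Qed.

Lemma twist_commutes M X (a : K) (f : M -> X) : Rlinear f -> a * a = p%:K * a ->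
  forall m, twist a f (a *: m) = a *: twist a f m.
Proof.
move=> fl aa m; rewrite /twist scalerA aa -scalerA (RlinearZ fl) addrK.
by rewrite scalerBr scalerDr !scalerA aa [a * _]mulrC addrAC subrr add0r.
Qed.

Lemma twist_preserves M X (a b : K) (f : M -> X) :
  (forall m, f (b *: m) = b *: f m) ->
  forall m, twist a f (b *: m) = b *: twist a f m.
Proof.
move=> fb m; rewrite /twist scalerA mulrC -scalerA !fb scalerBr scalerDr.
by rewrite !scalerA [b * a]mulrC [b * RtoK _ _]mulrC.
Qed.

(* Composition with the Casimir element (x ox 1 + 1 ox x - p)(y ox 1 + 1 ox y - p)
   of K ox_R K, that is, the sum of the e_i f e_i^* over dual bases of the form
   topcoef. *)
Definition casimir M X (f : M -> X) : M -> X := twist x (twist y f).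

Lemma casimir_Rlinear M X (f : M -> X) : Rlinear f -> Rlinear (casimir f).
Proof. by move=> fl; do 2!apply: twist_Rlinear. Qed.

Lemma casimir_linear M X (f : M -> X) : Rlinear f -> linear (casimir f).
Proof.
move=> fl; apply: Rlinear_linear; first exact: casimir_Rlinear.
  by apply: twist_commutes (xK_sqr p); apply: twist_Rlinear.
by apply: twist_preserves; apply: twist_commutes (yK_sqr p).
Qed.

Lemma casimirE M X (f : M -> X) m : casimir f m =
  (x *: (y *: f m + f (y *: m) - p%:K *: f m)
  + (y *: f (x *: m) + f (y *: (x *: m)) - p%:K *: f (x *: m))
  - p%:K *: (y *: f m + f (y *: m) - p%:K *: f m)).
Proof. by []. Qed.

Lemma eq_casimir M X (f g : M -> X) : f =1 g -> casimir f =1 casimir g.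
Proof. by move=> fg m; rewrite !casimirE !fg. Qed.

Lemma casimir_postcomp M X Z (h : {linear X -> Z}) (f : M -> X) m :
  casimir (fun m => h (f m)) m = h (casimir f m).
Proof.
have twistE a (k : M -> X) m' : twist a (fun m => h (k m)) m' = h (twist a k m').
  by rewrite /twist (linearB h) (linearD h) !(linearZ_LR h).
have twistE' m' := twistE y f m'.
rewrite /casimir -twistE [LHS]/twist [RHS]/twist.
by rewrite !(twistE' m) (twistE' (x *: m)).
Qed.

Lemma casimir_precomp M X Z (h : {linear Z -> M}) (f : M -> X) z :
  casimir (fun z => f (h z)) z = casimir f (h z).
Proof. by rewrite !casimirE !(linearZ_LR h). Qed.

(* Equivalently, h factors through a free module. *)
Definition relatively_null M X (h : M -> X) : Prop :=
  exists2 f : M -> X, Rlinear f & h =1 casimir f.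

Definition short_exact N L X (i : {linear N -> L}) (q : {linear L -> X}) : Prop :=
  [/\ injective i, forall e, q e = 0 <-> exists n, i n = e
    & forall m, exists e, q e = m].

Lemma kernel_exists L X (q : {linear L -> X}) : exists (N : lmodType K)
  (i : {linear N -> L}), injective i /\ forall e, q e = 0 <-> exists n, i n = e.
Proof.
exists (ker_mod q), (val : {linear ker_mod q -> L}); split; first exact: val_inj.
move=> e; split=> [/eqP h|[n <-]]; first by exists (Sub e h); exact: SubK.
exact/eqP/(valP n).
Qed.

Lemma cokernel_exists N L (i : {linear N -> L}) : exists (X : lmodType K)
  (q : {linear L -> X}),
    (forall e, q e = 0 <-> exists n, i n = e) /\ forall m, exists e, q e = m.
Proof.
pose T : {pred L} := fun e => `[< exists n, i n = e >].
have Tsub : submod_closed T.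
  split=> [|c u v]; first by apply/asboolP; exists 0; rewrite linear0.
  move=> /asboolP[n <-] /asboolP[n' <-]; apply/asboolP.
  by exists (c *: n + n'); rewrite linearP.
exists (lmod_quot Tsub), (lmod_pi Tsub); split=> [e|m].
  rewrite -(linear0 (lmod_pi Tsub)) lmod_pi_eq subr0.
  by split=> [/asboolP|h] //; apply/asboolP.
by exists (generic_quotient.repr m); exact: lmod_piK.
Qed.

End RestrictedLinear.

(** * Linear algebra over R and homology *)

Section DiscreteValuation.
Variables (R : idomainType) (p : R).
Hypothesis hR : complete_dvr p.

Lemma dvr_p_neq0 : p != 0. Proof. by case: hR. Qed.

(** An element of least valuation; it serves as the pivot in the elimination of
    [kernel_retraction_nat]. *)
Lemma dvr_min_divides (S : R -> Prop) (a0 : R) : S a0 -> a0 != 0 ->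
  exists a, [/\ S a, a != 0 & forall b, S b -> exists q, b = q * a].
Proof.
case: hR => p0 pu val _ Sa0 a00.
pose P n := `[< exists2 a, S a & exists2 u, u \is a GRing.unit & a = u * p ^+ n >].
have exP : exists n, P n.
  have [n [u uu E]] := val _ a00.
  by exists n; apply/asboolP; exists a0 => //; exists u.
have [n /asboolP[a Sa [u uu aE]] minP] := ex_minnP exP.
exists a; split=> // [|b Sb].
  by rewrite aE mulf_neq0 ?expf_neq0 //; apply: contraTneq uu => ->; rewrite unitr0.
have [->|b0] := eqVneq b 0; first by exists 0; rewrite mul0r.
have [m [v vu bE]] := val _ b0.
have le_nm : (n <= m)%N.
  by apply: minP; apply/asboolP; exists b => //; exists v.
exists (v * p ^+ (m - n) * u^-1).
by rewrite bE aE [u * _]mulrC mulrA mulrAC mulrVK // -mulrA -exprD subnK.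
Qed.

(** The values of a functional form a principal ideal, so its kernel splits off. The functionals are
    treated one at a time, each restricted to the image of the retraction already found. *)
Lemma kernel_retraction_nat (V : lmodType R) (n : nat) (g : nat -> V -> R) :
  (forall i c u v, g i (c *: u + v) = c * g i u + g i v) ->
  exists r : V -> V, [/\ forall c u v, r (c *: u + v) = c *: r u + r v,
    forall i v, (i < n)%N -> g i (r v) = 0
    & forall v, (forall i, (i < n)%N -> g i v = 0) -> r v = v].
Proof.
move=> glin; elim: n => [|n [r [rlin rker rid]]].
  by exists id; split.
have [allz|/existsNP[v1 /eqP nz]] := pselect (forall v, g n (r v) = 0).
  exists r; split=> // [i v|v h].
    by rewrite ltnS leq_eqVlt => /orP[/eqP ->|/rker].
  by apply: rid => i lt_in; apply: h; apply: ltnW.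
have [|a [[v0 aE] a0 adiv]] :=
    @dvr_min_divides (fun a => exists v, a = g n (r v)) _ _ nz; first by exists v1.
have quo v : exists q, g n (r v) = q * a by apply: adiv; exists v.
pose q v := sval (cid (quo v)).
have qE v : g n (r v) = q v * a by exact: (svalP (cid (quo v))).
have qlin c u v : q (c *: u + v) = c * q u + q v.
  by apply: (mulIf a0); rewrite -qE rlin glin !qE mulrDl mulrA.
(* The vector [r v0] attains the generator [a] of the values of [g n] on the image of [r].
   Subtracting its multiple kills [g n] and stays in the kernel of the earlier functionals. *)
exists (fun v => r v - q v *: r v0); split=> [c u v|i v|v h].
- rewrite rlin qlin scalerDl opprD addrACA scalerBr scalerA.
  by congr (_ + _).
- have gB w1 w2 c : g i (w1 - c *: w2) = g i w1 - c * g i w2.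
    by rewrite addrC -scaleNr glin mulNr addrC.
  rewrite gB ltnS leq_eqVlt => /orP[/eqP -> |lt_in].
    by rewrite -aE qE subrr.
  by rewrite !rker // mulr0 subrr.
- have rv : r v = v by apply: rid => i lt_in; apply: h; apply: ltnW.
  have : q v * a = 0 by rewrite -qE rv h.
  by move/eqP; rewrite mulf_eq0 (negPf a0) orbF => /eqP ->; rewrite scale0r subr0.
Qed.

Lemma kernel_retraction (V : lmodType R) (I : finType) (g : I -> V -> R) :
  (forall i c u v, g i (c *: u + v) = c * g i u + g i v) ->
  exists r : V -> V, [/\ forall c u v, r (c *: u + v) = c *: r u + r v,
    forall i v, g i (r v) = 0
    & forall v, (forall i, g i v = 0) -> r v = v].
Proof.
move=> glin.
pose G k v := if insub k is Some j then g (@enum_val I predT j) v else 0.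
have Glin k c u v : G k (c *: u + v) = c * G k u + G k v.
  by rewrite /G; case: insub => [j|]; rewrite ?glin // mulr0 addr0.
have [r [rlin rker rid]] := kernel_retraction_nat #|I| Glin.
exists r; split=> // [i v|v h].
  have := rker (enum_rank i) v (ltn_ord _).
  by rewrite /G valK enum_rankK.
by apply: rid => k lt_k; rewrite /G insubT h.
Qed.

End DiscreteValuation.

(** * Homology modules handled through linear relations *)

Section Homology.
Variable R : comNzRingType.
Implicit Types U V W : lmodType R.

Definition lmod_embeds U V : Prop := exists f : {linear U -> V}, injective f.

Section Relation.
Variables (U V : lmodType R) (S : U -> V -> Prop).
Hypothesis Slin : forall c u v u' v',
  S u v -> S u' v' -> S (c *: u + u') (c *: v + v').
Hypothesis Stot : forall u, exists v, S u v.
Hypothesis S0 : forall u v, S u v -> (u = 0 <-> v = 0).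

Let f u : V := sval (cid (Stot u)).
Let fS u : S u (f u) := svalP (cid (Stot u)).

Lemma relation_functional u v v' : S u v -> S u v' -> v = v'.
Proof.
move=> Sv Sv'; have := Slin (-1) Sv Sv'.
rewrite !scaleN1r addNr => /S0 [h _]; apply/eqP.
by rewrite eq_sym -subr_eq0 addrC h.
Qed.

(** Maps in homology come from choices of representatives and lifts. A total linear relation that
    pairs zero only with zero, on both sides, is the graph of an injection, so independence of the
    choices is the hypothesis [S0] alone. *)
Lemma relation_embeds_graph : exists2 g : {linear U -> V}, injective g &
  forall u, S u (g u).
Proof.
have fl : linear f.
  by move=> c u v; apply: (relation_functional (fS _)); apply: Slin; apply: fS.
pose Fm := GRing.isLinear.Build R U V _ f fl.
pose g : {linear U -> V} := HB.pack f Fm.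
have gS w : S w (g w) by exact: fS.
exists g => // u v E; apply/eqP; rewrite -subr_eq0; apply/eqP.
by have [_] := S0 (gS (u - v)); apply; rewrite (linearB g) E subrr.
Qed.

Lemma relation_embeds : lmod_embeds U V.
Proof. by have [g ginj _] := relation_embeds_graph; exists g. Qed.

Lemma relation_iso : (forall v, exists u, S u v) -> lmod_iso U V.
Proof.
move=> onto; have [g ginj gS] := relation_embeds_graph; exists g.
have inv v : exists u, g u = v.
  by have [u Su] := onto v; exists u; apply: relation_functional (gS u) Su.
exists (fun v => sval (cid (inv v))) => [u|v]; last exact: (svalP (cid (inv v))).
by apply: ginj; exact: (svalP (cid (inv (g u)))).
Qed.

End Relation.

Section Classes.
Variables (U V W : lmodType R) (f : {linear U -> V}) (g : {linear V -> W}).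

Definition is_class (q : homology f g) (v : V) : Prop :=
  exists2 k : ker_mod g, val k = v & q = lmod_pi (in_im_submod f g) k.

Lemma is_class_cocycle q v : is_class q v -> g v = 0.
Proof. by case=> k <- _; apply/eqP; exact: (valP k). Qed.

Lemma class_of_cocycle v : g v = 0 -> exists q, is_class q v.
Proof.
by move/eqP=> h; exists (lmod_pi (in_im_submod f g) (Sub v h)), (Sub v h); rewrite ?SubK.
Qed.

Lemma class_repr q : exists v, is_class q v.
Proof.
exists (val (generic_quotient.repr q : ker_mod g)).
by exists (generic_quotient.repr q) => //; rewrite lmod_piK.
Qed.

Lemma is_class_linear c q v q' v' :
  is_class q v -> is_class q' v' -> is_class (c *: q + q') (c *: v + v').
Proof.
by move=> [k <- ->] [k' <- ->]; exists (c *: k + k'); rewrite linearP.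
Qed.

Lemma is_class0 q v : is_class q v -> (q = 0 <-> exists u, f u = v).
Proof.
move=> [k <- ->]; rewrite -(linear0 (lmod_pi (in_im_submod f g))).
rewrite lmod_pi_eq subr0.
by split=> [/asboolP|h] //; apply/asboolP.
Qed.

End Classes.

Section HomologyRelation.
Variables (U1 V1 W1 U2 V2 W2 : lmodType R).
Variables (f1 : {linear U1 -> V1}) (g1 : {linear V1 -> W1}).
Variables (f2 : {linear U2 -> V2}) (g2 : {linear V2 -> W2}).
Variable S : V1 -> V2 -> Prop.
Hypothesis Slin : forall c u v u' v',
  S u v -> S u' v' -> S (c *: u + u') (c *: v + v').
Hypothesis Stot : forall u, g1 u = 0 -> exists2 v, g2 v = 0 & S u v.
Hypothesis S0 : forall u v, g1 u = 0 -> g2 v = 0 -> S u v ->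
  ((exists a, f1 a = u) <-> exists b, f2 b = v).

Let S' (q : homology f1 g1) (q' : homology f2 g2) :=
  exists u v, [/\ is_class q u, is_class q' v & S u v].

Let S'lin c u v u' v' : S' u v -> S' u' v' -> S' (c *: u + u') (c *: v + v').
Proof.
move=> [a [b [ha hb hS]]] [a' [b' [ha' hb' hS']]].
by exists (c *: a + a'), (c *: b + b'); split; [apply: is_class_linear..|apply: Slin].
Qed.

Let S'tot u : exists v, S' u v.
Proof.
have [a ha] := class_repr u; have [b gb Sab] := Stot (is_class_cocycle ha).
by have [q hq] := class_of_cocycle f2 gb; exists q, a, b.
Qed.

Let S'0 u v : S' u v -> (u = 0 <-> v = 0).
Proof.
move=> [a [b [ha hb hS]]]; rewrite (is_class0 ha) (is_class0 hb).
by apply: S0 => //; apply: is_class_cocycle; eassumption.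
Qed.

Lemma homology_embeds : lmod_embeds (homology f1 g1) (homology f2 g2).
Proof. exact: relation_embeds S'lin S'tot S'0. Qed.

Lemma homology_iso : (forall v, g2 v = 0 -> exists2 u, g1 u = 0 & S u v) ->
  lmod_iso (homology f1 g1) (homology f2 g2).
Proof.
move=> onto; apply: relation_iso S'lin S'tot S'0 _ => v.
have [b hb] := class_repr v; have [a ga Sab] := onto _ (is_class_cocycle hb).
by have [q hq] := class_of_cocycle f1 ga; exists q, a, b.
Qed.

End HomologyRelation.

Section HomologyOnto.
Variables (U V W Z : lmodType R) (f : {linear U -> V}) (g : {linear V -> W}).
Variable S : V -> Z -> Prop.

Lemma homology_iso_onto :
  (forall c u v u' v', S u v -> S u' v' -> S (c *: u + u') (c *: v + v')) ->
  (forall u, g u = 0 -> exists v, S u v) ->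
  (forall v, exists2 u, g u = 0 & S u v) ->
  (forall u v, g u = 0 -> S u v -> ((exists a, f a = u) <-> v = 0)) ->
  lmod_iso (homology f g) Z.
Proof.
move=> Slin Stot Sonto S0.
apply: (@relation_iso _ _ (fun q z => exists2 u, is_class q u & S u z)).
- move=> c u v u' v' [a ha Sa] [a' ha' Sa']; exists (c *: a + a').
    exact: is_class_linear.
  exact: Slin.
- move=> u; have [a ha] := class_repr u.
  by have [z Sz] := Stot _ (is_class_cocycle ha); exists z, a.
- move=> u v [a ha Sa]; rewrite (is_class0 ha).
  by apply: S0 => //; apply: is_class_cocycle ha.
- move=> z; have [a ga Sa] := Sonto z.
  by have [q hq] := class_of_cocycle f ga; exists q, a.
Qed.

End HomologyOnto.

Lemma lmod_iso_sym U V : lmod_iso U V -> lmod_iso V U.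
Proof.
move=> [f [g fK gK]]; apply: (@relation_iso _ _ (fun v u => f u = v)).
- by move=> c u v u' v' <- <-; rewrite linearP.
- by move=> v; exists (g v).
- move=> v u <-; split=> [h|->]; last by rewrite linear0.
  by rewrite -[u]fK h -(linear0 f) fK.
- by move=> u; exists (f u).
Qed.

Lemma lmod_iso_trans U V W : lmod_iso U V -> lmod_iso V W -> lmod_iso U W.
Proof.
by move=> [f fb] [g gb]; exists (g \o f : {linear _ -> _}); apply: bij_comp.
Qed.

Lemma lmod_iso_embeds U V : lmod_iso U V -> lmod_embeds U V.
Proof. by move=> [f /bij_inj]; exists f. Qed.

Lemma lmod_embeds_trans U V W : lmod_embeds U V -> lmod_embeds V W -> lmod_embeds U W.
Proof.
by move=> [f fi] [g gi]; exists (g \o f : {linear _ -> _}); apply: inj_comp.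
Qed.

(** The composite U -> V -> U is injective, hence onto, so the embedding V -> U is already onto. *)
Lemma coHopfian_sandwich U V :
  (forall f : {linear U -> U}, injective f -> forall v, exists u, f u = v) ->
  lmod_embeds U V -> lmod_embeds V U -> lmod_iso V U.
Proof.
move=> coH [f fi] [g gi].
have onto v : exists w, g w = v.
  have [u E] := coH (g \o f : {linear _ -> _}) (inj_comp gi fi) v.
  by exists (f u).
exists g; exists (fun v => sval (cid (onto v))) => [u|v].
  by apply: gi; exact: (svalP (cid (onto (g u)))).
exact: (svalP (cid (onto v))).
Qed.

End Homology.

(** * Lattices *)

Section Lattices.
Variables (R : idomainType) (p : R).
Hypothesis p0 : p != 0.
Local Notation K := (K p).
Local Notation x := (xK p).
Local Notation y := (yK p).
Implicit Types L M N X Y Z : lmodType K.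

Definition basis_on M (I : finType) (e : I -> M) (co : I -> M -> R) : Prop :=
  [/\ forall i c u v, co i (c%:K *: u + v) = c * co i u + co i v,
      forall m, m = \sum_i (co i m)%:K *: e i
    & forall i j, co i (e j) = (i == j)%:R].

Lemma coord_sum M (I J : finType) (e : I -> M) co (F : J -> M) (c : J -> R) i :
  basis_on e co -> co i (\sum_j (c j)%:K *: F j) = \sum_j c j * co i (F j).
Proof.
move=> [lin _ _].
have D u v : co i (u + v) = co i u + co i v.
  by have := lin i 1 u v; rewrite rmorph1 scale1r mul1r.
have Z0 : co i 0 = 0 by apply: (addrI (co i 0)); rewrite -D !addr0.
rewrite (big_morph (co i) D Z0); apply: eq_bigr => j _.
by have := lin i (c j) (F j) 0; rewrite Z0 !addr0.
Qed.

Lemma coord_basis_sum M (I : finType) (e : I -> M) co (c : I -> R) i :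
  basis_on e co -> co i (\sum_j (c j)%:K *: e j) = c i.
Proof.
move=> be; rewrite (coord_sum _ _ _ be); have [_ _ dual] := be.
rewrite (bigD1 i) //= dual eqxx mulr1 big1 ?addr0 // => j ne_ji.
by rewrite dual eq_sym (negPf ne_ji) mulr0.
Qed.

Lemma lattice_basis M : lattice M ->
  exists n (e : 'I_n -> M) co, basis_on e co.
Proof.
case=> n [e H]; exists n, e.
have scaleE (c : R) (m : restr M) : c *: m = c%:K *: (m : M) by [].
pose co i m : R := sval (cid (H m)) i.
have coE (m : M) : m = \sum_i (co i m)%:K *: e i.
  by have [E _] := svalP (cid (H m)).
have uniq (m : M) (c : 'I_n -> R) : m = \sum_i (c i)%:K *: e i -> forall i, co i m = c i.
  move=> E i; have [_ U] := svalP (cid (H m)).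
  have /U E' : m = \sum_i [ffun i => c i] i *: e i :> restr M.
    by rewrite [LHS]E; apply: eq_bigr => j _; rewrite ffunE.
  by rewrite /co E' ffunE.
exists co; split=> // [i c u v|i j].
  apply: (uniq _ (fun i => c * co i u + co i v)); rewrite {1}(coE u) {1}(coE v) scaler_sumr -big_split /=.
  by apply: eq_bigr => j _; rewrite scalerA -rmorphM -scalerDl -rmorphD.
apply: (uniq _ (fun i => (i == j)%:R)).
rewrite (bigD1 j) //= eqxx rmorph1 scale1r big1 ?addr0 // => k /negPf ->.
by rewrite rmorph0 scale0r.
Qed.

Lemma basis_lattice M (I : finType) (e : I -> M) co : basis_on e co -> lattice M.
Proof.
move=> be; have [lin ex dual] := be.
exists #|I|, (fun k => e (enum_val k)) => m.
have reidx (c : I -> R) : \sum_(k < #|I|) (c (enum_val k))%:K *: e (enum_val k)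
    = \sum_i (c i)%:K *: e i.
  by rewrite [RHS](reindex (@enum_val I predT)) //=; apply: onW_bij; apply: enum_val_bij.
exists [ffun k => co (enum_val k) m]; split.
  rewrite [LHS](ex m) -reidx; apply: eq_bigr => k _.
  by rewrite ffunE.
move=> c E; apply/ffunP => k; rewrite ffunE.
have -> : m = \sum_i (c (enum_rank i))%:K *: e i.
  by rewrite [LHS]E -reidx; apply: eq_bigr => j _; rewrite enum_valK.
by rewrite (coord_basis_sum _ _ be) enum_valK.
Qed.

(** The [f j] and [g j] are the injections and projections of an R-decomposition of Y into copies of
    M. Syzygies and cosyzygies below are three such copies. *)
Lemma lattice_direct_sum M Y (J : finType) (f : J -> M -> Y) (g : J -> Y -> M) :
  (forall j, Rlinear (f j)) -> (forall j, Rlinear (g j)) ->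
  (forall j k m, g j (f k m) = if j == k then m else 0) ->
  (forall u, u = \sum_j f j (g j u)) -> lattice M -> lattice Y.
Proof.
move=> fl gl gf fg /lattice_basis [n [e [co be]]]; have [lin ex dual] := be.
have Z0 i : co i 0 = 0.
  have := coord_basis_sum (fun=> 0) i be.
  by rewrite big1 // => j _; rewrite rmorph0 scale0r.
apply: (@basis_lattice _ (J * 'I_n)%type (fun k => f k.1 (e k.2))
          (fun k u => co k.2 (g k.1 u))).
split=> [[j i] c u v|u|[j i] [j' i']] /=.
- by rewrite gl lin.
- rewrite {1}[u]fg -(pair_bigA _ (fun j i => (co i (g j u))%:K *: f j (e i))) /=.
  apply: eq_bigr => j _; rewrite {1}(ex (g j u)) (Rlinear_sum (fl j)).
  by apply: eq_bigr => i _; rewrite (RlinearZ (fl j)).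
- rewrite gf -[(j, i) == _]/((j == j') && (i == i')).
  by case: (j == j'); rewrite ?dual ?Z0.
Qed.

(** A basis of X lifts to L, which gives [s]; then e - s (q e) lies in the image of i, which gives
    [r]. *)
Lemma short_exact_Rsplit N L X (i : {linear N -> L}) (q : {linear L -> X}) :
  short_exact i q -> lattice X ->
  exists s r, [/\ Rlinear s, Rlinear r, forall m, q (s m) = m, forall n, r (i n) = n
    & forall e, e = i (r e) + s (q e)].
Proof.
move=> [inj ker onto] /lattice_basis [n [e [co be]]]; have [lin ex dual] := be.
have [t tE] := choice onto.
pose s m := \sum_k (co k m)%:K *: t (e k).
have sl : Rlinear s.
  move=> c u v; rewrite /s scaler_sumr -big_split /=; apply: eq_bigr => k _.
  by rewrite lin rmorphD rmorphM scalerDl scalerA.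
have qs m : q (s m) = m.
  rewrite linear_sum [RHS](ex m); apply: eq_bigr => k _.
  by rewrite linearZ /= tE.
have exr u : exists v, i v = u - s (q u).
  by apply/ker; rewrite linearB qs subrr.
have [r rE] := choice exr.
have rl : Rlinear r.
  move=> c u v; apply: inj.
  rewrite (linearP i) !rE (linearP q) sl scalerBr opprD.
  by rewrite [RHS]addrACA.
exists s, r; split=> // [m|u]; last by rewrite rE subrK.
apply: inj; rewrite rE (_ : q (i m) = 0) ?(Rlinear0 sl) ?subr0 //.
by apply/ker; exists m.
Qed.

Definition Kfree (n : nat) : lmodType K := {ffun 'I_n -> K^o}.

Definition topcoef_map n (w : Kfree n) : Kfree n :=
  [ffun i => (topcoef (w i))%:K : K^o].

Lemma topcoefD (u v : K) : topcoef (u + v) = topcoef u + topcoef v.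
Proof. by have := topcoef_linear p0 1 u v; rewrite rmorph1 !mul1r. Qed.

Lemma topcoef0 : topcoef (0 : K) = 0.
Proof. by apply: (addrI (topcoef (0 : K))); rewrite -topcoefD !addr0. Qed.

Lemma topcoefZ c (u : K) : topcoef (c%:K * u) = c * topcoef u.
Proof. by have := topcoef_linear p0 c u 0; rewrite topcoef0 !addr0. Qed.

Lemma topcoefN (u : K) : topcoef (- u) = - topcoef u.
Proof. by apply/eqP; rewrite -addr_eq0 -topcoefD addNr topcoef0. Qed.

Lemma topcoef_map_Rlinear n : Rlinear (@topcoef_map n).
Proof.
move=> c u v; apply/ffunP => i; rewrite !ffunE (topcoef_linear p0).
by rewrite rmorphD rmorphM.
Qed.

(** The expansion of u in dual bases, read as an identity of operators: the identity of K is the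
    image of [topcoef] under the Casimir operator. This is how freeness is used from here on. *)
Lemma casimir_topcoef (u : K) :
  casimir (fun v : K^o => (topcoef (v : K))%:K : K^o) u = u.
Proof.
rewrite [RHS](topcoef_basis p0 u).
have -> : u * ((x - p%:K) * (y - p%:K)) = y * (x * u) + - (p%:K * (x * u))
   + - (p%:K * (y * u)) + p%:K * (p%:K * u).
  by move: (xK p) (yK p) => v w; ring.
have -> : u * (y - p%:K) = y * u + - (p%:K * u) by move: (yK p) => v; ring.
have -> : u * (x - p%:K) = x * u + - (p%:K * u) by move: (xK p) => v; ring.
rewrite !topcoefD !topcoefN !topcoefZ.
transitivity (x * (y * (topcoef u)%:K + (topcoef (y * u))%:K - p%:K * (topcoef u)%:K)
  + (y * (topcoef (x * u))%:K + (topcoef (y * (x * u)))%:K - p%:K * (topcoef (x * u))%:K)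
  - p%:K * (y * (topcoef u)%:K + (topcoef (y * u))%:K - p%:K * (topcoef u)%:K)).
  by [].
move: (topcoef _) (topcoef _) (topcoef _) (topcoef _) => a b c d.
move: (xK p) (yK p) => v w.
ring.
Qed.

Definition Kfree_proj n (i : 'I_n) (w : Kfree n) : K^o := w i.

Lemma Kfree_proj_linear n (i : 'I_n) : linear (Kfree_proj i).
Proof. by move=> a u v; rewrite /Kfree_proj !ffunE. Qed.

Lemma casimir_topcoef_map n w : casimir (@topcoef_map n) w = w.
Proof.
apply/ffunP => i; have [h hE] := linear_bundle (Kfree_proj_linear i).
transitivity (casimir (fun v : K^o => (topcoef (v : K))%:K : K^o) (h w)).
  rewrite -casimir_precomp -[LHS]/(Kfree_proj i _) -hE -casimir_postcomp.
  by apply: eq_casimir => v; rewrite !hE /Kfree_proj ffunE.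
by rewrite hE casimir_topcoef.
Qed.

End Lattices.

(** From the product form of the Casimir element to its sum over dual bases. [L] collects the
    coefficients of the four vectors, which reduces the identity to ring identities. *)
Lemma casimir_rearrange (A : comNzRingType) (V : lmodType A) (P x y : A) (a b c d : V) :
  x *: (y *: a + c - P *: a) + (y *: b + d - P *: b) - P *: (y *: a + c - P *: a)
  = (d - P *: b - P *: c + P *: (P *: a)) + x *: (c - P *: a) + y *: (b - P *: a)
    + (x * y) *: a.
Proof.
pose L k1 k2 k3 k4 := k1 *: a + k2 *: b + (k3 *: c + k4 *: d).
have LD k1 k2 k3 k4 l1 l2 l3 l4 : L k1 k2 k3 k4 + L l1 l2 l3 l4
    = L (k1 + l1) (k2 + l2) (k3 + l3) (k4 + l4).
  by rewrite /L !scalerDl addrACA; congr (_ + _); rewrite addrACA.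
have LZ k k1 k2 k3 k4 : k *: L k1 k2 k3 k4 = L (k * k1) (k * k2) (k * k3) (k * k4).
  by rewrite /L !scalerDr !scalerA.
have LN k1 k2 k3 k4 : - L k1 k2 k3 k4 = L (- k1) (- k2) (- k3) (- k4).
  by rewrite -scaleN1r LZ !mulN1r.
have -> : a = L 1 0 0 0 by rewrite /L scale1r !scale0r !addr0.
have -> : b = L 0 1 0 0 by rewrite /L scale1r !scale0r !addr0 add0r.
have -> : c = L 0 0 1 0 by rewrite /L scale1r !scale0r !add0r addr0.
have -> : d = L 0 0 0 1 by rewrite /L scale1r !scale0r !add0r.
rewrite ?(LZ, LN, LD); congr L; ring.
Qed.

Lemma addr_regroup3 (V : zmodType) (a1 a2 a3 b1 b2 b3 : V) :
  - (a1 + a2 + a3) + b1 + b2 + b3 = b1 - a1 + (b2 - a2 + (b3 - a3)).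
Proof. by rewrite !opprD [LHS](ACl ((4*1)*((5*2)*(6*3)))). Qed.

(** * Free covers and free hulls of lattices *)

Section CoverHull.
Variables (R : idomainType) (p : R).
Hypothesis p0 : p != 0.
Local Notation K := (K p).
Local Notation x := (xK p).
Local Notation y := (yK p).
Local Notation x' := (xK p - p%:K).
Local Notation y' := (yK p - p%:K).
Implicit Types L M N X Y Z : lmodType K.

(** The sum of e_i f(e_i^* m), for e_i running through 1, x, y, xy and e_i^* through the dual basis
    of [topcoef]. *)
Lemma casimir_dual M X (f : M -> X) m : Rlinear f -> casimir f m =
  f ((x' * y') *: m) + x *: f (y' *: m) + y *: f (x' *: m) + (x * y) *: f m.
Proof.
move=> fl; rewrite casimirE casimir_rearrange.
have E (a : K) : f ((a - p%:K) *: m) = f (a *: m) - p%:K *: f m.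
  by rewrite scalerBl (RlinearB fl) (RlinearZ fl).
rewrite !E; congr (_ + _ + _ + _).
have -> : x' * y' = y * x - p%:K * x - p%:K * y + p%:K * p%:K.
  by move: (xK p) (yK p) => u v; ring.
rewrite scalerDl !scalerBl -!scalerA.
by rewrite (RlinearD fl) !(RlinearB fl) !(RlinearZ fl).
Qed.

Lemma topcoef_eq (u : K) c : chi true true u - chi true false u
                  - chi false true u + chi false false u = p ^+ 2 * c ->
  topcoef u = c.
Proof. by rewrite -topcoefE => /(mulfI (expf_neq0 2 p0)). Qed.

Lemma chi_factors a b : (chi a b x = pz p a) * (chi a b y = pz p b) *
  (chi a b x' = pz p a - p) * (chi a b y' = pz p b - p).
Proof. by rewrite !rmorphB /= !chi_C chi_x chi_y. Qed.

Lemma chi_mul a b (u v : K) : chi a b (u * v) = chi a b u * chi a b v.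
Proof. exact: rmorphM. Qed.

Lemma topcoef_values :
  (topcoef (1 : K) = 0) * (topcoef x = 0) * (topcoef y = 0) * (topcoef (x * y) = 1) *
  (topcoef x' = 0) * (topcoef y' = 0) * (topcoef (x' * y') = 1) *
  (topcoef (y' * x) = 1) * (topcoef (y' * y) = 0) * (topcoef (x' * x) = 0) *
  (topcoef (x' * y) = 1) * (topcoef (y' * (x * y)) = 0) * (topcoef (x' * (x * y)) = 0) *
  (topcoef (x' * y' * x) = 0) * (topcoef (x' * y' * y) = 0).
Proof.
by do !split; apply: topcoef_eq; rewrite ?chi_mul ?chi_factors ?rmorph1 /pz; ring.
Qed.

Section Induced.
Variables (M F : lmodType K) (s : M -> F) (t : F -> M).
Hypotheses (s_Rlinear : Rlinear s) (t_Rlinear : Rlinear t).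
Hypothesis ts : forall u m, t (u *: s m) = (topcoef u)%:K *: m.
Hypothesis F_expand : forall w, w = s (t ((x' * y') *: w)) + x *: s (t (y' *: w))
    + y *: s (t (x' *: w)) + (x * y) *: s (t w).

Let tv0 u m : topcoef u = 0 -> t (u *: s m) = 0.
Proof. by move=> E; rewrite ts E rmorph0 scale0r. Qed.

Let s1 u : s u = 1 *: s u. Proof. by rewrite scale1r. Qed.

Let cover_map_s u : casimir t (s u) = u.
Proof.
rewrite (casimir_dual _ t_Rlinear) [in t (s u)]s1 !ts !topcoef_values.
by rewrite rmorph0 rmorph1 !scale0r scale1r !scaler0 !addr0.
Qed.

Let hull_map_t u : t (casimir s u) = u.
Proof.
rewrite (casimir_dual _ s_Rlinear) !(RlinearD t_Rlinear) s1 !ts !topcoef_values.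
by rewrite rmorph0 rmorph1 !scale0r scale1r !add0r.
Qed.

(** F stands for K ⊗_R M, with s m = 1 ⊗ m and t = [topcoef] ⊗ id. Then [casimir t] is the action
    map a ⊗ m |-> am, and its kernel is the syzygy. *)
Lemma induced_cover : lattice M -> exists (Y : lmodType K) (i : {linear Y -> F})
  (q : {linear F -> M}), short_exact i q /\ lattice Y.
Proof.
move=> latM; have [q qE] := linear_bundle (casimir_linear t_Rlinear).
have qs u : q (s u) = u by rewrite qE cover_map_s.
have [Y [i [iinj iker]]] := kernel_exists q.
exists Y, i, q; split.
  by split=> // m; exists (s m).
(* The kernel of the action map is spanned by a ⊗ m - 1 ⊗ am for a = x, y, xy. The dual basis
   elements y-p, x-p, 1 read off the three components. *)
have lift (a : K) m : exists u, i u = a *: s m - s (a *: m).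
  by apply/iker; rewrite (linearB q) (linearZ_LR q) !qs subrr.
have [f1 f1E] := choice (lift x); have [f2 f2E] := choice (lift y).
have [f3 f3E] := choice (lift (x * y)).
have fl (a : K) f : (forall m, i (f m) = a *: s m - s (a *: m)) -> Rlinear f.
  move=> fE c u v; apply: iinj; rewrite (linearP i) !fE.
  have := Rlinear_add (Rlinear_scale a s_Rlinear) (Rlinear_opp (Rlinear_prescale a s_Rlinear)).
  exact.
pose f (j : 'I_3) := nth f3 [:: f1; f2; f3] j.
pose g (j : 'I_3) (u : Y) : M := nth (t (i u)) [:: t (y' *: i u); t (x' *: i u)] j.
apply: (@lattice_direct_sum _ _ M Y 'I_3 f g) latM.
- move=> [[|[|[|//]]] lt_j]; [exact: fl f1E | exact: fl f2E | exact: fl f3E].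
- have il := linear_Rlinear i.
  move=> [[|[|[|//]]] lt_j]; rewrite /g /=.
  + by have := Rlinear_comp (Rlinear_prescale y' t_Rlinear) il; exact.
  + by have := Rlinear_comp (Rlinear_prescale x' t_Rlinear) il; exact.
  + by have := Rlinear_comp t_Rlinear il; exact.
- have tE (u a : K) m : t (u *: (a *: s m - s (a *: m)))
       = (topcoef (u * a))%:K *: m - (topcoef u)%:K *: (a *: m).
    by rewrite scalerBr (RlinearB t_Rlinear) (scalerA u a (s m)) !ts.
  have tE1 (a : K) m : t (a *: s m - s (a *: m)) = (topcoef a)%:K *: m.
    by rewrite (RlinearB t_Rlinear) ts [s (a *: m)]s1 tv0 ?topcoef_values // subr0.
  move=> [[|[|[|//]]] lt_j] [[|[|[|//]]] lt_k] m; rewrite /f /g /= ?f1E ?f2E ?f3E ?tE ?tE1;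
  by rewrite !topcoef_values ?rmorph0 ?rmorph1 ?scale0r ?scale1r ?subr0.
- move=> u; apply: iinj; rewrite linear_sum !big_ord_recl big_ord0 /f /g /= /bump /=.
  rewrite f1E f2E f3E addr0.
  have qi0 : q (i u) = 0 by apply/iker; exists u.
  have := qi0; rewrite qE (casimir_dual _ t_Rlinear) => E.
  have {}E : s (t ((x' * y') *: i u)) = - (s (x *: t (y' *: i u))
     + s (y *: t (x' *: i u)) + s ((x * y) *: t (i u))).
    apply/eqP; rewrite -addr_eq0 !addrA -!(RlinearD s_Rlinear) E.
    by rewrite (Rlinear0 s_Rlinear).
  rewrite {1}(F_expand (i u)) E.
  exact: addr_regroup3.
Qed.

(** The map [casimir s] sends m to the sum of e_i ⊗ e_i^* m. It has [t] as an R-linear retraction,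
    so the cokernel is a copy of the kernel of [t], spanned by 1 ⊗ m, x ⊗ m and y ⊗ m. *)
Lemma induced_hull : lattice M -> exists (X : lmodType K) (i : {linear M -> F})
  (q : {linear F -> X}), short_exact i q /\ lattice X.
Proof.
move=> latM; have [i iE] := linear_bundle (casimir_linear s_Rlinear).
have ti u : t (i u) = u by rewrite iE hull_map_t.
have [X [q [qker qonto]]] := cokernel_exists i.
exists X, i, q; split.
  by split=> // u v E; rewrite -[u]ti E ti.
(* The projection onto the kernel of [t] along the image of [i]. It vanishes on that image, so
   composing it with any set-theoretic section of [q] gives an R-linear map. *)
pose proj w := w - i (t w).
have proj_lin : Rlinear proj.
  apply: Rlinear_add; first exact: Rlinear_id.
  exact/Rlinear_opp/(Rlinear_comp (linear_Rlinear i) t_Rlinear).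
have [sec secE] := choice qonto.
have proj_sec w : proj (sec (q w)) = proj w.
  have [m mE] : exists m, i m = w - sec (q w).
    by apply/qker; rewrite linearB secE subrr.
  have {2}-> : w = sec (q w) + i m by rewrite mE addrC subrK.
  by rewrite [RHS](RlinearD proj_lin) [proj (i m)]/proj ti subrr addr0.
have psec_lin : Rlinear (fun u => proj (sec u)).
  move=> c u v.
  by rewrite -[u in LHS]secE -[v in LHS]secE -(linearP q) proj_sec proj_lin.
pose f (j : 'I_3) := nth (fun m => q (y *: s m)) [:: (fun m => q (s m)); (fun m => q (x *: s m))] j.
pose g (j : 'I_3) (u : X) : M := nth (t (x' *: proj (sec u)))
  [:: t ((x' * y') *: proj (sec u)); t (y' *: proj (sec u))] j.
have ql := linear_Rlinear q.
apply: (@lattice_direct_sum _ _ M X 'I_3 f g) latM.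
- move=> [[|[|[|//]]] lt_j]; rewrite /f /=.
  + exact: Rlinear_comp ql s_Rlinear.
  + exact: Rlinear_comp ql (Rlinear_scale x s_Rlinear).
  + exact: Rlinear_comp ql (Rlinear_scale y s_Rlinear).
- move=> [[|[|[|//]]] lt_j]; rewrite /g /=.
  + exact: Rlinear_comp (Rlinear_prescale (x' * y') t_Rlinear) psec_lin.
  + exact: Rlinear_comp (Rlinear_prescale y' t_Rlinear) psec_lin.
  + exact: Rlinear_comp (Rlinear_prescale x' t_Rlinear) psec_lin.
- have proj_id (u : K) m : topcoef u = 0 -> proj (u *: s m) = u *: s m.
    by move=> u0; rewrite /proj tv0 // linear0 subr0.
  have proj_s m : proj (s m) = 1 *: s m.
    by rewrite {1}[s m]s1 proj_id ?topcoef_values.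
  move=> [[|[|[|//]]] lt_j] [[|[|[|//]]] lt_k] m; rewrite /f /g /= proj_sec ?proj_s
   ?proj_id ?topcoef_values // (scalerA _ _ (s m)) ts ?mulr1 ?topcoef_values;
  by rewrite ?rmorph0 ?rmorph1 ?scale0r ?scale1r.
- move=> u; rewrite !big_ord_recl big_ord0 /f /g /= /bump /= addr0.
  rewrite -!linearD addrA.
  have tp : t (proj (sec u)) = 0 by rewrite (RlinearB t_Rlinear) ti subrr.
  have := F_expand (proj (sec u)).
  rewrite tp (Rlinear0 s_Rlinear) scaler0 addr0 => <-.
  rewrite linearB secE (_ : q (i _) = 0) ?subr0 //.
  by apply/qker; exists (t (sec u)).
Qed.

End Induced.

Section FreeInduced.
Variables (M : lmodType K) (n : nat) (e : 'I_n -> M) (co : 'I_n -> M -> R).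
Hypothesis be : basis_on e co.

Let s (m : M) : Kfree p n := [ffun i => (co i m)%:K : K^o].
Let t (w : Kfree p n) : M := \sum_i (topcoef (w i))%:K *: e i.

(** The R-basis of M identifies K^n with K ⊗_R M; this verifies the abstract properties of an
    induced module used above. *)
Lemma Kfree_induced : [/\ Rlinear s, Rlinear t,
  forall u m, t (u *: s m) = (topcoef u)%:K *: m
  & forall w, w = s (t ((x' * y') *: w)) + x *: s (t (y' *: w))
    + y *: s (t (x' *: w)) + (x * y) *: s (t w)].
Proof.
have sl : Rlinear s.
  move=> c u v; apply/ffunP=> i; rewrite !ffunE; have [-> _ _] := be.
  by rewrite rmorphD rmorphM.
have tl : Rlinear t.
  move=> c u v; rewrite /t scaler_sumr -big_split /=; apply: eq_bigr => i _.
  by rewrite !ffunE (topcoef_linear p0) rmorphD rmorphM scalerDl scalerA.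
split=> // [u m|w].
  have [_ ex _] := be; rewrite {2}(ex m) scaler_sumr; apply: eq_bigr => i _.
  have -> : (u *: s m) i = (co i m)%:K * u by rewrite ffunE mulrC /s ffunE.
  by rewrite (topcoefZ p0) scalerA -rmorphM mulrC.
rewrite -(casimir_dual w (Rlinear_comp sl tl)).
rewrite -{1}(casimir_topcoef_map p0 w); apply: eq_casimir => v.
by apply/ffunP => i; rewrite !ffunE (coord_basis_sum _ _ be).
Qed.

End FreeInduced.

Lemma free_cover M : lattice M -> exists n (Y : lmodType K)
  (i : {linear Y -> Kfree p n}) (q : {linear Kfree p n -> M}),
  short_exact i q /\ lattice Y.
Proof.
move=> latM; have [n [e [co be]]] := lattice_basis latM; exists n.
by have [sl tl ts ex] := Kfree_induced be; exact: (induced_cover sl tl ts ex latM).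
Qed.

Lemma free_hull M : lattice M -> exists n (X : lmodType K)
  (i : {linear M -> Kfree p n}) (q : {linear Kfree p n -> X}),
  short_exact i q /\ lattice X.
Proof.
move=> latM; have [n [e [co be]]] := lattice_basis latM; exists n.
by have [sl tl ts ex] := Kfree_induced be; exact: (induced_hull sl tl ts ex latM).
Qed.

End CoverHull.

(** * Tate duality for lattices *)

Section MatrixDuality.
Variables (R : idomainType) (p : R).
Hypothesis hR : complete_dvr p.
Let p0 : p != 0 := dvr_p_neq0 hR.

(** The matrix of [twist a f], where A and B are the matrices of a on source and target. Vectors are
    rows, so composition of maps is the product from left to right. *)
Definition mx_twist m n (A : 'M[R]_m) (B : 'M_n) (T : 'M_(m, n)) : 'M_(m, n) :=
  T *m B + A *m T - p *: T.

(* The Casimir element acts as the product of these for x and y; its square is p^4. *)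
Definition mx_different m (A : 'M[R]_m) : 'M_m := A + A - p%:M.

(** By cyclicity of the trace, twisting is adjoint to the twist in the opposite direction. *)
Lemma mx_twist_trace m n (A : 'M[R]_m) (B : 'M_n) (T : 'M_(m, n)) (V : 'M_(n, m)) :
  \tr (mx_twist A B T *m V) = \tr (T *m mx_twist B A V).
Proof.
rewrite /mx_twist !mulmxDl !mulmxDr !mulNmx !mulmxN -scalemxAl -scalemxAr.
rewrite !mxtraceD !raddfN /= addrC [RHS]addrC; congr (_ + _).
rewrite addrC -!mulmxA [\tr (A *m _)]mxtrace_mulC -!mulmxA; congr (_ + _).
Qed.

Lemma mx_twist_intertwiner m n (A : 'M[R]_m) (B : 'M_n) (T : 'M_(m, n)) :
  A *m T = T *m B -> mx_twist A B T = mx_different A *m T.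
Proof.
by move=> E; rewrite /mx_twist /mx_different -E !mulmxDl mulNmx mul_scalar_mx.
Qed.

(** (2A - p)^2 = 4(A^2 - pA) + p^2. *)
Lemma mx_different_sqr m (A : 'M[R]_m) : A *m A = p *: A ->
  mx_different A *m mx_different A = (p ^+ 2)%:M.
Proof.
move=> AA; rewrite -(@mx_twist_intertwiner _ _ A A); last first.
  by rewrite /mx_different !(mulmxDl, mulmxDr) mulmxN mulNmx scalar_mxC.
have DA : mx_different A *m A = p *: A.
  by rewrite /mx_different !mulmxDl AA mulNmx mul_scalar_mx addrK.
have AD : A *m mx_different A = p *: A.
  by rewrite /mx_different !mulmxDr AA mulmxN mul_mx_scalar addrK.
rewrite /mx_twist DA AD /mx_different scalerBr scalerDr opprB addrC subrK.
by rewrite scale_scalar_mx expr2.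
Qed.

Lemma mx_twist_intertwines m n (A : 'M[R]_m) (B : 'M_n) (T : 'M_(m, n)) :
  A *m A = p *: A -> B *m B = p *: B ->
  A *m mx_twist A B T = mx_twist A B T *m B.
Proof.
move=> AA BB; rewrite /mx_twist !(mulmxDl, mulmxDr) mulmxN mulNmx.
rewrite -scalemxAl -scalemxAr mulmxA [A *m (A *m T)]mulmxA AA -[T *m B *m B]mulmxA BB.
by rewrite -scalemxAl -scalemxAr addrK addrC addKr.
Qed.

Lemma mx_twist_preserves m n (A A' : 'M[R]_m) (B B' : 'M_n) (T : 'M_(m, n)) :
  A *m A' = A' *m A -> B *m B' = B' *m B -> A' *m T = T *m B' ->
  A' *m mx_twist A B T = mx_twist A B T *m B'.
Proof.
move=> AA BB E; rewrite /mx_twist !(mulmxDl, mulmxDr) mulmxN mulNmx.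
rewrite -scalemxAl -scalemxAr E; congr (_ + _ - _).
  by rewrite mulmxA E -!mulmxA BB.
by rewrite mulmxA -AA -!mulmxA E.
Qed.

Lemma mx_trace_nondeg m n (A B : 'M[R]_(m, n)) :
  (forall V : 'M_(n, m), \tr (A *m V) = \tr (B *m V)) -> A = B.
Proof.
move=> E; apply/matrixP => i j.
have key (C : 'M_(m, n)) : \tr (C *m delta_mx j i) = C i j.
  rewrite /mxtrace (bigD1 i) //= big1 ?addr0 => [|k ne_ki].
    rewrite mxE (bigD1 j) //= big1 ?addr0 => [|l ne_lj]; rewrite mxE !eqxx ?mulr1 //.
    by rewrite (negPf ne_lj) mulr0.
  by rewrite mxE big1 // => l _; rewrite mxE (negPf ne_ki) andbF mulr0.
by rewrite -!key E.
Qed.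

Lemma mx_different_intertwines m n (A : 'M[R]_m) (B : 'M_n) (T : 'M_(m, n)) :
  A *m T = T *m B -> mx_different A *m T = T *m mx_different B.
Proof.
by move=> E; rewrite /mx_different !(mulmxDl, mulmxDr) E mulmxN mulNmx scalar_mxC.
Qed.

Lemma mx_different_comm k (A B : 'M[R]_k) : A *m B = B *m A ->
  mx_different A *m B = B *m mx_different A.
Proof. exact: mx_different_intertwines. Qed.

Section OneModule.
Variables (m : nat) (X Y : 'M[R]_m).
Hypotheses (XX : X *m X = p *: X) (YY : Y *m Y = p *: Y) (XY : X *m Y = Y *m X).
Local Notation DX := (mx_different X).
Local Notation DY := (mx_different Y).

Let DXY : DX *m DY = DY *m DX.
Proof. by apply/mx_different_comm/esym/mx_different_comm. Qed.

Lemma mx_different_XY : X *m (DX *m DY) = DX *m DY *m X /\ Y *m (DX *m DY) = DX *m DY *m Y.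
Proof.
have cXX : X *m DX = DX *m X by apply/esym/mx_different_comm.
have cYY : Y *m DY = DY *m Y by apply/esym/mx_different_comm.
have cXY : X *m DY = DY *m X by apply/esym/mx_different_comm.
have cYX : Y *m DX = DX *m Y by apply/esym/mx_different_comm.
by split; rewrite mulmxA ?cXX ?cYX -!mulmxA ?cXY ?cYY.
Qed.

Lemma mx_different4 : DX *m (DY *m (DX *m DY)) = (p ^+ 4)%:M.
Proof.
rewrite DXY (mulmxA DY DY) mx_different_sqr // mul_scalar_mx -scalemxAr.
by rewrite mx_different_sqr // scale_scalar_mx -exprD.
Qed.

(** Adjointness moves both twists onto D = DX DY. As D is an intertwiner, they multiply it by D, and
    D^2 = p^4. Hence null endomorphisms pair to elements of R. *)
Lemma mx_null_trace T :
  \tr (DX *m DY *m mx_twist X X (mx_twist Y Y T)) = p ^+ 4 * \tr T.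
Proof.
have [D1X D1Y] := mx_different_XY.
rewrite mxtrace_mulC !mx_twist_trace (mx_twist_intertwiner D1X).
rewrite mx_twist_intertwiner; last first.
  by rewrite mulmxA -mx_different_comm // -!mulmxA D1Y !mulmxA.
have -> : DY *m (DX *m (DX *m DY)) = (p ^+ 4)%:M.
  by rewrite -mx_different4 !mulmxA -!DXY -(mulmxA DX DY DX) -DXY !mulmxA.
by rewrite mul_mx_scalar mxtraceZ.
Qed.

End OneModule.

Section Duality.
Variables (m n : nat) (X1 Y1 : 'M[R]_m) (X2 Y2 : 'M[R]_n).
Hypotheses (XX1 : X1 *m X1 = p *: X1) (YY1 : Y1 *m Y1 = p *: Y1).
Hypotheses (XX2 : X2 *m X2 = p *: X2) (YY2 : Y2 *m Y2 = p *: Y2).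
Hypotheses (XY1 : X1 *m Y1 = Y1 *m X1) (XY2 : X2 *m Y2 = Y2 *m X2).
Variable H : 'M[R]_(m, n).
Hypotheses (HX : X1 *m H = H *m X2) (HY : Y1 *m H = H *m Y2).

Let D1 := mx_different X1 *m mx_different Y1.

(* The functional U |-> tr (D1 H U) / p^4 on intertwiners extends to all matrices
   and is represented by some T; testing on the images of the Casimir operator
   shows that H is the image of T. *)
Lemma mx_duality :
  (forall U, X2 *m U = U *m X1 -> Y2 *m U = U *m Y1 ->
     exists r, \tr (D1 *m H *m U) = p ^+ 4 * r) ->
  exists T, H = mx_twist X1 X2 (mx_twist Y1 Y2 T).
Proof.
move=> divis.
pose g (k : bool * ('I_n * 'I_m)) (U : 'M[R]_(n, m)) : R :=
  (if k.1 then X2 *m U - U *m X1 else Y2 *m U - U *m Y1) k.2.1 k.2.2.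
have glin k c u v : g k (c *: u + v) = c * g k u + g k v.
  rewrite /g; case: k.1; rewrite !(mulmxDl, mulmxDr) -!scalemxAl -!scalemxAr !mxE;
    ring.
(* The intertwiners are the common kernel of the [g k], hence a retract of all matrices; a
   functional on them extends by composition with [r]. *)
have [r [rlin rker rid]] := kernel_retraction hR glin.
have rX U : X2 *m r U = r U *m X1.
  apply/eqP; rewrite -subr_eq0; apply/eqP/matrixP => i j.
  by rewrite [RHS]mxE; exact: (rker (true, (i, j)) U).
have rY U : Y2 *m r U = r U *m Y1.
  apply/eqP; rewrite -subr_eq0; apply/eqP/matrixP => i j.
  by rewrite [RHS]mxE; exact: (rker (false, (i, j)) U).
pose l U := sval (cid (divis _ (rX U) (rY U))).
have lE U : \tr (D1 *m H *m r U) = p ^+ 4 * l U by exact: (svalP (cid (divis _ (rX U) (rY U)))).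
have p40 := expf_neq0 4 p0.
have llin c u v : l (c *: u + v) = c * l u + l v.
  apply: (mulfI p40); rewrite -lE rlin mulmxDr -scalemxAr mxtraceD mxtraceZ !lE.
  by ring.
have lD u v : l (u + v) = l u + l v by have := llin 1 u v; rewrite scale1r mul1r.
have l0 : l 0 = 0 by apply: (addrI (l 0)); rewrite -lD !addr0.
pose T : 'M[R]_(m, n) := \matrix_(i, j) l (delta_mx j i).
have lT V : l V = \tr (T *m V).
  rewrite {1}[V]matrix_sum_delta (big_morph l lD l0) /mxtrace.
  under eq_bigr => i _ do rewrite (big_morph l lD l0).
  rewrite exchange_big /=; apply: eq_bigr => j _; rewrite mxE; apply: eq_bigr => i _.
  by have := llin (V i j) (delta_mx i j) 0; rewrite l0 !addr0 mxE mulrC => ->.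
exists T; apply: mx_trace_nondeg => F.
pose U := mx_twist Y2 Y1 (mx_twist X2 X1 F).
have UY : Y2 *m U = U *m Y1 by apply: mx_twist_intertwines.
have UX : X2 *m U = U *m X1.
  by apply: mx_twist_preserves => //; apply: mx_twist_intertwines.
have rU : r U = U.
  by apply: rid => -[[] [i j]]; rewrite /g /= ?UX ?UY subrr mxE.
have [D1X D1Y] := mx_different_XY XY1.
apply: (mulfI p40); rewrite !mx_twist_trace -/U -lT -lE rU /U -!mx_twist_trace.
have hY : Y1 *m (D1 *m H) = D1 *m H *m Y2 by rewrite mulmxA D1Y -!mulmxA HY.
have hX : X1 *m (D1 *m H) = D1 *m H *m X2 by rewrite mulmxA D1X -!mulmxA HX.
have hX' : X1 *m (mx_different Y1 *m (D1 *m H)) = mx_different Y1 *m (D1 *m H) *m X2.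
  have cXY : X1 *m mx_different Y1 = mx_different Y1 *m X1.
    exact/esym/mx_different_comm.
  by rewrite mulmxA cXY -[LHS]mulmxA hX !mulmxA.
rewrite (mx_twist_intertwiner hY) (mx_twist_intertwiner hX').
have -> : mx_different X1 *m (mx_different Y1 *m (D1 *m H)) = p ^+ 4 *: H.
  by rewrite -mul_scalar_mx -(mx_different4 XX1 YY1 XY1) !mulmxA.
by rewrite -scalemxAl mxtraceZ.
Qed.

Lemma mx_null_trace_left (U : 'M[R]_(n, m)) T :
  H *m U = mx_twist X1 X1 (mx_twist Y1 Y1 T) -> \tr (D1 *m H *m U) = p ^+ 4 * \tr T.
Proof. by move=> E; rewrite -mulmxA E mx_null_trace. Qed.

Lemma mx_null_trace_right (U : 'M[R]_(n, m)) T :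
  U *m H = mx_twist X2 X2 (mx_twist Y2 Y2 T) -> \tr (D1 *m H *m U) = p ^+ 4 * \tr T.
Proof.
move=> E; have -> : D1 *m H = H *m (mx_different X2 *m mx_different Y2).
  rewrite /D1 -mulmxA (mx_different_intertwines HY) mulmxA.
  by rewrite (mx_different_intertwines HX) mulmxA.
by rewrite -(mulmxA H) mxtrace_mulC -(mulmxA _ U H) E mx_null_trace.
Qed.

End Duality.
End MatrixDuality.

(** * From matrices to lattices *)

Section LatticeDuality.
Variables (R : idomainType) (p : R).
Hypothesis hR : complete_dvr p.
Let p0 : p != 0 := dvr_p_neq0 hR.
Local Notation K := (K p).
Local Notation x := (xK p).
Local Notation y := (yK p).
Implicit Types L M N X Y Z : lmodType K.

Lemma coordZ M (I : finType) (e : I -> M) co i c v : basis_on e co ->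
  co i (c%:K *: v) = c * co i v.
Proof.
move=> be; have := coord_sum (fun=> v) (fun=> c) i be (J := unit).
by rewrite !big_const !cardT !enumT !unlock /= !addr0.
Qed.

Definition Rmx M N m n (e : 'I_m -> M) (co : 'I_n -> N -> R) (f : M -> N) : 'M[R]_(m, n) :=
  \matrix_(i, j) co j (f (e i)).

Section Matrices.
Variables (M : lmodType K) (m : nat) (e : 'I_m -> M) (ce : 'I_m -> M -> R).
Hypothesis be : basis_on e ce.

Lemma Rlinear_expand N (f : M -> N) v : Rlinear f ->
  f v = \sum_i (ce i v)%:K *: f (e i).
Proof.
move=> fl; have [_ ex _] := be; rewrite {1}(ex v) (Rlinear_sum fl).
by apply: eq_bigr => i _; rewrite (RlinearZ fl).
Qed.

Variables (N : lmodType K) (n : nat) (e' : 'I_n -> N) (ce' : 'I_n -> N -> R).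
Hypothesis be' : basis_on e' ce'.

Lemma Rmx_inj (f g : M -> N) : Rlinear f -> Rlinear g ->
  Rmx e ce' f = Rmx e ce' g -> f =1 g.
Proof.
move=> fl gl E v; rewrite (Rlinear_expand v fl) (Rlinear_expand v gl).
apply: eq_bigr => i _; congr (_ *: _).
have [_ ex _] := be'; rewrite [LHS]ex [RHS]ex; apply: eq_bigr => j _.
by have := congr1 (fun A : 'M_(m, n) => A i j) E; rewrite !mxE => ->.
Qed.

Lemma Rmx_comp L l (e'' : 'I_l -> L) (f : L -> M) (g : M -> N) : Rlinear g ->
  Rmx e'' ce' (fun v => g (f v)) = Rmx e'' ce f *m Rmx e ce' g.
Proof.
move=> gl; apply/matrixP => i j; rewrite !mxE (Rlinear_expand _ gl).
by rewrite (coord_sum _ _ _ be'); apply: eq_bigr => k _; rewrite !mxE.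
Qed.

Definition Rmap_of_mx (T : 'M[R]_(m, n)) (v : M) : N :=
  \sum_j (\sum_i ce i v * T i j)%:K *: e' j.

Lemma Rmap_of_mx_Rlinear T : Rlinear (Rmap_of_mx T).
Proof.
move=> c u v; rewrite /Rmap_of_mx scaler_sumr -big_split /=; apply: eq_bigr => j _.
rewrite scalerA -rmorphM -scalerDl -rmorphD mulr_sumr -big_split /=.
congr (RtoK p _ *: _); apply: eq_bigr => i _.
by have [-> _ _] := be; rewrite mulrDl mulrA.
Qed.

Lemma Rmx_of_map T : Rmx e ce' (Rmap_of_mx T) = T.
Proof.
apply/matrixP => i j; rewrite mxE (coord_basis_sum _ _ be').
have [_ _ dual] := be; rewrite (bigD1 i) //= dual eqxx mul1r big1 ?addr0 //.
by move=> k ne_ki; rewrite dual (negPf ne_ki) mul0r.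
Qed.

End Matrices.

Lemma scale_Rlinear M (a : K) : Rlinear (fun v : M => a *: v).
Proof. exact: Rlinear_scale (@Rlinear_id _ _ M). Qed.

Lemma Rmx_twist M N m n e ce e' ce' (be : @basis_on _ _ M 'I_m e ce)
    (be' : @basis_on _ _ N 'I_n e' ce') a (f : M -> N) : Rlinear f ->
  Rmx e ce' (twist a f) =
  mx_twist p (Rmx e ce (fun v => a *: v)) (Rmx e' ce' (fun v => a *: v)) (Rmx e ce' f).
Proof.
move=> fl; rewrite /mx_twist -(Rmx_comp be be' _ _ fl).
rewrite -(Rmx_comp be' be' _ _ (scale_Rlinear a)).
apply/matrixP => i j; rewrite !mxE /twist.
have [lin _ _] := be'.
have D u v : ce' j (u + v) = ce' j u + ce' j v.
  by have := lin j 1 u v; rewrite rmorph1 scale1r mul1r.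
have RN : - p%:K = (- p)%:K :> K by rewrite rmorphN.
by rewrite [in LHS]addrC -scaleNr RN lin D [LHS]addrC mulNr.
Qed.

(* The pairing (h, u) |-> tr (D h u) / p^4 in Q/R of the stable Hom groups is
   nondegenerate, and its value only depends on h u, or on u h, up to null maps. *)
Lemma lattice_duality M N (h : {linear M -> N}) : lattice M -> lattice N ->
  relatively_null h \/
  exists u : {linear N -> M}, ~ relatively_null (fun v => h (u v)) /\
                              ~ relatively_null (fun v => u (h v)).
Proof.
move=> /lattice_basis [m [e [ce be]]] /lattice_basis [n [e' [ce' be']]].
have [nn|nn] := pselect (relatively_null h); [by left | right].
pose A a : 'M[R]_m := Rmx e ce (fun v => a *: v).
pose B a : 'M[R]_n := Rmx e' ce' (fun v => a *: v).
pose H := Rmx e ce' h.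
have hl := linear_Rlinear h.
have sqA a : a * a = p%:K * a -> A a *m A a = p *: A a.
  move=> E; rewrite -(Rmx_comp be be _ _ (scale_Rlinear a)).
  by apply/matrixP => i j; rewrite !mxE scalerA E -scalerA (coordZ _ _ _ be).
have sqB a : a * a = p%:K * a -> B a *m B a = p *: B a.
  move=> E; rewrite -(Rmx_comp be' be' _ _ (scale_Rlinear a)).
  by apply/matrixP => i j; rewrite !mxE scalerA E -scalerA (coordZ _ _ _ be').
have cA : A x *m A y = A y *m A x.
  rewrite -!(Rmx_comp be be _ _ (scale_Rlinear _)).
  by apply/matrixP => i j; rewrite !mxE !scalerA mulrC.
have cB : B x *m B y = B y *m B x.
  rewrite -!(Rmx_comp be' be' _ _ (scale_Rlinear _)).
  by apply/matrixP => i j; rewrite !mxE !scalerA mulrC.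
have HA a : A a *m H = H *m B a.
  rewrite -(Rmx_comp be be' _ _ hl) -(Rmx_comp be' be' _ _ (scale_Rlinear a)).
  by apply/matrixP => i j; rewrite !mxE linearZ.
have [xx yy] := (xK_sqr p, yK_sqr p).
have [U UX [UY nodiv]] : exists2 U, B x *m U = U *m A x &
   B y *m U = U *m A y /\ ~ exists r,
     \tr (mx_different p (A x) *m mx_different p (A y) *m H *m U) = p ^+ 4 * r.
  have [h0|noU] := pselect (exists2 U, B x *m U = U *m A x &
   B y *m U = U *m A y /\ ~ exists r,
     \tr (mx_different p (A x) *m mx_different p (A y) *m H *m U) = p ^+ 4 * r).
    exact: h0.
  case: nn; have [|T TE] := mx_duality hR (sqA _ xx) (sqA _ yy) (sqB _ xx) (sqB _ yy)
     cA cB (HA x) (HA y).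
    move=> U UX UY; by apply: contrapT => nodiv; apply: noU; exists U.
  exists (Rmap_of_mx ce e' T).
    exact: (Rmap_of_mx_Rlinear be e' T).
  have tl := Rmap_of_mx_Rlinear be e' T.
  apply: (Rmx_inj be be' hl (casimir_Rlinear tl)).
  rewrite /casimir (Rmx_twist be be' _ (twist_Rlinear y tl)).
  by rewrite (Rmx_twist be be' _ tl) (Rmx_of_map be be').
have ul := Rmap_of_mx_Rlinear be' e U.
have uE := Rmx_of_map be' be U.
have ucomm a : B a *m U = U *m A a ->
    forall v, Rmap_of_mx ce' e U (a *: v) = a *: Rmap_of_mx ce' e U v.
  move=> E; apply: (Rmx_inj be' be).
  - exact: Rlinear_prescale.
  - exact: Rlinear_scale.
  - by rewrite (Rmx_comp be' be _ _ ul) (Rmx_comp be be _ _ (scale_Rlinear a)) uE.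
have [u uf] := linear_bundle (Rlinear_linear ul (ucomm _ UX) (ucomm _ UY)).
have {}uE : Rmx e' ce u = U by rewrite -[RHS]uE; apply/matrixP => i j; rewrite !mxE uf.
have {}ul := linear_Rlinear u.
exists u; split=> -[f fl fE]; apply: nodiv.
  exists (\tr (Rmx e' ce' f)).
  apply: (mx_null_trace_right (sqB _ xx) (sqB _ yy) cB (HA x) (HA y)).
  rewrite -(Rmx_twist be' be' _ fl) -(Rmx_twist be' be' _ (twist_Rlinear y fl)).
  rewrite -uE -(Rmx_comp be be' _ _ hl).
  by apply/matrixP => i j; rewrite !mxE fE.
exists (\tr (Rmx e ce f)).
apply: (mx_null_trace_left (sqA _ xx) (sqA _ yy) cA).
rewrite -(Rmx_twist be be _ fl) -(Rmx_twist be be _ (twist_Rlinear y fl)).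
rewrite -uE -(Rmx_comp be' be _ _ ul).
by apply/matrixP => i j; rewrite !mxE fE.
Qed.

End LatticeDuality.

(** * Almost split sequences and the shift of Tate cohomology *)

Section AlmostSplit.
Variables (R : idomainType) (p : R).
Hypothesis hR : complete_dvr p.
Let p0 : p != 0 := dvr_p_neq0 hR.
Implicit Types L M N X Y Z : lmodType (K p).

Definition split_embeds M N : Prop :=
  exists (u : {linear M -> N}) (r : {linear N -> M}), forall v, r (u v) = v.

(** The identity of the free module is [casimir topcoef_map], and the Casimir operator commutes with
    composition by K-linear maps on either side. *)
Lemma null_through_free L M n (a : {linear L -> Kfree p n}) (b : {linear Kfree p n -> M}) :
  relatively_null (fun v => b (a v)).
Proof.
have tl := topcoef_map_Rlinear p0 (n := n).
exists (fun v => b (topcoef_map (a v))).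
  exact: Rlinear_comp (linear_Rlinear b) (Rlinear_comp tl (linear_Rlinear a)).
move=> v; rewrite (casimir_postcomp b (fun v => topcoef_map (a v))).
by rewrite (casimir_precomp a) casimir_topcoef_map.
Qed.

Section Sequence.
Variables (N E M : lmodType (K p)) (f : {linear N -> E}) (g : {linear E -> M}).
Hypothesis fg : almost_split_seq f g.

Lemma almost_split_short_exact : short_exact f g.
Proof. by case: fg => _ [[finj gker gonto] _]; split. Qed.

(* The comparison map h : Y -> N is not null, since otherwise g would split; if
   u : N -> Y did not split, it would factor through f, so that u h would factor
   through the free module, against the choice of u by duality. *)
Lemma almost_split_syzygy n Y (i : {linear Y -> Kfree p n})
    (q : {linear Kfree p n -> M}) : short_exact i q -> lattice Y -> split_embeds N Y.
Proof.
move=> iq latY; have [[latN latE latM] [_ [[nsf las] [nsg ras]]]] := fg.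
have sfg := almost_split_short_exact; have [finj gker gonto] := sfg.
have [s [r [sl rl gs rf decE]]] := short_exact_Rsplit sfg latM.
have [s' [r' [sl' rl' qs' ri' decF]]] := short_exact_Rsplit iq latM.
have [iinj qker qonto] := iq.
have Tl := topcoef_map_Rlinear p0 (n := n).
(* Projectivity of the free module: s q is only an R-linear lift of q, but the Casimir operator
   applied to its composite with [topcoef_map] is a K-linear one. *)
have [k kE] : exists k : {linear Kfree p n -> E}, forall v, g (k v) = q v.
  have := Rlinear_comp sl (Rlinear_comp (linear_Rlinear q) Tl).
  move=> /casimir_linear /linear_bundle [k kE]; exists k => v.
  rewrite kE -(casimir_postcomp g).
  rewrite (eq_casimir (g := fun v => q (topcoef_map v))) => [|w]; last by rewrite gs.
  by rewrite (casimir_postcomp q) casimir_topcoef_map.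
have qi v : q (i v) = 0 by apply/qker; exists v.
have gf v : g (f v) = 0 by apply/gker; exists v.
have [h fh] : exists h : {linear Y -> N}, forall v, f (h v) = k (i v).
  have lift v : exists n0, f n0 = k (i v) by apply/gker; rewrite kE qi.
  have [h0 h0E] := choice lift.
  have [|h hE] := @linear_bundle _ _ _ _ h0.
    by move=> a u v; apply: finj; rewrite (linearP f) !h0E (linearP i) (linearP k).
  by exists h => v; rewrite hE.
have [[t tl tE]|[u [_ nnull]]] := lattice_duality hR h latY latN.
- case: nsg.
  (* A null h = [casimir t] extends to the free module as [casimir (t r')]. Then k - f w kills the
     syzygy and descends to M, where it is a section of g. *)
  have [w wE] := linear_bundle (casimir_linear (Rlinear_comp tl rl')).
  have wi v : w (i v) = h v.
    rewrite wE -(casimir_precomp i (fun v => t (r' v))) tE; apply: eq_casimir => z.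
    by rewrite ri'.
  pose kk v := k v - f (w v).
  have kkD u v : kk (u + v) = kk u + kk v.
    by rewrite /kk (linearD k) (linearD w) (linearD f) opprD addrACA.
  have kki v : kk (i v) = 0 by rewrite /kk wi fh subrr.
  have kks v : kk (s' (q v)) = kk v by rewrite [in RHS](decF v) kkD kki add0r.
  have [|sg sgE] := @linear_bundle _ _ _ _ (fun m => kk (s' m)).
    move=> a m m'; rewrite -(qs' m) -(qs' m') -(linearP q) !kks.
    by rewrite /kk (linearP k) (linearP w) (linearP f) scalerBr opprD addrACA.
  by exists sg => m; rewrite sgE (linearB g) gf subr0 kE qs'.
- have [[ru ruE]|nsu] := pselect (split_mono u); first by exists u, ru.
  have [t tE] := las _ u latY nsu; case: nnull.
  have [b bl bE] := null_through_free i (t \o k : {linear Kfree p n -> Y}).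
  by exists b => // v; rewrite -bE -tE fh.
Qed.

(** Dual to [almost_split_syzygy]. Extending i along f gives h : M -> X. If h were null, f would
    split. If u : X -> M were not split epi, it would factor through g, and h u through the free
    module. *)
Lemma almost_split_cosyzygy n X (i : {linear N -> Kfree p n})
    (q : {linear Kfree p n -> X}) : short_exact i q -> lattice X -> split_embeds M X.
Proof.
move=> iq latX; have [[latN latE latM] [_ [[nsf las] [nsg ras]]]] := fg.
have sfg := almost_split_short_exact; have [finj gker gonto] := sfg.
have [s [r [sl rl gs rf decE]]] := short_exact_Rsplit sfg latM.
have [s' [r' [sl' rl' qs' ri' decF]]] := short_exact_Rsplit iq latX.
have [iinj qker qonto] := iq.
have Tl := topcoef_map_Rlinear p0 (n := n).
have [j jf] : exists j : {linear E -> Kfree p n}, forall v, j (f v) = i v.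
  have := Rlinear_comp Tl (Rlinear_comp (linear_Rlinear i) rl).
  move=> /casimir_linear /linear_bundle [j jE]; exists j => v.
  rewrite jE -(casimir_precomp f (fun v => topcoef_map (i (r v)))).
  rewrite (eq_casimir (g := fun v => topcoef_map (i v))) => [|w]; last by rewrite rf.
  by rewrite (casimir_precomp i) casimir_topcoef_map.
have qi v : q (i v) = 0 by apply/qker; exists v.
have gf v : g (f v) = 0 by apply/gker; exists v.
have [h hg] : exists h : {linear M -> X}, forall v, h (g v) = q (j v).
  have key v : q (j (s (g v))) = q (j v).
    by rewrite [in RHS](decE v) (linearD j) (linearD q) jf qi add0r.
  have [|h hE] := @linear_bundle _ _ _ _ (fun m => q (j (s m))).
    move=> a m m'; rewrite -(gs m) -(gs m') -(linearP g) !key.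
    by rewrite (linearP j) (linearP q).
  by exists h => v; rewrite hE key.
have [[t tl tE]|[u [nnull _]]] := lattice_duality hR h latM latX.
- case: nsf.
  have [w wE] := linear_bundle (casimir_linear (Rlinear_comp sl' tl)).
  have qw v : q (w v) = h v.
    rewrite wE -(casimir_postcomp q (fun v => s' (t v))) tE; apply: eq_casimir => z.
    by rewrite qs'.
  have lift e : exists n0, i n0 = j e - w (g e).
    by apply/qker; rewrite (linearB q) qw hg subrr.
  have [r0 r0E] := choice lift.
  have [|rr rrE] := @linear_bundle _ _ _ _ r0.
    move=> a u v; apply: iinj; rewrite (linearP i) !r0E (linearP j) (linearP g) (linearP w).
    by rewrite scalerBr opprD addrACA.
  by exists rr => v; apply: iinj; rewrite rrE r0E gf linear0 subr0 jf.
- have [[su suE]|nsu] := pselect (split_epi u); first by exists su, u.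
  have [t tE] := ras _ u latX nsu; case: nnull.
  have [b bl bE] := null_through_free (j \o t : {linear X -> Kfree p n}) q.
  by exists b => // v; rewrite -bE -tE hg.
Qed.

End Sequence.
End AlmostSplit.

(** * Self-injectivity of K and exactness of the full resolution *)

Section FullResolution.
Variables (R : idomainType) (p : R).
Hypothesis hR : complete_dvr p.
Let p0 : p != 0 := dvr_p_neq0 hR.
Local Notation K := (K p).
Local Notation x := (xK p).
Local Notation y := (yK p).
Variable P : resolution p.

Lemma xy_null_chi (u : K) : (x * y) * u = 0 <-> chi true true u = 0.
Proof.
split=> [E|E].
  have := congr1 (chi true true) E; rewrite !rmorphM /= rmorph0 chi_x chi_y /pz.
  by move/eqP; rewrite !mulf_eq0 (negPf p0) => /eqP.
apply: (chi_inj p0) => a b; rewrite !rmorphM /= rmorph0 chi_x chi_y.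
by case: a; case: b; rewrite /pz ?E ?mulr0 ?mul0r.
Qed.

(** Such a u vanishes at the three characters other than (p,p), which leaves only its xy-term. With
    [xy_null_chi] this gives exactness where the resolution and its dual are spliced by xy. *)
Lemma augmentation_annihilator (u : K) :
  (x - p%:K) * u = 0 -> (y - p%:K) * u = 0 -> exists c, u = c%:K * (x * y).
Proof.
have [a [b [c [d E]]]] := K_basis u => Ex Ey; exists d.
have ev a' b' : chi a' b' u = a + b * pz p a' + c * pz p b' + d * (pz p a' * pz p b').
  by rewrite E chi_basis.
have z a' b' : ~~ (a' && b') -> chi a' b' u = 0.
  have := (congr1 (chi a' b') Ex, congr1 (chi a' b') Ey).
  rewrite !rmorphM !rmorphB /= !rmorph0 !chi_C chi_x chi_y.
  case: a'; case: b' => //= -[/eqP + /eqP]; rewrite /pz sub0r !mulf_eq0 oppr_eq0 ?(negPf p0) //=.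
  - by move=> _ /eqP.
  - by move=> /eqP.
  - by move=> /eqP.
apply: (chi_inj p0) => a' b'; rewrite !rmorphM /= chi_C chi_x chi_y.
case: (boolP (a' && b')) => [/andP[-> ->]|nab]; last first.
  rewrite z //; move: nab; case: a'; case: b' => //= _; rewrite /pz ?mul0r ?mulr0 //.
have := (z true false isT, z false true isT, z false false isT).
rewrite !ev /pz !mulr0 !mul0r !mulr0 !addr0 => -[[E1 E2] E3].
by move: E1 E2; rewrite E3 !add0r => -> ->; rewrite !add0r.
Qed.

Lemma res_d0_chi j : chi true true (res_d P 0 j ord0) = 0.
Proof.
have := (res_exact0 (row j (res_d P 0))).2; rewrite mxE; apply.
by exists (delta_mx 0 j); rewrite rowE.
Qed.

Lemma res_dd n : res_d P n.+1 *m res_d P n = 0.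
Proof.
apply/row_matrixP => j; rewrite row0 row_mul; apply/res_exact.
by exists (delta_mx 0 j); rewrite rowE.
Qed.

Lemma full_dd i : full_d P (int_succ i) *m full_d P i = 0.
Proof.
case: i => [n|[|[|n]]] /=.
- exact: res_dd.
- apply/matrixP => j k; rewrite mxE big_ord_recl big_ord0 addr0 !mxE.
  rewrite (ord1 k) eqxx mulr1n mulrC.
  by apply/xy_null_chi; rewrite res_d0_chi.
- apply/matrixP => j k; rewrite mxE big_ord_recl big_ord0 addr0 !mxE.
  rewrite (ord1 j) eqxx mulr1n.
  by apply/xy_null_chi; rewrite res_d0_chi.
- by rewrite -trmx_mul res_dd trmx0.
Qed.

(** Perfectness of the form: e is the sum of f(e_i) e_i^* over the dual bases. *)
Lemma topcoef_represents (f : K -> R) :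
  (forall c u v, f (c%:K * u + v) = c * f u + f v) ->
  exists e, forall a, topcoef (a * e) = f a.
Proof.
move=> fl.
have fD u v : f (u + v) = f u + f v by have := fl 1 u v; rewrite rmorph1 !mul1r.
have f0 : f 0 = 0 by apply: (addrI (f 0)); rewrite -fD !addr0.
have fZ c u : f (c%:K * u) = c * f u by have := fl c u 0; rewrite f0 !addr0.
exists ((f 1)%:K * ((x - p%:K) * (y - p%:K)) + (f x)%:K * (y - p%:K)
   + (f y)%:K * (x - p%:K) + (f (x * y))%:K) => a.
have tZ c u : topcoef (a * (c%:K * u)) = c * topcoef (a * u).
  by rewrite mulrCA topcoefZ.
rewrite 3!mulrDr !(topcoefD p0) !tZ [a * (f (x * y))%:K]mulrC (topcoefZ p0).
have fC c : f (c%:K) = c * f 1 by rewrite -{1}[RtoK p c]mulr1 fZ.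
rewrite [in RHS](topcoef_basis p0 a) !fD fC !fZ.
by congr (_ + _ + _ + _); rewrite mulrC.
Qed.

(** By exactness the image of each differential is the common kernel of R-valued functionals: the
    augmentation in degree 0, and otherwise the four characters of the coordinates of the next
    differential. *)
Lemma image_retraction n : exists r : 'rV[K]_(res_rank P n) -> 'rV[K]_(res_rank P n),
  [/\ forall c u v, r (c%:K *: u + v) = c%:K *: r u + r v,
      forall v, exists w, r v = w *m res_d P n
    & forall w, r (w *m res_d P n) = w *m res_d P n].
Proof.
have [I [g [glin gker]]] : exists (I : finType) (g : I -> 'rV[K]_(res_rank P n) -> R),
    (forall i c u v, g i (c%:K *: u + v) = c * g i u + g i v) /\
    forall v, (forall i, g i v = 0) <-> exists w, v = w *m res_d P n.
  case: n => [|n].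
    exists unit, (fun _ v => chi true true (v ord0 ord0)); split=> [_ c u v|v].
      by rewrite !mxE rmorphD rmorphM /= chi_C.
    by rewrite -res_exact0; split=> [/(_ tt)|h _].
  exists ('I_(res_rank P n) * (bool * bool))%type,
     (fun k v => chi k.2.1 k.2.2 ((v *m res_d P n) 0 k.1)); split=> [k c u v|v].
    by rewrite mulmxDl -scalemxAl !mxE rmorphD rmorphM /= chi_C.
  rewrite -res_exact; split=> [h|h k]; last by rewrite h mxE rmorph0.
  apply/rowP => j; rewrite [RHS]mxE; apply: (chi_inj p0) => a b.
  by rewrite rmorph0; exact: (h (j, (a, b))).
have [r [rlin rker rid]] := @kernel_retraction _ _ hR (restr 'rV[K]_(res_rank P n)) I g glin.
exists r; split=> // [v|w].
  by apply/gker => i; apply: rker.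
by apply: rid; apply/gker; exists w.
Qed.

(* Extend v |-> topcoef (v *m u) from the image of d_n, a direct summand over R,
   and represent the extension by the perfect form topcoef. *)
Lemma res_self_injective n (u : 'cV[K]_(res_rank P n.+1)) :
  res_d P n.+1 *m u = 0 -> exists w, u = res_d P n *m w.
Proof.
move=> du; have [r [rlin rim rid]] := image_retraction n.
pose ev (w : 'rV[K]_(res_rank P n.+1)) : R := topcoef ((w *m u) 0 0).
have evl c v w : ev (c%:K *: v + w) = c * ev v + ev w.
  by rewrite /ev mulmxDl -scalemxAl !mxE (topcoef_linear p0).
have ev_wd w w' : w *m res_d P n = w' *m res_d P n -> ev w = ev w'.
  move=> E; have /res_exact [z zE] : (w - w') *m res_d P n = 0.
    by rewrite mulmxBl E subrr.
  by rewrite /ev -[w in LHS](subrK w') zE mulmxDl -mulmxA du mulmx0 add0r.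
have [c cE] := choice rim.
pose G v := ev (c v).
have Gl a v w : G (a%:K *: v + w) = a * G v + G w.
  by rewrite /G -evl; apply: ev_wd; rewrite -cE rlin mulmxDl -scalemxAl -!cE.
have GD v w : G (v + w) = G v + G w by have := Gl 1 v w; rewrite rmorph1 scale1r mul1r.
have G0 : G 0 = 0 by apply: (addrI (G 0)); rewrite -GD !addr0.
have rep j : exists e, forall a, topcoef (a * e) = G (a *: delta_mx 0 j).
  apply: topcoef_represents => b v w.
  by rewrite scalerDl -scalerA Gl.
have [e eE] := choice rep.
have tsum (J : finType) (F : J -> K) : topcoef (\sum_k F k) = \sum_k topcoef (F k).
  by apply: big_morph; [exact: topcoefD | exact: topcoef0].
have GE v : topcoef ((v *m \col_j e j) 0 0) = G v.
  rewrite mxE tsum [in RHS](row_sum_delta v) (big_morph G GD G0).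
  by apply: eq_bigr => j _; rewrite mxE eE.
exists (\col_j e j); apply/colP => j; apply/eqP; rewrite -subr_eq0; apply/eqP.
apply: (topcoef_nondeg p0) => a.
pose w : 'rV[K]_(res_rank P n.+1) := a *: delta_mx 0 j.
have coef (z : 'cV[K]_(res_rank P n.+1)) : (w *m z) 0 0 = a * z j 0.
  by rewrite -scalemxAl mxE -rowE mxE.
rewrite mulrBr (topcoefD p0) (topcoefN p0) -!coef mulmxA GE.
rewrite -[topcoef _]/(ev w) -(ev_wd (c (w *m res_d P n)) w) ?subrr //.
by rewrite -cE rid.
Qed.

(** In the dual half of the full resolution columns take the place of rows. Positive degrees use
    self-injectivity, the two positions next to the splice use the annihilators of xy and of the
    augmentation ideal, and the remaining degrees are the exactness of [P] transposed. *)
Lemma full_exact i (u : 'cV[K]_(full_rank P (int_succ i))) :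
  full_d P (int_succ i) *m u = 0 -> exists w, u = full_d P i *m w.
Proof.
case: i u => [n|[|[|n]]] /= u.
- exact: res_self_injective.
- move=> E.
  have gen (v : K) : chi true true v = 0 -> v * u 0 0 = 0.
    move=> cv; have [|w wE] := (res_exact0 (r := P) (\row_(i < 1) v)).1.
      by rewrite mxE.
    have : (\row_(i < 1) v) *m u = 0 by rewrite wE -mulmxA E mulmx0.
    by move/matrixP/(_ 0 0); rewrite mxE big_ord_recl big_ord0 addr0 !mxE.
  have [||c cE] := @augmentation_annihilator (u 0 0).
  + by apply: gen; rewrite rmorphB /= chi_x chi_C subrr.
  + by apply: gen; rewrite rmorphB /= chi_y chi_C subrr.
  exists (\col_(i < 1) c%:K); apply/matrixP => j k.
  by rewrite (ord1 j) (ord1 k) mxE big_ord_recl big_ord0 addr0 !mxE eqxx mulr1n mulrC.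
- move=> E.
  have cu : chi true true (u 0 0) = 0.
    apply/xy_null_chi; have := congr1 (fun A : 'M_(1, 1) => A 0 0) E.
    by rewrite mxE big_ord_recl big_ord0 addr0 !mxE eqxx mulr1n.
  have [|w wE] := (res_exact0 (r := P) u^T).1; first by rewrite mxE.
  by exists w^T; rewrite -trmx_mul -wE trmxK.
- move=> E; have [|w wE] := (res_exact (r := P) (n := n) u^T).1.
    by rewrite -[res_d P n]trmxK -trmx_mul E trmx0.
  by exists w^T; rewrite -trmx_mul -wE trmxK.
Qed.
End FullResolution.

(** * Dimension shifting *)

Section Shift.
Variables (R : idomainType) (p : R).
Hypothesis hR : complete_dvr p.
Let p0 : p != 0 := dvr_p_neq0 hR.
Local Notation K := (K p).
Variable P : resolution p.
Implicit Types L M N X Y Z : lmodType K.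

(* The Tate cohomology in degree i + 1. *)
Definition tate_succ M (i : int) : lmodType R :=
  homology (@delta R p P M i) (@delta R p P M (int_succ i)).

Definition cochain_map M N (h : M -> N) i (f : cochain P M i) : cochain P N i :=
  [ffun j => h (f j)].

Lemma deltaE M i (f : cochain P M i) j :
  delta f j = \sum_l full_d P i j l *: (f l : M).
Proof. by rewrite ffunE. Qed.

Lemma delta_cochain_map M N (h : {linear M -> N}) i (f : cochain P M i) :
  delta (cochain_map h f) = cochain_map h (delta f).
Proof.
apply/ffunP => j; rewrite deltaE [RHS]ffunE deltaE linear_sum.
by apply: eq_bigr => l _; rewrite ffunE linearZ.
Qed.

Lemma cochain_map_lincomb M N (h : {linear M -> N}) i c (f f' : cochain P M i) :
  cochain_map h (c *: f + f') = c *: cochain_map h f + cochain_map h f'.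
Proof.
apply/ffunP => j; rewrite !ffunE -[c *: (f j : restr M)]/(c%:K *: (f j : M)).
by rewrite (linearP h).
Qed.

Lemma cochain_map0 M N (h : {linear M -> N}) i :
  cochain_map h (0 : cochain P M i) = 0.
Proof. by apply/ffunP => j; rewrite !ffunE linear0. Qed.

Lemma cochain_map_inj M N (h : M -> N) i : injective h ->
  injective (@cochain_map M N h i).
Proof.
move=> hi f f' E; apply/ffunP => j; apply: hi.
by have := congr1 (fun k : cochain P N i => k j) E; rewrite !ffunE.
Qed.

Lemma delta_delta M i (f : cochain P M i) : delta (delta f) = 0.
Proof.
apply/ffunP => j; rewrite deltaE [RHS]ffunE.
under eq_bigr => l _ do rewrite deltaE scaler_sumr.
rewrite exchange_big /= big1 // => k _.
under eq_bigr => l _ do rewrite scalerA.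
rewrite -scaler_suml (_ : \sum_l _ = 0) ?scale0r //.
by have := congr1 (fun A => fun_of_matrix A j k) (full_dd hR P i); rewrite !mxE.
Qed.

Lemma Kfree_acyclic n i (f : cochain P (Kfree p n) (int_succ i)) :
  delta f = 0 -> exists g, delta g = f.
Proof.
move=> df.
have sumE k (I : finType) (F : I -> Kfree p n) : (\sum_i F i) k = \sum_i F i k.
  by rewrite (big_morph (fun w : Kfree p n => w k) (id1 := 0) (op1 := +%R)) //;
    [move=> u v | ]; rewrite ffunE.
have col k : exists w : 'cV[K]_(full_rank P i),
   (\col_j (f j : Kfree p n) k) = full_d P i *m w.
  apply: (full_exact hR); apply/colP => j; rewrite !mxE.
  have := congr1 (fun h : cochain P (Kfree p n) _ => (h j : Kfree p n) k) df.
  rewrite deltaE sumE 2![in RHS]ffunE => E; rewrite -[RHS]E.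
  by apply: eq_bigr => l _; rewrite mxE ffunE.
have [w wE] := choice col.
exists [ffun j => [ffun k => w k j 0] : Kfree p n]; apply/ffunP => j.
apply/ffunP => k; rewrite deltaE sumE.
have := congr1 (fun A : 'cV_(full_rank P (int_succ i)) => A j 0) (wE k).
rewrite !mxE => ->; apply: eq_bigr => l _.
by rewrite !ffunE.
Qed.

(** The connecting homomorphism as a relation: f is paired with f' if some lift g of f has
    coboundary i f'. The free middle term is acyclic, which makes the relation bijective on
    classes. *)
Lemma tate_shift N X n (i : {linear N -> Kfree p n}) (q : {linear Kfree p n -> X}) k :
  short_exact i q -> lmod_iso (tate_succ X k) (tate_succ N (int_succ k)).
Proof.
move=> [iinj qker qonto].
have lift m (f : cochain P X m) : exists g, cochain_map q g = f.
  have [s sE] := choice qonto.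
  by exists (cochain_map s f); apply/ffunP => j; rewrite !ffunE sE.
have kerq m (g : cochain P (Kfree p n) m) : cochain_map q g = 0 ->
    exists f, cochain_map i f = g.
  move=> E; have ex j : exists v, i v = g j.
    by apply/qker; have := congr1 (fun h : cochain P X m => h j) E; rewrite !ffunE.
  have [s sE] := choice ex.
  by exists [ffun j => s j]; apply/ffunP => j; rewrite !ffunE sE.
have qi m (f : cochain P N m) : cochain_map q (cochain_map i f) = 0.
  by apply/ffunP => j; rewrite !ffunE; apply/qker; exists (f j).
have iI m := @cochain_map_inj _ _ i m iinj.
apply: (@homology_iso _ _ _ _ _ _ _ _ _ _ _ (fun f f' =>
   exists2 g, cochain_map q g = f & delta g = cochain_map i f')).
- move=> c u v u' v' [g <- gE] [g' <- gE']; exists (c *: g + g').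
    by rewrite cochain_map_lincomb.
  by rewrite linearP /= gE gE' cochain_map_lincomb.
- move=> f df; have [g gE] := lift _ f.
  have [|f' fE'] := kerq _ (delta g); first by rewrite -delta_cochain_map gE.
  exists f'; last by exists g.
  by apply: iI; rewrite -delta_cochain_map fE' delta_delta cochain_map0.
- move=> f f' df df' [g gE dg]; split=> [[e eE]|[e eE]].
    have [e' eE'] := lift _ e.
    have [|c cE] := kerq _ (g - delta e').
      rewrite -scaleN1r addrC cochain_map_lincomb -delta_cochain_map eE' eE gE.
      by rewrite scaleN1r addNr.
    exists c; apply: iI.
    by rewrite -delta_cochain_map cE linearB /= delta_delta subr0.
  have [|e' eE'] := @Kfree_acyclic n _ (g - cochain_map i e).
    by rewrite linearB /= delta_cochain_map eE dg subrr.
  exists (cochain_map q e'); rewrite /= delta_cochain_map eE'.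
  by rewrite -scaleN1r addrC cochain_map_lincomb qi scaler0 add0r.
- move=> f' df'; have [|g gE] := @Kfree_acyclic n _ (cochain_map i f').
    by rewrite delta_cochain_map df' cochain_map0.
  exists (cochain_map q g); last by exists g.
  by rewrite /= delta_cochain_map gE qi.
Qed.

Lemma tate_split_embeds M N k : split_embeds M N ->
  lmod_embeds (tate_succ M k) (tate_succ N k).
Proof.
move=> [u [r ru]].
have ruE m (f : cochain P M m) : cochain_map r (cochain_map u f) = f.
  by apply/ffunP => j; rewrite !ffunE ru.
apply: (@homology_embeds _ _ _ _ _ _ _ _ _ _ _ (fun f f' => cochain_map u f = f')).
- by move=> c f v f' v' <- <-; rewrite cochain_map_lincomb.
- by move=> f df; exists (cochain_map u f); rewrite //= delta_cochain_map df cochain_map0.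
- move=> f f' _ _ <-; split=> [[e <-]|[e eE]].
    by exists (cochain_map u e); rewrite /= delta_cochain_map.
  by exists (cochain_map r e); rewrite /= delta_cochain_map eE ruE.
Qed.

Lemma lmod_iso_split M N : lmod_iso M N -> split_embeds M N /\ split_embeds N M.
Proof.
move=> MN; have [g [g' gK g'K]] := lmod_iso_sym MN.
have [f [f' fK f'K]] := MN.
have [|fi fiE] := @linear_bundle _ _ _ _ f'.
  by move=> a u v; apply: (can_inj fK); rewrite (linearP f) !f'K.
by split; [exists f, fi | exists fi, f] => v; rewrite fiE.
Qed.

Definition mutual_shift (d : int) M N : Prop := forall k,
  lmod_embeds (tate_succ N (k + d)) (tate_succ M k) /\
  lmod_embeds (tate_succ M k) (tate_succ N (k + d)).

Lemma is_tau_shift M N : is_tau M N -> mutual_shift 1 M N.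
Proof.
move=> [_ _ [E [f [g fg]]]] k; rewrite -int_succE.
have [[latN _ latM] _] := fg.
have [n [Y [i [q [iq latY]]]]] := free_cover p0 latM.
have [n' [X [i' [q' [iq' latX]]]]] := free_hull p0 latN.
split.
  apply: lmod_embeds_trans (tate_split_embeds _ (almost_split_syzygy hR fg iq latY)) _.
  exact/lmod_iso_embeds/lmod_iso_sym/(tate_shift _ iq).
apply: lmod_embeds_trans (tate_split_embeds _ (almost_split_cosyzygy hR fg iq' latX)) _.
exact/lmod_iso_embeds/(tate_shift _ iq').
Qed.

Lemma is_tau_iter_shift n M N : is_tau_iter n M N -> mutual_shift n%:Z M N.
Proof.
elim: n N => [|n IH] N /=.
  move=> /lmod_iso_split [MN NM] k; rewrite addr0.
  by split; apply: tate_split_embeds.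
move=> [L /IH ML /is_tau_shift LN] k.
rewrite intS [1 + _]addrC addrA.
have [a b] := ML k; have [c d] := LN (k + n%:Z).
by split; [apply: lmod_embeds_trans c a | apply: lmod_embeds_trans b d].
Qed.

(** For negative k the definition makes M an iterated translate of N, so the two embeddings exchange
    their roles. *)
Lemma is_tau_pow_shift (k : int) M N : is_tau_pow k M N -> mutual_shift k M N.
Proof.
case: k => n; first exact: is_tau_iter_shift.
move=> /is_tau_iter_shift NM k.
have := NM (k + Negz n).
by rewrite NegzE subrK => -[].
Qed.

Lemma tate_tau_pow (k n : int) M N (V : lmodType R) : is_tau_pow k M N ->
  (forall f : {linear V -> V}, injective f -> forall v, exists u, f u = v) ->
  lmod_iso (tate_succ M (n - k - 1)) V -> lmod_iso (tate_cohomology P N n) V.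
Proof.
move=> /is_tau_pow_shift /(_ (n - k - 1)) [NM MN] coH MV.
have E : n - k - 1 + k = n - 1 by rewrite addrAC subrK.
rewrite E in NM MN.
apply: coHopfian_sandwich coH _ _.
  apply: lmod_embeds_trans MN.
  exact/lmod_iso_embeds/lmod_iso_sym.
by apply: lmod_embeds_trans NM _; apply: lmod_iso_embeds.
Qed.

End Shift.

(** * Independence of the resolution *)

Section Comparison.
Variables (R : idomainType) (p : R).
Hypothesis hR : complete_dvr p.
Let p0 : p != 0 := dvr_p_neq0 hR.
Local Notation K := (K p).
Implicit Types M N : lmodType K.

(** For every resolution, the entries of the first differential generate the augmentation ideal. *)
Lemma degree0_cocycle (P : resolution p) M (f : cochain P M (Posz 0)) :
  delta f = 0 <-> forall u : K, chi true true u = 0 -> u *: (f ord0 : M) = 0.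
Proof.
split=> [df u cu|df].
  have [|w wE] := (res_exact0 (r := P) (\row_(i < 1) u)).1; first by rewrite mxE.
  have := congr1 (fun v : 'rV_1 => v 0 0) wE; rewrite mxE => ->.
  rewrite mxE scaler_suml big1 // => j _; rewrite -scalerA.
  move/ffunP/(_ j): (df).
  by rewrite deltaE big_ord_recl big_ord0 addr0 ffunE => ->; rewrite scaler0.
apply/ffunP => j; rewrite deltaE big_ord_recl big_ord0 addr0 [RHS]ffunE df //.
exact: res_d0_chi.
Qed.

(* Dimension shifting reduces to degree 0, where P enters only through the
   augmentation ideal. *)
Lemma tate_comparison (P P' : resolution p) i M : lattice M ->
  lmod_iso (tate_succ P M i) (tate_succ P' M i).
Proof.
have step_up k : (forall M, lattice M -> lmod_iso (tate_succ P M k) (tate_succ P' M k)) ->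
    forall M, lattice M ->
      lmod_iso (tate_succ P M (int_succ k)) (tate_succ P' M (int_succ k)).
  move=> IH N latN; have [n [X [a [q [aq latX]]]]] := free_hull p0 latN.
  apply: lmod_iso_trans (lmod_iso_sym (tate_shift hR P k aq)) _.
  exact: lmod_iso_trans (IH _ latX) (tate_shift hR P' k aq).
have step_down k : (forall M, lattice M ->
      lmod_iso (tate_succ P M (int_succ k)) (tate_succ P' M (int_succ k))) ->
    forall M, lattice M -> lmod_iso (tate_succ P M k) (tate_succ P' M k).
  move=> IH N latN; have [n [Y [a [q [aq latY]]]]] := free_cover p0 latN.
  apply: lmod_iso_trans (tate_shift hR P k aq) _.
  exact: lmod_iso_trans (IH _ latY) (lmod_iso_sym (tate_shift hR P' k aq)).
(* [Negz 0] gives cohomology in degree 0. There both complexes have N itself as cochains and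
   multiplication by xy as incoming map, so the identity relation serves. *)
have base N : lattice N -> lmod_iso (tate_succ P N (Negz 0)) (tate_succ P' N (Negz 0)).
  move=> _; apply: (@homology_iso _ _ _ _ _ _ _ _ _ _ _
     (fun (f : cochain P N (Posz 0)) (f' : cochain P' N (Posz 0)) => f = f')).
  - by move=> c u v u' v' <- <-.
  - move=> f df; exists f => //.
    exact: (@degree0_cocycle P' N f).2 ((@degree0_cocycle P N f).1 df).
  - by move=> f f' _ _ <-; split.
  - move=> f df; exists f => //.
    exact: (@degree0_cocycle P N f).2 ((@degree0_cocycle P' N f).1 df).
case: i M => n; elim: n => [|n IH].
- exact: step_up base.
- exact: step_up IH.
- exact: base.
- exact: (step_down (Negz n.+1)).
Qed.

End Comparison.

(** * The tensor product resolution *)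

Section ExplicitResolution.
Variables (R : idomainType) (p : R).
Hypothesis p0 : p != 0.
Local Notation K := (K p).
Local Notation x := (xK p).
Local Notation y := (yK p).

(** The differential from degree j to j - 1 of the periodic resolution; the first one is x - p, with
    x acting as p on the resolved module R. *)
Definition dx (j : nat) : K := if odd j then x - p%:K else x.
Definition dy (j : nat) : K := if odd j then y - p%:K else y.

Lemma dx_dx j : dx j.+1 * dx j = 0.
Proof. by rewrite /dx /=; case: odd => /=; rewrite ?xK_root // mulrC xK_root. Qed.

Lemma dy_dy j : dy j.+1 * dy j = 0.
Proof. by rewrite /dy /=; case: odd => /=; rewrite ?yK_root // mulrC yK_root. Qed.

Lemma chi_dx a b j : chi a b (dx j) = pz p a - pz p (odd j).
Proof. by rewrite /dx; case: odd; rewrite ?rmorphB /= ?chi_C chi_x ?subr0. Qed.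

Lemma chi_dy a b j : chi a b (dy j) = pz p b - pz p (odd j).
Proof. by rewrite /dy; case: odd; rewrite ?rmorphB /= ?chi_C chi_y ?subr0. Qed.

Let mulp_eq0 (a : R) : a * p = 0 -> a = 0.
Proof. by move/eqP; rewrite mulf_eq0 (negPf p0) orbF => /eqP. Qed.

Let mulNp_eq0 (a : R) : a * - p = 0 -> a = 0.
Proof. by rewrite mulrN => /eqP; rewrite oppr_eq0 => /eqP/mulp_eq0. Qed.

Lemma annihilator_dx j (u : K) : u * dx j = 0 -> exists v, u = v * dx j.+1.
Proof.
have [a [b [c [d uE]]]] := K_basis u.
(* The coefficient of x in u, viewed as a polynomial in x over R[y]. *)
move=> E; exists (b%:K + d%:K * y).
have ev a' b' := congr1 (chi a' b') E.
have {ev}ev a' b' : (a + b * pz p a' + c * pz p b' + d * (pz p a' * pz p b'))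
    * (pz p a' - pz p (odd j)) = 0.
  by have := ev a' b'; rewrite rmorphM /= rmorph0 chi_dx uE chi_basis.
apply: (chi_inj p0) => a' b'; rewrite uE chi_basis.
rewrite rmorphM /= rmorphD rmorphM /= !chi_C chi_y chi_dx.
move: (ev (~~ odd j) true) (ev (~~ odd j) false); rewrite /=.
case: (odd j); rewrite /pz /= ?subr0 ?sub0r.
  move=> /mulNp_eq0 E1 /mulNp_eq0 E2.
  have {}E2 : a = 0 by rewrite -E2; ring.
  have {}E1 : c = 0 by apply: mulp_eq0; rewrite -E1 E2; ring.
  by rewrite E1 E2; case: a'; case: b'; ring.
move=> /mulp_eq0 E1 /mulp_eq0 E2.
have {}E2 : a = - b * p.
  by apply/eqP; rewrite -subr_eq0 -[X in _ == X]E2; apply/eqP; ring.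
have {}E1 : c = - d * p.
  apply/eqP; rewrite -subr_eq0; apply/eqP/mulp_eq0.
  by rewrite -[RHS]E1 E2; ring.
by rewrite E1 E2; case: a'; case: b'; ring.
Qed.

(** Exactness of the y-resolution over K/(x - p). The witnesses come from the division u = (a + bp)
    + (c + dp)y + (b + dy)(x - p). *)
Lemma annihilator_dy_mod j (u w : K) : u * dy j + w * (x - p%:K) = 0 ->
  exists v w', u = v * dy j.+1 + w' * (x - p%:K).
Proof.
have [a [b [c [d uE]]]] := K_basis u.
move=> E; exists ((c + d * p)%:K), (b%:K + d%:K * y).
have ev : (a + b * p + c * pz p (~~ odd j) + d * (p * pz p (~~ odd j)))
    * (pz p (~~ odd j) - pz p (odd j)) = 0.
  have := congr1 (chi true (~~ odd j)) E.
  rewrite rmorphD rmorphM /= rmorphM rmorphB /= rmorph0 chi_x chi_C chi_dy uE chi_basis.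
  by rewrite /pz subrr mulr0 addr0.
apply: (chi_inj p0) => a' b'; rewrite uE chi_basis.
rewrite rmorphD !rmorphM /= (rmorphD (chi a' b')) rmorphB rmorphM /= !chi_C chi_x chi_y chi_dy.
move: ev; rewrite /=; case: (odd j); rewrite /pz /= ?subr0 ?sub0r.
  move=> /mulNp_eq0 E1.
  have {}E1 : a = - b * p.
    by apply/eqP; rewrite -subr_eq0 -[X in _ == X]E1; apply/eqP; ring.
  by rewrite E1; case: a'; case: b'; ring.
move=> /mulp_eq0 E1.
have {}E1 : a = - b * p - c * p - d * (p * p).
  by apply/eqP; rewrite -subr_eq0 -[X in _ == X]E1; apply/eqP; ring.
by rewrite E1; case: a'; case: b'; ring.
Qed.

(* The boundary of the element with coordinates v_0, ..., v_(n+1) on the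
   generators e_j (x) e'_(n+1-j) of the tensor product of the periodic
   resolutions of R over R[x]/(x(x-p)) and R[y]/(y(y-p)). *)
Definition tensor_d (n : nat) (v : nat -> K) (l : nat) : K :=
  v l.+1 * dx l.+1 + v l * ((-1) ^+ l * dy (n.+1 - l)).

Lemma tensor_dd n v l : (l <= n)%N -> tensor_d n (tensor_d n.+1 v) l = 0.
Proof.
move=> le_ln; rewrite /tensor_d subSS (subSn (leqW le_ln)) (subSn le_ln).
rewrite exprS.
have := (dx_dx l.+1, dy_dy (n - l).+1).
move: (dx l.+2) (dx l.+1) (dy (n - l).+2) (dy (n - l).+1) ((-1) ^+ l : K) => a b c d s [ab cd].
transitivity (v l.+2 * (a * b) + v l * (s * s * (c * d))); first by ring.
by rewrite ab cd !mulr0 addr0.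
Qed.

(** The preimage is built one coordinate at a time. The coordinates w_0, w_1 come from exactness in
    y modulo x - p = [dx 1]; each later one comes from exactness in x. *)
Lemma tensor_exact n v : (forall l, (l <= n)%N -> tensor_d n v l = 0) ->
  exists w, forall l, (l <= n.+1)%N -> v l = tensor_d n.+1 w l.
Proof.
move=> dv.
suff: forall m, (m <= n.+1)%N -> exists w, forall l, (l <= m)%N -> v l = tensor_d n.+1 w l.
  by apply.
elim=> [_|m IH lt_m].
  have := dv 0%N isT; rewrite /tensor_d expr0 !mul1r subn0 addrC => /annihilator_dy_mod [a [b E]].
  exists (fun k => if k is 0 then a else b) => l; rewrite leqn0 => /eqP ->.
  by rewrite subn0 expr0 mul1r E addrC.
have [w wE] := IH (ltnW lt_m).
(* What the next coordinate must produce: w_(m+2) has to satisfy [rest] = w_(m+2) [dx m.+2]. *)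
pose rest := v m.+1 - w m.+1 * ((-1) ^+ m.+1 * dy (n.+2 - m.+1)).
have : rest * dx m.+1 = 0.
  have := dv m lt_m; have := wE m (leqnn m).
  rewrite /rest /tensor_d subSS (subSn (ltnW lt_m)) exprS.
  have := dy_dy (n.+1 - m).
  move: (v m) (v m.+1) (w m) (w m.+1) (dx m.+1) (dy (n.+1 - m).+1) (dy (n.+1 - m)) ((-1) ^+ m : K).
  move=> vm vm1 wm wm1 a c d s cd -> E.
  rewrite -[RHS]E; apply/eqP; rewrite -subr_eq0; apply/eqP.
  transitivity (- wm * s * s * (c * d)); first by ring.
  by rewrite cd mulr0.
move=> /annihilator_dx [u uE].
exists (fun k => if k == m.+2 then u else w k) => l le_l; rewrite /tensor_d.
rewrite (ltn_eqF (le_l : (l < m.+2)%N)) eqSS.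
move: le_l; rewrite leq_eqVlt => /orP[/eqP ->|lt_l].
  by rewrite eqxx -uE /rest subrK.
by rewrite (ltn_eqF lt_l) wE.
Qed.

(** Extension by zero lets the differentials be formulas on natural indices, with no boundary cases
    and no casts between ordinals. *)
Definition nat_ext (r : nat) (V : zmodType) (v : 'I_r -> V) (k : nat) : V :=
  if insub k is Some j then v j else 0.

Lemma nat_extE r (V : zmodType) (v : 'I_r -> V) (j : 'I_r) : nat_ext v j = v j.
Proof. by rewrite /nat_ext valK. Qed.

Lemma nat_ext_out r (V : zmodType) (v : 'I_r -> V) k : (r <= k)%N -> nat_ext v k = 0.
Proof. by move=> le; rewrite /nat_ext insubF // ltnNge le. Qed.

Lemma nat_ext_pick r (V : zmodType) (v : 'I_r -> V) k :
  \sum_(j < r) (if (j : nat) == k then v j else 0) = nat_ext v k.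
Proof.
rewrite -big_mkcond /= /nat_ext; case: insubP => [j _ jk|nlt].
  rewrite (big_pred1 j) // => i; by rewrite -jk.
by rewrite big_pred0 // => i; apply: contraNF nlt => /eqP <-.
Qed.

(** Written with [rank_of], not as n + 1, so that it is convertible to the rank in the record. *)
Definition tensor_rank (n : nat) := rank_of (fun n => n.+2) n.

Lemma tensor_rankE n : tensor_rank n = n.+1. Proof. by case: n. Qed.

Definition tensor_mx n : 'M[K]_(tensor_rank n.+1, tensor_rank n) :=
  \matrix_(j, l) ((if (j : nat) == l.+1 then dx j else 0)
                + (if (j : nat) == l then (-1) ^+ j * dy (n.+1 - j) else 0)).

Lemma tensor_mxE n (v : 'rV_(tensor_rank n.+1)) l :
  (v *m tensor_mx n) 0 l = tensor_d n (nat_ext (v 0)) l.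
Proof.
rewrite /tensor_d mxE -!nat_ext_pick !mulr_suml -big_split /=; apply: eq_bigr => j _.
rewrite mxE mulrDr.
by congr (_ + _); case: eqP => [->|_]; rewrite ?mulr0 ?mul0r.
Qed.

Fact tensor_exact0 (v : 'rV[K]_(tensor_rank 0)) :
  chi true true (v ord0 ord0) = 0 <-> exists w, v = w *m tensor_mx 0.
Proof.
split=> [/(chi_true_ker p0) [a [b E]]|[w ->]]; last first.
  rewrite tensor_mxE /tensor_d rmorphD !rmorphM /= chi_dx chi_dy.
  by rewrite !subrr !mulr0 addr0.
exists (\row_(j < 2) if (j : nat) == 0%N then b else a); apply/rowP => l.
rewrite tensor_mxE /tensor_d (ord1 l) E addrC.
have ext (u : 'rV[K]_2) : nat_ext (u 0) 0 = u 0 0 /\ nat_ext (u 0) 1 = u 0 1.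
  by split; [rewrite -(nat_extE (u 0) 0) | rewrite -(nat_extE (u 0) 1)].
have [-> ->] := ext (\row_(j < 2) if (j : nat) == 0%N then b else a).
by rewrite !mxE /= /dx /dy /= expr0 mul1r addrC.
Qed.

Fact tensor_exactS n (v : 'rV[K]_(tensor_rank n.+1)) :
  v *m tensor_mx n = 0 <-> exists w, v = w *m tensor_mx n.+1.
Proof.
split=> [E|[w ->]].
  have [l le_ln|w wE] := @tensor_exact n (nat_ext (v 0)).
    have lt_l : (l < tensor_rank n)%N by rewrite tensor_rankE.
    by rewrite -[l]/(val (Ordinal lt_l)) -tensor_mxE E mxE.
  exists (\row_j w j); apply/rowP => l; rewrite tensor_mxE -[LHS](nat_extE (v 0)).
  rewrite wE; last by rewrite -ltnS; exact: (ltn_ord l).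
  have ext k : (k <= n.+2)%N -> nat_ext ((\row_(j < tensor_rank n.+2) w j) 0) k = w k.
    by move=> le; rewrite -[k]/(val (Ordinal (le : (k < tensor_rank n.+2)%N))) nat_extE mxE.
  have lt_l := ltn_ord l.
  by rewrite /tensor_d !ext // ltnW.
apply/rowP => l; rewrite tensor_mxE mxE.
have lt_l : (l <= n)%N by have := ltn_ord l; rewrite [X in (_ < X)%N](tensor_rankE n).
rewrite -(tensor_dd (nat_ext (w 0)) lt_l) /tensor_d.
have ext k : (k <= n.+1)%N -> nat_ext ((w *m tensor_mx n.+1) 0) k = tensor_d n.+1 (nat_ext (w 0)) k.
  move=> le; rewrite -[k in LHS]/(val (Ordinal (le : (k < tensor_rank n.+1)%N))).
  by rewrite nat_extE tensor_mxE.
by rewrite !ext // ltnW.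
Qed.

Definition tensor_resolution : resolution p :=
  @Resolution R p (fun n => n.+2) tensor_mx tensor_exact0 tensor_exactS.

End ExplicitResolution.

(** * Cohomology of the rank one lattices and of A *)

Section CyclicTargets.
Variables (R : comNzRingType) (q : R).

Lemma cyclic_pi0 (a : R) :
  lmod_pi (multiples_submod q) (a : R^o) = 0 <-> exists b, a = q * b.
Proof.
rewrite -(linear0 (lmod_pi (multiples_submod q))) lmod_pi_eq subr0.
by split=> [/asboolP|h] //; apply/asboolP.
Qed.

Variables (U V W : lmodType R) (f : {linear U -> V}) (g : {linear V -> W}).

(** The coordinates need to be realised only modulo q; for A, cocycles with prescribed coordinates
    are found only up to such a correction. *)
Lemma homology_cyclic_pow (I : finType) (c : I -> V -> R) :
  (forall i a u v, c i (a *: u + v) = a * c i u + c i v) ->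
  (forall z : I -> R, exists2 u, g u = 0 & forall i, exists b, c i u = z i + q * b) ->
  (forall u, g u = 0 -> ((exists e, f e = u) <-> forall i, exists b, c i u = q * b)) ->
  lmod_iso (homology f g) (cyclic_pow q #|I|).
Proof.
move=> clin conto cbound.
apply: (@homology_iso_onto _ _ _ _ _ _ _ (fun u (z : cyclic_pow q #|I|) =>
  forall i, z (enum_rank i) = lmod_pi (multiples_submod q) (c i u : R^o))).
- move=> a u v u' v' h h' i.
  by rewrite !ffunE h h' clin -linearP.
- move=> u _; exists [ffun k => lmod_pi (multiples_submod q) (c (enum_val k) u : R^o)].
  by move=> i; rewrite ffunE enum_rankK.
- move=> z.
  have [u gu uE] := conto (fun i => generic_quotient.repr (z (enum_rank i)) : R^o).
  exists u => // i; have [b ->] := uE i; rewrite -[LHS]lmod_piK.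
  by apply/esym/lmod_pi_eq/asboolP; exists b; rewrite addrC addKr.
- move=> u z gu uz; rewrite cbound //; split=> [h|z0 i].
    apply/ffunP => k; rewrite ffunE -(enum_valK k) uz.
    exact/cyclic_pi0.
  by apply/cyclic_pi0; rewrite -uz z0 ffunE.
Qed.

Lemma homology_cyclic (c : V -> R) :
  (forall a u v, c (a *: u + v) = a * c u + c v) ->
  (forall z : R, exists2 u, g u = 0 & c u = z) ->
  (forall u, g u = 0 -> ((exists e, f e = u) <-> exists b, c u = q * b)) ->
  lmod_iso (homology f g) (cyclic_mod q).
Proof.
move=> clin conto cbound.
apply: (@homology_iso_onto _ _ _ _ _ _ _ (fun u (z : cyclic_mod q) =>
  z = lmod_pi (multiples_submod q) (c u : R^o))).
- by move=> a u v u' v' -> ->; rewrite clin -linearP.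
- by move=> u _; exists (lmod_pi (multiples_submod q) (c u : R^o)).
- move=> z; have [u gu uE] := conto (generic_quotient.repr z : R^o).
  by exists u; rewrite // uE lmod_piK.
- by move=> u z gu ->; rewrite cbound // cyclic_pi0.
Qed.

End CyclicTargets.

(* The tensor resolution with coefficients in R_ab: up to the scalars p and s,
   the maps are x-part A and y-part B with entries 0 and 1, whose indices of
   nonzero entries alternate. *)
Section ZigZag.
Variables (R : idomainType) (p : R).
Hypothesis p0 : p != 0.
Variables (A B : nat -> bool) (s t : R).
Hypotheses (AS : forall j, A j.+1 = ~~ A j) (BS : forall j, B j.+1 = ~~ B j).
Hypotheses (ss : s * s = 1) (tt : t * t = 1).

Let sg (j : nat) : R := (-1) ^+ j * t.

Let sgS j : sg j.+1 = - sg j. Proof. by rewrite /sg exprS !mulNr mul1r. Qed.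
Let sg_sqr j : sg j * sg j = 1.
Proof. by rewrite /sg mulrACA tt mulr1 -exprD addnn -mul2n exprM sqrrN !expr1n. Qed.

Definition zigzag_up (m : nat) (F : nat -> R) (j : nat) : R :=
  (if j is j'.+1 then (A j)%:R * F j' else 0) + sg j * ((B (m.+1 - j))%:R * F j).

Definition zigzag_down (m : nat) (F : nat -> R) (l : nat) : R :=
  (A l.+1)%:R * F l.+1 + sg l * ((B (m.+1 - l))%:R * F l).

(** The free coordinates of a cocycle. If A j fails, row j + 1 expresses F j through F (j+1); if B
    (m+1) holds, row 0 forces F 0 = 0. *)
Definition up_index (m j : nat) : bool := A j && ~~ ((j == 0%N) && B m.+1).

(** The free coordinates of a cocycle in the dual complex. A coordinate l + 1 with A (l+1) is
    determined by coordinate l. Index 0 has no predecessor and stays free also when B (m+1)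
    holds. *)
Definition down_index (m l : nat) : bool := A l.+1 || ((l == 0%N) && B m.+1).

(** The complex with entries 0 and 1 is exact here, so coboundaries of the actual complex are p
    times cocycles. Divisibility by p need only be tested at the free coordinates. *)
Lemma zigzag_up_bounds m F : (forall k, (m.+1 < k)%N -> F k = 0) ->
  (forall j, (j <= m.+2)%N -> zigzag_up m.+1 F j = 0) ->
  (forall j, (j <= m.+1)%N -> up_index m.+1 j -> exists b, F j = p * b) ->
  exists G, (forall k, (m < k)%N -> G k = 0) /\
    forall j, (j <= m.+1)%N -> F j = p * (s * zigzag_up m G j).
Proof.
move=> F0 cocyc div.
have div' j : exists h, A j -> F j = p * h.
  have [le_j|lt_j] := leqP j m.+1; last by exists 0; rewrite F0 // mulr0.
  case: (boolP (A j)) => [Aj|_]; last by exists 0.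
  case: (boolP (up_index m.+1 j)) => [/(div j le_j) [b ->]|]; first by exists b.
  rewrite /up_index Aj /= negbK => /andP[/eqP -> Bm].
  exists 0 => _; have := cocyc 0%N isT; rewrite /zigzag_up subn0 Bm mul1r add0r => E.
  by rewrite mulr0 -[F 0%N]mul1r -(sg_sqr 0) -mulrA E mulr0.
have [h hE] := choice div'.
have h0 k : A k -> (m.+1 < k)%N -> h k = 0.
  move=> Ak lt_k; have /esym/eqP := hE k Ak.
  by rewrite F0 // mulf_eq0 (negPf p0) => /eqP.
(* If A (k+1), row k + 1 returns G k. A nonzero entry at row 0 can be reached only through the
   B-part, whence the exceptional value of G 0. *)
pose G k := s * (if A k.+1 then h k.+1 else if k == 0%N then sg 0 * h 0%N else 0).
exists G; split=> [k lt_mk|j le_j].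
  by rewrite /G; case: ifP => [Ak|_]; [rewrite h0 ?mulr0 | case: k lt_mk => [|k] //=; rewrite mulr0].
rewrite /zigzag_up /G.
case: (boolP (A j)) => Aj; last first.
  have -> : (if j is j'.+1 then false%:R * (s * (if A j'.+1 then h j'.+1 else if j' == 0%N then sg 0 * h 0%N else 0)) else 0) = 0 :> R.
    by case: (j) => // k; rewrite mul0r.
  rewrite AS Aj add0r.
  have := cocyc j.+1 le_j; rewrite /zigzag_up subSS AS Aj mul1r sgS.
  rewrite (hE j.+1) ?AS // => /eqP; rewrite mulNr subr_eq0 => /eqP ->.
  transitivity (s * s * (p * (sg j * ((B (m.+1 - j))%:R * h j.+1)))); last by ring.
  by rewrite ss mul1r; ring.
rewrite AS Aj /=; case: j le_j Aj => [|j] le_j Aj.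
  rewrite add0r subn0 (hE 0%N) //; case: (boolP (B m.+1)) => Bm.
    transitivity (s * s * (p * (sg 0 * sg 0 * h 0%N))); last by rewrite /=; ring.
    by rewrite ss sg_sqr !mul1r.
  have : F 0%N = 0.
    have := cocyc 0%N isT; rewrite /zigzag_up subn0 BS Bm mul1r add0r => E.
    by rewrite -[F 0%N]mul1r -(sg_sqr 0) -mulrA E mulr0.
  by rewrite hE // => ->; rewrite mul0r !mulr0.
rewrite Aj /= !mulr0 addr0 mul1r (mulrA s) ss mul1r; exact: hE.
Qed.

Lemma zigzag_up_lift m (c : nat -> R) : exists F, [/\ forall k, (m < k)%N -> F k = 0,
   forall j, (j <= m.+1)%N -> zigzag_up m F j = 0
   & forall j, (j <= m)%N -> up_index m j -> F j = c j].
Proof.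
pose c' k := if (k <= m)%N && up_index m k then c k else 0.
(* Where A j fails, the value is the one forced by row j + 1 of the cocycle condition. *)
pose F j := if A j then c' j else sg j * ((B (m - j))%:R * c' j.+1).
have c'0 k : (m < k)%N -> c' k = 0 by move=> lt; rewrite /c' leqNgt lt.
exists F; split=> [k lt_mk|j le_j|j le_j Ij].
- by rewrite /F !c'0 ?mulr0 ?if_same // ltnW.
- rewrite /zigzag_up /F; case: (boolP (A j)) => Aj.
    case: j le_j Aj => [_ A0|j le_j Aj].
      rewrite add0r subn0 /c' /up_index A0 /=.
      by case: (B _); rewrite /= ?mul0r ?mulr0.
    have nAj : A j = false by move: Aj; rewrite AS => /negPf.
    by rewrite nAj subSS sgS mul1r mulNr subrr.
  have -> : (if j is j'.+1 then false%:R * (if A j' then c' j' else sg j' * ((B (m - j'))%:R * c' j'.+1)) else 0) = 0 :> R.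
    by case: (j) => // k; rewrite mul0r.
  rewrite add0r; move: le_j; rewrite leq_eqVlt => /orP[/eqP ->|le_j].
    by rewrite c'0 ?mulr0.
  by rewrite subSn // BS; case: (B (m - j)); rewrite /= ?mul0r ?mulr0 ?mul0r ?mulr0.
- by move: (Ij); rewrite /up_index => /andP[Aj _]; rewrite /F Aj /c' le_j Ij.
Qed.

(** The second hypothesis replaces the cocycle condition in degree -1 (m = 0), where the first is
    vacuous: the outgoing map is the action of xy, which is injective when A 1 and B 1 both fail and
    zero otherwise. *)
Lemma zigzag_down_bounds m F :
  (forall l, (l < m)%N -> zigzag_down m.-1 F l = 0) ->
  (m = 0%N -> ~~ A 1 -> ~~ B 1 -> F 0%N = 0) ->
  (forall l, (l <= m)%N -> down_index m l -> exists b, F l = p * b) ->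
  exists G, (forall k, (m.+1 < k)%N -> G k = 0) /\
    forall l, (l <= m)%N -> F l = p * (s * zigzag_down m G l).
Proof.
move=> cocyc deg0 div.
have div' j : exists h, (j <= m)%N -> down_index m j -> F j = p * h.
  have [le_j|lt_j] := leqP j m; last by exists 0.
  case: (boolP (down_index m j)) => [/(div j le_j) [b ->]|_]; first by exists b.
  by exists 0.
have [h hE] := choice div'.
pose G k := s * (if k is k'.+1 then (if (k' <= m)%N && A k then h k' else 0)
   else if ~~ A 1 && B m.+1 then sg 0 * h 0%N else 0).
exists G; split=> [k|l le_l].
  by rewrite /G; case: k => [|k] //; rewrite ltnS ltnNge => /negPf ->; rewrite mulr0.
rewrite /zigzag_down /G le_l /=.
case: (boolP (A l.+1)) => Al.
  rewrite hE /down_index ?Al //=.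
  case: l le_l Al => [|l] le_l Al; first by rewrite Al /= !mulr0 addr0 mul1r (mulrA s) ss mul1r.
  move: (Al); rewrite AS => /negPf ->; rewrite andbF !mulr0 addr0 mul1r.
  by rewrite (mulrA s) ss mul1r.
rewrite mul0r add0r; case: l le_l Al => [|l] le_l Al.
  rewrite subn0 Al /=; case: (boolP (B m.+1)) => Bm.
    rewrite hE ?/down_index ?Bm ?orbT //.
    transitivity (s * s * (p * (sg 0 * sg 0 * h 0%N))); last by rewrite /=; ring.
    by rewrite ss sg_sqr !mul1r.
  rewrite mul0r !mulr0.
  case: m {div div' le_l h hE G} cocyc deg0 Bm => [|m] cocyc deg0 Bm; first exact: deg0.
  have := cocyc 0%N isT; rewrite /zigzag_down (negPf Al) mul0r add0r /= subn0.
  move: Bm; rewrite BS negbK => -> E.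
  by rewrite -[F 0%N]mul1r -(sg_sqr 0) -mulrA -[F 0%N]mul1r E mulr0.
have Al' : A l.+1 by move: Al; rewrite AS negbK.
rewrite (ltnW le_l) Al' /=.
have := cocyc l le_l; rewrite /zigzag_down Al' mul1r (prednK (leq_ltn_trans (leq0n l) le_l)).
rewrite subSS sgS (hE l) ?(ltnW le_l) /down_index ?Al' // => /eqP.
rewrite addr_eq0 => /eqP ->.
transitivity (s * s * (p * (- sg l * ((B (m - l))%:R * h l)))); last by ring.
by rewrite ss mul1r; ring.
Qed.

Lemma zigzag_down_lift m (c : nat -> R) : exists F, [/\ forall k, (m < k)%N -> F k = 0,
   forall l, (l < m)%N -> zigzag_down m.-1 F l = 0,
   m = 0%N -> ~~ A 1 -> ~~ B 1 -> F 0%N = 0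
   & forall l, (l <= m)%N -> down_index m l -> F l = c l].
Proof.
pose c' k := if (k <= m)%N && down_index m k then c k else 0.
pose F l := if (l <= m)%N then (if A l.+1 || (l == 0%N) then c' l
   else sg l * ((B (m.+1 - l))%:R * c' l.-1)) else 0.
exists F; split=> [k lt_mk|l lt_l|m0 nA nB|l le_l Il].
- by rewrite /F leqNgt lt_mk.
- have m_gt0 := leq_ltn_trans (leq0n l) lt_l.
  rewrite /zigzag_down (prednK m_gt0) /F lt_l (ltnW lt_l) /=.
  case: (boolP (A l.+1)) => Al.
    by rewrite AS Al /= subSS sgS mul1r mulNr addNr.
  rewrite mul0r add0r; case: l lt_l Al => [|l] lt_l Al.
    rewrite subn0 /= /c' /down_index (negPf Al) /= BS.
    by case: (B m); rewrite /= ?mul0r ?mulr0.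
  rewrite /= subSS -(subnSK (ltnW lt_l)) !BS.
  by case: (B (m - l.+1)); rewrite /= ?mul0r ?mulr0 ?mul0r ?mulr0.
- by rewrite /F leq0n orbT /c' /down_index (negPf nA) m0 (negPf nB).
- rewrite /F le_l; case: ifP => [_|]; first by rewrite /c' le_l Il.
  by move: Il; rewrite /down_index => /orP[->|/andP[-> _]]; rewrite ?orbT.
Qed.

End ZigZag.

(** * Cohomology of the rank one lattices *)

Section CharacterCohomology.
Variables (R : idomainType) (p : R).
Hypothesis p0 : p != 0.
Variables a b : bool.
Local Notation T := (tensor_resolution p0).
Local Notation M := (Rchar p a b).

Let A (j : nat) := odd j != a.
Let B (j : nat) := odd j != b.
Let sgn (c : bool) : R := if c then 1 else -1.
(** The x-part of the differential is p s times a 0-1 matrix. The y-part has sign [sgn b] = s t, so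
    that p s is a common factor and t remains. *)
Let s := sgn a.
Let t := sgn a * sgn b.

Let AS j : A j.+1 = ~~ A j. Proof. by rewrite /A /=; case: odd; case: a. Qed.
Let BS j : B j.+1 = ~~ B j. Proof. by rewrite /B /=; case: odd; case: b. Qed.
Let sgn_sqr c : sgn c * sgn c = 1. Proof. by rewrite /sgn; case: c; rewrite ?mulrNN mulr1. Qed.
Let ss : s * s = 1. Proof. exact: sgn_sqr. Qed.
Let tsq : t * t = 1. Proof. by rewrite /t mulrACA !sgn_sqr mulr1. Qed.

Let pzB c (j : nat) : pz p c - pz p (odd j) = p * (sgn c * (odd j != c)%:R).
Proof.
by rewrite /pz /sgn; case: c; case: odd; rewrite /= ?subrr ?subr0 ?sub0r ?mulr0 ?mulr1 ?mulrN1.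
Qed.

Let scaled_eq0 z : p * (s * z) = 0 -> z = 0.
Proof.
move/eqP; rewrite mulf_eq0 (negPf p0) => /eqP E.
by rewrite -[z]mul1r -ss -mulrA E mulr0.
Qed.

Let pick r (f : 'I_r -> R) c k :
  \sum_(l < r) (if (l : nat) == k then c * f l else 0) = c * nat_ext f k.
Proof.
by rewrite -nat_ext_pick mulr_sumr; apply: eq_bigr => l _; case: ifP; rewrite ?mulr0.
Qed.

Let chi_tensor m (j l : nat) :
  chi a b ((if j == l.+1 then dx p j else 0) + (if j == l then (-1) ^+ j * dy p (m.+1 - j) else 0))
  = p * (s * ((if j == l.+1 then (A j)%:R else 0)
         + (if j == l then (-1) ^+ j * t * (B (m.+1 - j))%:R else 0))).
Proof.
have E1 : chi a b (if j == l.+1 then dx p j else 0) = p * (s * (if j == l.+1 then (A j)%:R else 0)).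
  by case: eqP => _; rewrite ?rmorph0 ?mulr0 // chi_dx pzB.
have E2 : chi a b (if j == l then (-1) ^+ j * dy p (m.+1 - j) else 0)
    = p * (s * (if j == l then (-1) ^+ j * t * (B (m.+1 - j))%:R else 0)).
  case: eqP => _; rewrite ?rmorph0 ?mulr0 // rmorphM /= rmorphXn /= rmorphN rmorph1.
  rewrite chi_dy pzB /t -/s -[(_ != b)]/(B (m.+1 - j)).
  transitivity ((s * s) * ((-1) ^+ j * (p * (sgn b * (B (m.+1 - j))%:R)))); last by ring.
  by rewrite ss mul1r.
by rewrite (rmorphD (chi a b)) /= E1 E2 !mulrDr.
Qed.

Lemma delta_up m (f : cochain T M (Posz m)) j :
  delta f j = p * (s * zigzag_up A B t m (nat_ext (f : 'I_(tensor_rank m) -> R)) j) :> R.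
Proof.
rewrite deltaE.
transitivity (\sum_(l < tensor_rank m) chi a b (tensor_mx p m j l) * (f l : R)); first by [].
transitivity (p * (s * (\sum_(l < tensor_rank m)
   ((if (j : nat) == l.+1 then (A j)%:R * (f l : R) else 0)
  + (if (l : nat) == j then (-1) ^+ j * t * (B (m.+1 - j))%:R * (f l : R) else 0))))).
  rewrite !mulr_sumr; apply: eq_bigr => l _.
  rewrite mxE chi_tensor [(l : nat) == j]eq_sym -(mulrA p) -(mulrA s) mulrDl.
  by congr (_ * (_ * (_ + _))); case: eqP => _; rewrite ?mul0r.
congr (_ * (_ * _)); rewrite big_split /= pick /zigzag_up [in RHS]mulrA.
congr (_ + _).
case: (j : nat) => [|k]; first by rewrite big1.
by rewrite -pick; apply: eq_bigr => l _; rewrite eqSS eq_sym.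
Qed.

Lemma delta_down m (f : cochain T M (Negz m.+1)) l :
  delta f l = p * (s * zigzag_down A B t m (nat_ext (f : 'I_(tensor_rank m.+1) -> R)) l) :> R.
Proof.
rewrite deltaE.
transitivity (\sum_(j < tensor_rank m.+1) chi a b (tensor_mx p m j l) * (f j : R)).
  by apply: eq_bigr => j _; rewrite mxE.
transitivity (p * (s * (\sum_(j < tensor_rank m.+1)
   ((if (j : nat) == l.+1 then (A l.+1)%:R * (f j : R) else 0)
  + (if (j : nat) == l then (-1) ^+ l * t * (B (m.+1 - l))%:R * (f j : R) else 0))))).
  rewrite !mulr_sumr; apply: eq_bigr => j _; rewrite mxE chi_tensor.
  rewrite -(mulrA p) -(mulrA s) mulrDl.
  by congr (_ * (_ * (_ + _))); case: eqP => [->|_]; rewrite ?mul0r.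
by congr (_ * (_ * _)); rewrite big_split /= !pick /zigzag_down !mulrA.
Qed.

Lemma delta_norm (f : cochain T M (Negz 0)) j :
  delta f j = pz p a * pz p b * (f ord0 : R) :> R.
Proof.
rewrite deltaE big_ord_recl big_ord0 addr0 mxE (ord1 j) mulr1n.
by rewrite -[LHS]/(chi a b _ * (f ord0 : R)) rmorphM /= chi_x chi_y.
Qed.

Let nat_ext_row r (F : nat -> R) : (forall k, (r <= k)%N -> F k = 0) ->
  nat_ext (fun k : 'I_r => F k) = F.
Proof.
move=> F0; apply/funext => k; have [le|lt] := leqP r k.
  by rewrite nat_ext_out ?F0.
by rewrite -[k]/(val (Ordinal lt)) nat_extE.
Qed.

Let ext_finfun r (F : nat -> R) : (forall k, (r <= k)%N -> F k = 0) ->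
  nat_ext ([ffun k : 'I_r => F k] : {ffun 'I_r -> R}) = F.
Proof.
move=> F0; rewrite -[RHS](nat_ext_row F0); congr nat_ext.
by apply/funext => k; rewrite ffunE.
Qed.

Lemma tate_character_pos n : lmod_iso (tate_succ T M (Posz n))
  (cyclic_pow p #|[pred k : 'I_n.+2 | up_index A B n.+1 k]|).
Proof.
rewrite -card_sig.
apply: (@homology_cyclic_pow _ _ _ _ _ _ _ _
   (fun k (f : cochain T M (Posz n.+1)) => (f (val k) : R))).
- by move=> i c u v; rewrite !ffunE; congr (_ + _); rewrite -[LHS]/(chi a b c%:K * _) chi_C.
- move=> z; pose c := nat_ext (fun j : 'I_n.+2 => if insub j is Some i then z i else 0).
  have [F [F0 cocyc Fc]] := zigzag_up_lift t AS BS n.+1 c.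
  exists ([ffun k : 'I_n.+2 => F k] : {ffun 'I_n.+2 -> restr M}).
    apply/ffunP => j; rewrite [RHS]ffunE [LHS]delta_up ext_finfun // cocyc ?mulr0 //.
    by rewrite -ltnS; apply: ltn_ord.
  move=> i; exists 0; rewrite mulr0 addr0; have Ii : up_index A B n.+1 (val i) by exact: (valP i).
  transitivity (F (val i)); first exact: ffunE.
  have lt_i : (val i <= n.+1)%N by rewrite -ltnS; exact: (ltn_ord (val i)).
  by rewrite (Fc _ lt_i Ii) /c nat_extE valK.
- move=> f df; have {}df j : (j <= n.+2)%N ->
      zigzag_up A B t n.+1 (nat_ext (f : 'I_n.+2 -> R)) j = 0.
    move=> le_j; apply: scaled_eq0.
    have := congr1 (fun h : cochain T M (Posz n.+2) => (h (Ordinal (le_j : (j < n.+3)%N)) : R)) df.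
    by rewrite [in LHS]/= delta_up ffunE.
  split=> [[e <-] i|div].
    by eexists; rewrite [LHS]delta_up; reflexivity.
  have [|j le_j Ij|G [G0 GE]] := zigzag_up_bounds p0 AS BS ss tsq _ df.
  + by move=> k lt_k; apply: nat_ext_out.
  + rewrite -[j]/(val (Ordinal (le_j : (j < n.+2)%N))) nat_extE.
    have [c cE] := div (exist _ (Ordinal (le_j : (j < n.+2)%N)) Ij).
    by exists c.
  exists ([ffun k : 'I_(tensor_rank n) => G k] : {ffun 'I_(tensor_rank n) -> restr M}); apply/ffunP => j.
  rewrite [LHS]delta_up ext_finfun; last by rewrite tensor_rankE.
  have := GE j; rewrite -ltnS (ltn_ord j) (nat_extE (f : 'I_n.+2 -> R)).
  by move=> /(_ isT) ->.
Qed.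

Let neg_cocycle m (f : cochain T M (Negz m)) : delta f = 0 <->
  (forall l, (l < m)%N -> zigzag_down A B t m.-1 (nat_ext (f : 'I_(tensor_rank m) -> R)) l = 0)
  /\ (m = 0%N -> ~~ A 1 -> ~~ B 1 -> nat_ext (f : 'I_(tensor_rank m) -> R) 0%N = 0).
Proof.
case: m f => [|m] f.
  have f0 : nat_ext (f : 'I_1 -> R) 0%N = f ord0 by rewrite -(nat_extE (f : 'I_1 -> R) ord0).
  split=> [df|[_ h]].
    split=> // _; rewrite /A /B f0 /= => nA nB.
    have := congr1 (fun h : cochain T M (Posz 0) => (h ord0 : R)) df.
    rewrite [in LHS]/= delta_norm [in RHS]ffunE.
    move: nA nB; rewrite /pz; case: (a); case: (b) => //= _ _ /eqP.
    by rewrite !mulf_eq0 (negPf p0) => /eqP.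
  apply/ffunP => j; rewrite [LHS]delta_norm [RHS]ffunE.
  move: h; rewrite /A /B /pz f0; case: (a); case: (b) => //= h; rewrite ?mul0r ?mulr0 ?mul0r //.
  by rewrite h ?mulr0.
split=> [df|[h _]].
  split=> // l lt_l; apply: scaled_eq0.
  have lt_l' : (l < tensor_rank m)%N by rewrite tensor_rankE.
  have := congr1 (fun h : cochain T M (Negz m) => (h (Ordinal lt_l') : R)) df.
  by rewrite [in LHS]/= delta_down ffunE.
apply/ffunP => j; rewrite [LHS]delta_down [RHS]ffunE h ?mulr0 //.
have := ltn_ord j; rewrite [X in (_ < X)%N](tensor_rankE m); exact.
Qed.

Lemma tate_character_neg m : lmod_iso (tate_succ T M (Negz m.+1))
  (cyclic_pow p #|[pred k : 'I_m.+1 | down_index A B m k]|).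
Proof.
rewrite -card_sig.
have lt_rank (k : nat) : (k < m.+1)%N -> (k < tensor_rank m)%N by rewrite tensor_rankE.
pose cast (k : 'I_m.+1) : 'I_(tensor_rank m) := Ordinal (lt_rank k (ltn_ord k)).
apply: (@homology_cyclic_pow _ _ _ _ _ _ _ _
   (fun k (f : cochain T M (Negz m)) => (f (cast (val k)) : R))).
- by move=> i c u v; rewrite !ffunE; congr (_ + _); rewrite -[LHS]/(chi a b c%:K * _) chi_C.
- move=> z; pose c := nat_ext (fun j : 'I_m.+1 => if insub j is Some i then z i else 0).
  have [F [F0 cocyc deg0 Fc]] := zigzag_down_lift t AS BS m c.
  exists ([ffun k : 'I_(tensor_rank m) => F k] : {ffun 'I_(tensor_rank m) -> restr M}).
    by apply/neg_cocycle; rewrite ext_finfun // tensor_rankE.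
  move=> i; exists 0; rewrite mulr0 addr0; have Ii : down_index A B m (val i) by exact: (valP i).
  transitivity (F (val i)); first exact: ffunE.
  have lt_i : (val i <= m)%N by rewrite -ltnS; exact: (ltn_ord (val i)).
  by rewrite (Fc _ lt_i Ii) /c nat_extE valK.
- move=> f /neg_cocycle [df df0].
  split=> [[e <-] i|div].
    by eexists; rewrite [LHS]delta_down; reflexivity.
  have [l le_l Il|G [G0 GE]] := zigzag_down_bounds (p := p) AS BS ss tsq df df0.
  + have lt_l : (l < m.+1)%N by [].
    rewrite -[l]/(val (cast (Ordinal lt_l))) (nat_extE (f : 'I_(tensor_rank m) -> R)).
    by have [c cE] := div (exist _ (Ordinal lt_l) Il); exists c.
  exists ([ffun k : 'I_(tensor_rank m.+1) => G k] : {ffun 'I_(tensor_rank m.+1) -> restr M}).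
  apply/ffunP => j; rewrite [LHS]delta_down ext_finfun //.
  have := GE j; rewrite (nat_extE (f : 'I_(tensor_rank m) -> R)) => <- //.
  by have := ltn_ord j; rewrite [X in (_ < X)%N](tensor_rankE m).
Qed.

Let cocycle0 (f : cochain T M (Posz 0)) : delta f = 0 -> ~~ (a && b) -> f = 0.
Proof.
move=> df nab; apply/ffunP => j; rewrite [RHS]ffunE (ord1 j).
have E k : zigzag_up A B t 0 (nat_ext (f : 'I_1 -> R)) (k : 'I_2) = 0.
  apply: scaled_eq0.
  have := congr1 (fun h : cochain T M (Posz 1) => (h k : R)) df.
  by rewrite [in LHS]/= delta_up ffunE.
have f0 : nat_ext (f : 'I_1 -> R) 0%N = f ord0 by rewrite -(nat_extE (f : 'I_1 -> R) ord0).
have f1 : nat_ext (f : 'I_1 -> R) 1%N = 0 by rewrite nat_ext_out.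
have := E 0; have := E 1; rewrite /zigzag_up /= f1 f0 !mulr0 addr0 add0r expr0 mul1r.
move: nab; rewrite /A /B /= /t /sgn; case: (a); case: (b) => //= _; rewrite ?mul1r ?mul0r ?mulr0.
- by move=> _ /eqP; rewrite mulN1r oppr_eq0 => /eqP.
- by move=> ->.
- by move=> ->.
Qed.

(** One of x - p, y - p acts on the lattice as -p, so no nonzero element is a cocycle in degree
    0. *)
Lemma tate_character0 : ~~ (a && b) -> lmod_iso (tate_succ T M (Negz 0)) (cyclic_pow p 0).
Proof.
move=> nab; have -> : cyclic_pow p 0 = cyclic_pow p #|{: void}| by rewrite card_void.
apply: (@homology_cyclic_pow _ _ _ _ _ _ _ void (fun k (f : cochain T M (Posz 0)) => (f ord0 : R))).
- by case.
- move=> z; exists 0; first exact: linear0.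
  by case.
- move=> f df; rewrite (cocycle0 df nab); split=> [_ []|_].
  by exists 0; apply: linear0.
Qed.

(** Here x - p and y - p act as zero, so every element is a cocycle, while xy acts as p^2. *)
Lemma tate_trivial_character0 : a && b ->
  lmod_iso (tate_succ T M (Negz 0)) (cyclic_mod (p ^+ 2)).
Proof.
move=> /andP [a1 b1].
have dE (f : cochain T M (Negz 0)) : delta f ord0 = p ^+ 2 * (f ord0 : R) :> R.
  by rewrite delta_norm a1 b1 /= expr2.
apply: (@homology_cyclic _ _ _ _ _ _ _ (fun (f : cochain T M (Posz 0)) => (f ord0 : R))).
- by move=> c u v; rewrite !ffunE; congr (_ + _); rewrite -[LHS]/(chi a b c%:K * _) chi_C.
- move=> z; exists ([ffun k : 'I_1 => z] : {ffun 'I_1 -> restr M}); last exact: ffunE.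
  apply/ffunP => j; rewrite [LHS]delta_up [RHS]ffunE.
  rewrite /zigzag_up /A /B a1 b1.
  by case: j => [[|[|//]] lt_j] /=; rewrite ?[nat_ext _ 1]nat_ext_out // ?(mul0r, mulr0, addr0).
- move=> f df; split=> [[e <-]|[c cE]]; first by exists (e ord0); exact: dE.
  exists ([ffun k : 'I_1 => c] : {ffun 'I_1 -> restr M}); apply/ffunP => j.
  by rewrite (ord1 j) [LHS]dE ffunE.
Qed.

End CharacterCohomology.

(** * The over-ring A *)

Section OverRing.
Variables (R : idomainType) (p : R).
Hypothesis p0 : p != 0.
Local Notation K := (K p).
Local Notation x := (xK p).
Local Notation y := (yK p).

Lemma basis_of_bijection (M : lmodType K) n (f : ('I_n -> R) -> M) (g : 'I_n -> M -> R) :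
  (forall i c u v, g i (c%:K *: u + v) = c * g i u + g i v) ->
  (forall m, f (fun i => g i m) = m) -> (forall c i, g i (f c) = c i) ->
  basis_on (fun i => f (fun j => (j == i)%:R)) g.
Proof.
move=> glin fg gf.
have ginj u v : (forall i, g i u = g i v) -> u = v.
  by move=> E; rewrite -[u]fg -[v]fg; congr f; apply/funext.
split=> [//|m|i j]; last by rewrite gf.
apply: ginj => j.
have gD u v : g j (u + v) = g j u + g j v.
  by have := glin j 1 u v; rewrite rmorph1 scale1r mul1r.
have g0 : g j 0 = 0 by apply: (addrI (g j 0)); rewrite -gD !addr0.
have gZ c u : g j (c%:K *: u) = c * g j u.
  by have := glin j c u 0; rewrite g0 !addr0.
rewrite (big_morph (g j) gD g0) (bigD1 j) //= gZ gf eqxx mulr1 big1 ?addr0 //.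
by move=> i ne_ij; rewrite gZ gf eq_sym (negPf ne_ij) mulr0.
Qed.

Lemma Rchar_lattice a b : lattice (Rchar p a b).
Proof.
apply: (basis_lattice (e := fun i : 'I_1 => (fun c : 'I_1 -> R => c ord0 : Rchar p a b) (fun j => (j == i)%:R))
  (co := fun _ m => m)).
apply: (@basis_of_bijection (Rchar p a b) 1 (fun c => c ord0)) => // [i c u v|c i].
  by rewrite -[c%:K *: u]/(chi a b c%:K * _) chi_C.
by rewrite (ord1 i).
Qed.

Lemma tofracI (a b : R) : tofrac a = tofrac b -> a = b.
Proof. by move/eqP; rewrite tofrac_eq => /eqP. Qed.

(* The element f0 + f1 x + f2 y + f3 z of Q^4. *)
Definition A_value (f : 'I_4 -> R) : Q4 p :=
  mkQ4 (f 0 + f 1 * p + f 2%:R * p + f 3%:R * p) (f 0 + f 1 * p) (f 0 + f 2%:R * p) (f 0).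

Lemma A_value_inj (f g : 'I_4 -> R) : A_value f = A_value g -> f =1 g.
Proof.
case=> /tofracI E1 /tofracI E2 /tofracI E3 /tofracI E4.
move: E1 E2 E3; rewrite E4 -!addrA => /addrI E1 /addrI E2 /addrI E3.
move: E1; rewrite E2 E3 => /addrI/addrI E1 i.
have pI u v : u * p = v * p -> u = v by apply: mulIf.
have := (pI _ _ E1, pI _ _ E2, pI _ _ E3) => -[[h1 h2] h3].
by case: i => [[|[|[|[|//]]]] lt_i]; [move: E4|move: h2|move: h3|move: h1];
  congr (_ = _); congr (_ _); apply: val_inj.
Qed.

Lemma Q4_value (f : 'I_4 -> R) : A_value f =
  Kembed (((f 0)%:K + (f 1)%:K * x + (f 2%:R)%:K * y + 0%:K * (x * y)) : K)
  + Kembed ((f 3%:R)%:K : K) * zQ4 p.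
Proof.
rewrite /Kembed !chi_basis !chi_C /zQ4 /mkQ4 /pz.
congr (_, _, _, _); rewrite /= -?rmorphM -?rmorphD /=; congr tofrac; ring.
Qed.

(** In Q^4 one has xy = pz, so the xy-coefficient of u contributes p times itself to the coordinate
    on z. That coordinate modulo p therefore detects A/K. *)
Lemma A_value_form (u : K) (r : R) : exists2 f, Kembed u + Kembed (r%:K : K) * zQ4 p = A_value f
  & f 3%:R = p * topcoef u + r.
Proof.
have [a [b [c [d uE]]]] := K_basis u.
exists (fun i => nth 0 [:: a; b; c; p * d + r] i); last first.
  by rewrite [LHS]/=; congr (_ * _ + _); apply: (mulfI (expf_neq0 2 p0));
    rewrite topcoefE uE !chi_basis /pz; ring.
rewrite uE /Kembed !chi_basis !chi_C /A_value /zQ4 /mkQ4 /pz.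
congr (_, _, _, _); rewrite /= -?rmorphM -?rmorphD /=; congr tofrac; ring.
Qed.

Fact A_of_subproof f : in_A (A_value f).
Proof.
rewrite Q4_value; apply/asboolP.
by eexists; eexists; reflexivity.
Qed.

Definition A_of (f : 'I_4 -> R) : A p := exist _ (A_value f) (A_of_subproof f).

Fact A_coord_exists (v : A p) : exists f, A_of f = v.
Proof.
have /asboolP [u [r E]] := valP v; have [f fE _] := A_value_form u r.
by exists f; apply: val_inj; rewrite /= -fE -E.
Qed.

Definition A_coord (i : 'I_4) (v : A p) : R := sval (cid (A_coord_exists v)) i.

Lemma A_coordK v : A_of (A_coord ^~ v) = v.
Proof. exact: (svalP (cid (A_coord_exists v))). Qed.

Lemma A_ofK f i : A_coord i (A_of f) = f i.
Proof.
have /(congr1 val) /= := A_coordK (A_of f).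
by move=> /A_value_inj; apply.
Qed.

Lemma A_coord_linear i c u v : A_coord i (c%:K *: u + v) = c * A_coord i u + A_coord i v.
Proof.
rewrite -[RHS](A_ofK (fun i => c * A_coord i u + A_coord i v)); congr A_coord.
apply: val_inj; rewrite linearP /= -{1}[u]A_coordK -{1}[v]A_coordK /=.
rewrite -[_ *: _]/(Kembed (c%:K : K) * _) /Kembed !chi_C /A_value /mkQ4.
congr (_, _, _, _); rewrite /= -?rmorphM -?rmorphD /=; congr tofrac; ring.
Qed.

Lemma A_lattice : lattice (A p).
Proof.
exact: basis_lattice (basis_of_bijection A_coord_linear A_coordK A_ofK).
Qed.

Fact Kembed_in_A (u : K) : in_A (Kembed u : Q4 p).
Proof. by apply/asboolP; exists u, 0; rewrite rmorph0 (rmorph0 (@Kembed R p)) mul0r addr0. Qed.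

Definition K_to_A (w : Kfree p 1) : A p := exist _ (Kembed (w ord0 : K) : Q4 p) (Kembed_in_A _).

Lemma K_to_A_linear : linear K_to_A.
Proof.
move=> a u v; apply: val_inj; rewrite linearP /= !ffunE.
by rewrite (rmorphD (@Kembed R p)) (rmorphM (@Kembed R p)).
Qed.

Lemma K_to_A_inj : injective K_to_A.
Proof.
move=> u v /(congr1 val) /= [/tofracI E1 /tofracI E2 /tofracI E3 /tofracI E4].
apply/ffunP => i; rewrite (ord1 i).
by apply: (chi_inj p0) => -[] [].
Qed.

Lemma K_to_A_image (v : A p) : (exists w, K_to_A w = v) <-> exists b, A_coord 3%:R v = p * b.
Proof.
split=> [[w <-]|[b bE]].
  have [f fE f3] := A_value_form (w ord0 : K) 0.
  exists (topcoef (w ord0 : K)); rewrite addr0 in f3; rewrite -f3 -[RHS]A_ofK.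
  congr A_coord; apply: val_inj; rewrite /= -fE.
  by rewrite rmorph0 (rmorph0 (@Kembed R p)) mul0r addr0.
pose f i := A_coord i v.
exists [ffun=> ((f 0)%:K + (f 1)%:K * x + (f 2%:R)%:K * y + b%:K * (x * y)) : K^o].
rewrite -[RHS]A_coordK; apply: val_inj; rewrite /= ffunE /A_value bE -/(f 0) -/(f 1) -/(f 2%:R).
rewrite /Kembed !chi_basis /mkQ4 /pz.
congr (_, _, _, _); congr tofrac; ring.
Qed.

(* The hypothesis says that u lies in the radical of K. *)
Lemma radical_scale_A (u : K) (v : A p) : (exists c, chi true true u = p * c) ->
  exists w, K_to_A w = u *: v.
Proof.
move=> [c uE]; have /asboolP [k [r E]] := valP v.
(* On z the element u acts as its value pc, and u (rz) = cr (pz) = cr xy lies in K. *)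
exists [ffun=> (u * k + (c * r)%:K * (x * y)) : K^o]; apply: val_inj; rewrite /= ffunE E.
have -> : u *: (Kembed k + Kembed (r%:K : K) * zQ4 p : Q4 p)
    = Kembed (u * k) + Kembed ((p * c * r)%:K : K) * zQ4 p.
  transitivity (Kembed u * (Kembed k + Kembed (r%:K : K) * zQ4 p)); first by [].
  have KM (a b : K) : Kembed a * Kembed b = Kembed (a * b) by rewrite (rmorphM (@Kembed R p)).
  rewrite mulrDr mulrA (KM u k) (KM u (r%:K)) (Kembed_z (u * r%:K)).
  by have -> : chi true true (u * r%:K) = p * c * r by rewrite rmorphM /= chi_C uE.
rewrite (rmorphD (@Kembed R p)); congr (_ + _).
rewrite /= /Kembed !chi_mul !chi_C !chi_x !chi_y /zQ4 /mkQ4 /pz.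
congr (_, _, _, _); rewrite /= -?rmorphM -?rmorphD /=; congr tofrac; ring.
Qed.

Lemma tensor_full_d_radical i j l :
  exists c, chi true true (full_d (tensor_resolution p0) i j l) = p * c.
Proof.
have entry n j' l' : exists c, chi true true (tensor_mx p n j' l') = p * c.
  rewrite mxE rmorphD /=.
  have [c1 ->] : exists c, chi true true (if (j' : nat) == l'.+1 then dx p j' else 0) = p * c.
    case: eqP => _; last by exists 0; rewrite rmorph0 mulr0.
    by rewrite chi_dx /pz; case: odd; [exists 0 | exists 1]; ring.
  have [c2 ->] : exists c, chi true true
      (if (j' : nat) == l' then (-1) ^+ j' * dy p (n.+1 - j') else 0) = p * c.
    case: eqP => _; last by exists 0; rewrite rmorph0 mulr0.
    rewrite rmorphM /= chi_dy /pz; case: odd; first by exists 0; ring.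
    by exists (chi true true ((-1) ^+ j' : K)); ring.
  by exists (c1 + c2); rewrite mulrDr.
case: i j l => [n|[|n]] j l; [exact: entry | | by rewrite mxE; exact: entry].
rewrite mxE (ord1 j) (ord1 l) mulr1n rmorphM /= chi_x chi_y.
by exists p.
Qed.

(* K is acyclic and A/K = R/p, so A has the cohomology of R/p; on R/p the
   differentials vanish, the resolution being minimal. *)
Lemma tate_overring (hR : complete_dvr p) i : lmod_iso (tate_succ (tensor_resolution p0) (A p) i)
  (cyclic_pow p (full_rank (tensor_resolution p0) (int_succ i))).
Proof.
set T := tensor_resolution p0.
have [k kE] := linear_bundle K_to_A_linear.
have kinj : injective k by move=> u v; rewrite !kE => /K_to_A_inj.
have AD u v : A_coord 3%:R (u + v) = A_coord 3%:R u + A_coord 3%:R v.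
  by have := A_coord_linear 3%:R 1 u v; rewrite rmorph1 scale1r mul1r.
have A0 : A_coord 3%:R 0 = 0.
  by apply: (addrI (A_coord 3%:R 0)); rewrite -AD !addr0.
have delta_div m (f : cochain T (A p) m) j : exists b, A_coord 3%:R (delta f j) = p * b.
  rewrite deltaE (big_morph _ AD A0).
  have ex l : exists b, A_coord 3%:R (full_d T m j l *: (f l : A p)) = p * b.
    by apply/K_to_A_image/radical_scale_A; exact: tensor_full_d_radical.
  have [b bE] := choice ex.
  by exists (\sum_l b l); rewrite mulr_sumr; apply: eq_bigr => l _.
have lift m (f : cochain T (A p) m) : (forall j, exists b, A_coord 3%:R (f j) = p * b) ->
    exists g, cochain_map k g = f.
  move=> h; have ex j : exists w, k w = f j.
    by have /K_to_A_image [w wE] := h j; exists w; rewrite kE.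
  have [s sE] := choice ex.
  by exists [ffun j => s j]; apply/ffunP => j; rewrite !ffunE sE.
have kI m := @cochain_map_inj _ _ T _ _ k m kinj.
rewrite -[full_rank T _]card_ord.
apply: (@homology_cyclic_pow _ _ _ _ _ _ _ 'I_(full_rank T (int_succ i))
   (fun j (f : cochain T (A p) (int_succ i)) => A_coord 3%:R (f j))).
- by move=> j c u v; rewrite !ffunE; apply: A_coord_linear.
- move=> z; pose f : cochain T (A p) (int_succ i) :=
    [ffun j => A_of (fun l => if l == 3%:R then z j else 0)].
  (* The coboundary of [f] takes values in K and is a cocycle there, hence the coboundary of some
     K-valued [e]. Subtracting [e] makes [f] a cocycle and changes the z-coordinates only by
     multiples of p. *)
  have [g gE] := lift _ (delta f) (delta_div _ f).
  have [|e eE] := Kfree_acyclic hR (f := g).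
    by apply: kI; rewrite -delta_cochain_map gE delta_delta // cochain_map0.
  exists (f - cochain_map k e).
    by rewrite linearB /= delta_cochain_map eE gE subrr.
  move=> j; have /K_to_A_image [b bE] : exists w, K_to_A w = cochain_map k e j.
    by exists (e j); rewrite ffunE kE.
  exists (- b); rewrite mulrN -bE; apply/eqP; rewrite eq_sym subr_eq -AD; apply/eqP.
  rewrite -[z j](A_ofK (fun l => if l == 3%:R then z j else 0) 3%:R); congr A_coord.
  by rewrite [X in X + _]ffunE [X in _ + X + _]ffunE subrK ffunE.
- move=> f df; split=> [[e <-] j|/lift [g gE]]; first exact: delta_div.
  have [|e eE] := Kfree_acyclic hR (f := g).
    by apply: kI; rewrite -delta_cochain_map gE df cochain_map0.
  by exists (cochain_map k e); rewrite /= delta_cochain_map eE.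
Qed.

End OverRing.

(** * Injective endomorphisms of R/p^2 and (R/p)^n *)

Section CoHopfian.
Variables (R : idomainType) (p : R).
Hypothesis hR : complete_dvr p.
Let p0 : p != 0 := dvr_p_neq0 hR.

Lemma dvr_unit_or_divides (a : R) : a \is a GRing.unit \/ exists b, a = p * b.
Proof.
case: hR => _ _ val _.
have [->|a0] := eqVneq a 0; first by right; exists 0; rewrite mulr0.
have [[|n] [u uu ->]] := val a a0; first by left; rewrite mulr1.
by right; exists (u * p ^+ n); rewrite exprS mulrCA.
Qed.

(** The endomorphism is multiplication by some a. If p divided a, the class of p would be killed,
    yet p is not a multiple of p^2. So a is a unit. *)
Lemma cyclic_mod_sqr_coHopfian (f : {linear cyclic_mod (p ^+ 2) -> cyclic_mod (p ^+ 2)}) :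
  injective f -> forall v, exists u, f u = v.
Proof.
move=> finj v; pose pi (a : R) := lmod_pi (multiples_submod (p ^+ 2)) (a : R^o).
have piZ c a : c *: pi a = pi (c * a) by rewrite /pi -linearZ.
have [a aE] : exists a, f (pi 1) = pi a.
  by exists (generic_quotient.repr (f (pi 1))); rewrite /pi lmod_piK.
have fE c : f (pi c) = pi (c * a) by rewrite -[c in LHS]mulr1 -piZ linearZ /= aE piZ.
have [au|[b bE]] := dvr_unit_or_divides a; last first.
  have : pi p = 0.
    apply: finj; rewrite fE linear0 bE mulrA -expr2.
    by apply/cyclic_pi0; exists b.
  move=> /cyclic_pi0 [c pE]; case: hR => _ /negP pu _ _; case: pu.
  apply/unitrPr; exists c.
  by apply: (mulfI p0); rewrite mulr1 [RHS]pE expr2 mulrA.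
exists (pi (generic_quotient.repr v * a^-1)); rewrite fE divrK //.
by rewrite /pi lmod_piK.
Qed.

(* If w *m \adj F = v then v *m F = det F *: w, and det F is a unit times a power
   of p, which the hypothesis lets us cancel. *)
Lemma matrix_onto_mod n (F : 'M[R]_n) :
  (forall v : 'rV_n, (exists w, v *m F = p *: w) -> exists w, v = p *: w) ->
  forall w : 'rV_n, exists v, v *m F = w.
Proof.
move=> inj w.
have vZ k : forall v w : 'rV[R]_n, v *m F = p ^+ k *: w -> exists v', v' *m F = w /\ v = p ^+ k *: v'.
  elim: k => [|k IH] v w' E; first by exists v; rewrite E !scale1r.
  have [|v1 v1E] := inj v; first by exists (p ^+ k *: w'); rewrite scalerA -exprS.
  have [|v' [v'F v'E]] := IH v1 w'.
    have := E; rewrite v1E -scalemxAl exprS -scalerA => /matrixP h.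
    by apply/matrixP => i j; have := h i j; rewrite !mxE => /(mulfI p0).
  by exists v'; rewrite v1E v'E scalerA -exprS.
(* By [vZ], a vector killed by F is divisible by every power of p, hence zero. *)
have det_neq0 : \det F != 0.
  apply/negP => /det0P [v v0 vF].
  have [i vi] : exists i, v 0 i != 0.
    apply/existsP; apply: contraNT v0 => /existsPn h; apply/eqP/rowP => i.
    by have := h i; rewrite negbK mxE => /eqP.
  case: (hR) => _ pu val _; have [k [u uu vE]] := val _ vi.
  have [|v' [_ v'E]] := vZ k.+1 v 0; first by rewrite vF scaler0.
  have := vE; rewrite v'E mxE exprSr -mulrA mulrC => /(mulIf (expf_neq0 k p0)) E.
  by case/negP: pu; apply/unitrPr; exists (v' 0 i / u); rewrite mulrA E divrr.
case: (hR) => _ _ val _; have [k [u uu dE]] := val _ det_neq0.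
have [|v' [v'F _]] := vZ k (w *m \adj F) (u *: w).
  by rewrite -mulmxA mul_adj_mx mul_mx_scalar dE scalerA mulrC.
by exists (u^-1 *: v'); rewrite -scalemxAl v'F scalerA mulVr // scale1r.
Qed.

(** Lifted to a matrix over R, injectivity of [f] becomes the hypothesis of [matrix_onto_mod]. *)
Lemma cyclic_pow_coHopfian n (f : {linear cyclic_pow p n -> cyclic_pow p n}) :
  injective f -> forall v, exists u, f u = v.
Proof.
move=> finj v.
pose pi (a : R) : cyclic_mod p := lmod_pi (multiples_submod p) (a : R^o).
have piZ c a : c *: pi a = pi (c * a) by rewrite /pi -linearZ.
pose pis (a : 'rV[R]_n) : cyclic_pow p n := [ffun i => pi (a 0 i)].
have pis_onto z : exists a, pis a = z.
  exists (\row_i generic_quotient.repr (z i)); apply/ffunP => i.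
  by rewrite ffunE mxE /pi lmod_piK.
have pis0 a : pis a = 0 <-> exists w, a = p *: w.
  split=> [E|[w ->]].
    have ex i : exists b, a 0 i = p * b.
      by apply/cyclic_pi0; have := congr1 (fun z : cyclic_pow p n => z i) E; rewrite !ffunE.
    have [b bE] := choice ex.
    by exists (\row_i b i); apply/rowP => i; rewrite !mxE.
  by apply/ffunP => i; rewrite !ffunE; apply/cyclic_pi0; exists (w 0 i); rewrite mxE.
have pisl c a b : pis (c *: a + b) = c *: pis a + pis b.
  by apply/ffunP => i; rewrite !ffunE !mxE /pi -linearP.
have pisD a b : pis (a + b) = pis a + pis b by have := pisl 1 a b; rewrite !scale1r.
have pis00 : pis 0 = 0 by apply/pis0; exists 0; rewrite scaler0.
have pisZ c a : pis (c *: a) = c *: pis a by have := pisl c a 0; rewrite pis00 !addr0.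
have ex i : exists a, pis a = f (pis (delta_mx 0 i)) by exact: pis_onto.
have [r rE] := choice ex.
pose F := \matrix_i r i.
have fE a : f (pis a) = pis (a *m F).
  rewrite {1}[a]row_sum_delta (big_morph pis pisD pis00) linear_sum.
  rewrite mulmx_sum_row (big_morph pis pisD pis00); apply: eq_bigr => i _.
  by rewrite !pisZ linearZ /= -rE rowK.
have [w wE] := pis_onto v.
have [|a aF] := @matrix_onto_mod n F _ w.
  move=> a /pis0; rewrite -fE => E; apply/pis0/finj; by rewrite E linear0.
by exists (pis a); rewrite fE aF.
Qed.

End CoHopfian.

(** * Counting the free coordinates *)

Section Counting.

Lemma card_ord_split (P : nat -> bool) n :
  #|[pred k : 'I_n.+1 | P k]| = (P 0%N + #|[pred k : 'I_n | P k.+1]|)%N.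
Proof.
rewrite -!sum1_card !(big_mkcond (fun i => i \in _)) big_ord_recl /=.
by congr (_ + _)%N; rewrite inE /=; case: (P _).
Qed.

Lemma card_ord_parity c n :
  #|[pred k : 'I_n | odd k == c]| = if c then n./2 else uphalf n.
Proof.
elim: n c => [|n IH] c; first by rewrite eq_card0 ?if_same // => -[].
rewrite (card_ord_split (fun k => odd k == c)).
have -> : #|[pred k : 'I_n | odd k.+1 == c]| = #|[pred k : 'I_n | odd k == ~~ c]|.
  by apply: eq_card => k; rewrite !inE /=; case: odd; case: c.
by rewrite IH; case: c => /=; rewrite ?uphalfE.
Qed.

(** The number of free coordinates in degrees N and -N for N > 0; the two zigzag counts agree. *)
Definition character_rank (a b : bool) (N : nat) : nat :=
  if a && b then (if odd N then N./2 else N./2 + 1)%N else (N + 1)./2.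

Lemma card_up_index a b m :
  #|[pred k : 'I_m.+2 | up_index (fun j => odd j != a) (fun j => odd j != b) m.+1 k]|
  = character_rank a b m.+1.
Proof.
rewrite (card_ord_split (up_index _ _ m.+1)).
have -> : #|[pred k : 'I_m.+1 | up_index (fun j => odd j != a) (fun j => odd j != b) m.+1 k.+1]|
   = #|[pred k : 'I_m.+1 | odd k == a]|.
  by apply: eq_card => k; rewrite !inE /up_index /= andbT; case: odd; case: a.
rewrite card_ord_parity /character_rank /up_index /= addn1 negbK uphalf_half.
by case: a; case: b; case om: (odd m); rewrite ?(addn1, uphalf_half) /= ?uphalf_half ?om ?add1n ?add0n.
Qed.

Lemma card_down_index a b m :
  #|[pred k : 'I_m.+1 | down_index (fun j => odd j != a) (fun j => odd j != b) m k]|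
  = character_rank a b m.+1.
Proof.
rewrite (card_ord_split (down_index _ _ m)).
have -> : #|[pred k : 'I_m | down_index (fun j => odd j != a) (fun j => odd j != b) m k.+1]|
   = #|[pred k : 'I_m | odd k == ~~ a]|.
  by apply: eq_card => k; rewrite !inE /down_index /= orbF negbK; case: odd; case: a.
rewrite card_ord_parity /character_rank /down_index /= addn1 uphalf_half.
by case: a; case: b; case om: (odd m); rewrite ?(addn1, uphalf_half) /= ?uphalf_half ?om ?add1n ?add0n.
Qed.

End Counting.

(** * The cohomology before translation, for an arbitrary resolution *)

Section Values.
Variables (R : idomainType) (p : R).
Hypothesis hR : complete_dvr p.
Let p0 : p != 0 := dvr_p_neq0 hR.
Variable P : resolution p.

Lemma tate_character a b (d : int) : d != 0 ->
  lmod_iso (tate_succ P (Rchar p a b) (d - 1)) (cyclic_pow p (character_rank a b `|d|)).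
Proof.
move=> d0; apply: lmod_iso_trans (tate_comparison hR P (tensor_resolution p0) _ (Rchar_lattice p a b)) _.
case: d d0 => [[|m]|m] // _.
  have -> : Posz m.+1 - 1 = Posz m by rewrite intS addrC addKr.
  rewrite /= -card_up_index; exact: tate_character_pos.
have -> : Negz m - 1 = Negz m.+1 by rewrite !NegzE [in RHS]intS opprD addrC.
rewrite /= -card_down_index; exact: tate_character_neg.
Qed.

Lemma tate_A (d : int) : lmod_iso (tate_succ P (A p) (d - 1))
  (cyclic_pow p (full_rank (tensor_resolution p0) d)).
Proof.
have {2}-> : d = int_succ (d - 1) by rewrite int_succE subrK.
apply: lmod_iso_trans (tate_comparison hR P (tensor_resolution p0) _ (A_lattice p0)) _.
exact: tate_overring.
Qed.

End Values.

Theorem theorem2p5 (R : idomainType) (p : R) (hR : complete_dvr p)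
    (P : resolution p) (n k : int) :
  (forall N : lmodType (K p), is_tau_pow k (A p) N ->
     (k <= n ->
        lmod_iso (tate_cohomology P N n) (cyclic_pow p (absz (n - k + 1)))) /\
     (n < k ->
        lmod_iso (tate_cohomology P N n) (cyclic_pow p `|k - n|%N))) /\
  (forall N : lmodType (K p), is_tau_pow k (Rchar p true true) N ->
     (n - k != 0 -> ~~ odd `|n - k|%N ->
        lmod_iso (tate_cohomology P N n) (cyclic_pow p (`|n - k|%N./2 + 1))) /\
     (odd `|n - k|%N ->
        lmod_iso (tate_cohomology P N n) (cyclic_pow p `|n - k|%N./2)) /\
     (n = k ->
        lmod_iso (tate_cohomology P N n) (cyclic_mod (p ^+ 2)))) /\
  (forall a b : bool, (a, b) != (true, true) ->
     forall N : lmodType (K p), is_tau_pow k (Rchar p a b) N ->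
       lmod_iso (tate_cohomology P N n)
                (cyclic_pow p (`|n - k|%N + 1)./2)).
Proof.
have p0 := dvr_p_neq0 hR.
split=> [N tauN|].
  have iso := tate_tau_pow hR tauN (@cyclic_pow_coHopfian _ _ hR _) (tate_A hR P (n - k)).
  (* The full resolution has rank d + 1 in degree d >= 0 and rank -d in degree d < 0; with d = n - k
     these are the two cases for A. *)
  have rkE d : full_rank (tensor_resolution (dvr_p_neq0 hR)) d = if d is Negz m then m.+1 else `|d|.+1.
    by case: d => m; rewrite /= ?tensor_rankE //; case: m.
  split=> [le_kn|lt_nk]; move: iso; rewrite rkE.
    move: le_kn; rewrite -subr_ge0; case: (n - k) => // m _.
    by rewrite -PoszD addn1.
  rewrite distnC; move: lt_nk; rewrite -subr_lt0; case: (n - k) => // m _; exact.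
split=> [N tauN|a b nab N tauN].
  split=> [d0 ev|]; [|split=> [od|nk]].
  - have := tate_tau_pow hR tauN (@cyclic_pow_coHopfian _ _ hR _) (tate_character hR P true true d0).
    by rewrite /character_rank /= (negPf ev).
  - have d0 : n - k != 0 by apply: contraTneq od => ->.
    have := tate_tau_pow hR tauN (@cyclic_pow_coHopfian _ _ hR _) (tate_character hR P true true d0).
    by rewrite /character_rank /= od.
  - apply: (tate_tau_pow hR tauN (@cyclic_mod_sqr_coHopfian _ _ hR)).
    rewrite nk subrr.
    apply: lmod_iso_trans (tate_comparison hR P (tensor_resolution p0) _ (Rchar_lattice p _ _)) _.
    exact: tate_trivial_character0.
have ab : a && b = false by move: nab; case: (a); case: (b).
(* The count of free coordinates covers nonzero degrees only. In degree 0 the cohomology vanishes,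
   in accordance with [(0 + 1)/2] = 0. *)
have [d0|d0] := eqVneq (n - k) 0.
  apply: (tate_tau_pow hR tauN (@cyclic_pow_coHopfian _ _ hR _)); rewrite d0 /=.
  apply: lmod_iso_trans (tate_comparison hR P (tensor_resolution p0) _ (Rchar_lattice p _ _)) _.
  by apply: tate_character0; rewrite ab.
have := tate_tau_pow hR tauN (@cyclic_pow_coHopfian _ _ hR _) (tate_character hR P a b d0).
by rewrite /character_rank ab.
Qed.
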